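(* Let $m<\infty$, let $R=(\rho_{ij})$ be a positive-definite $m\times m$ correlation matrix, let $\boldsymbol w$ be a fixed simplex weight vector, let $\boldsymbol Z\sim N_m(0,R)$, and let $Y_i=\{1-\Phi(Z_i)\}^{-1}$. With $A=\{i:w_i>0\}$ put $$\rho_*=\max_{i<j,\ i,j\in A}\rho_{ij},\qquad E_*=\{(i,j):i<j,\ i,j\in A,\ \rho_{ij}=\rho_*\}.$$ Suppose $\rho_*>0$ and put $r_*(t)=t^{-q_{\rho_*}}(\log t)^{-\beta_{\rho_*}}$. Assume that for every $(i,j)\in E_*$, $$\lim_{\varepsilon\downarrow0,\,M\uparrow\infty}\limsup_{t\to\infty}r_*(t)^{-1}\,\mathbb E\!\left[|G_{\{i,j\}}(Y_i/t,Y_j/t)|\,\mathbf 1\{(Y_i/t,Y_j/t)\notin[\varepsilon,M]^2\}\right]=0,\tag{a}$$ and that $$\sum_{i<j,\ (i,j)\notin E_*}\left|\mathbb E\,G_{\{i,j\}}(Y_i/t,Y_j/t)\right|+\sum_{I\subseteq A,\ |I|\ge3}\left|\mathbb E\,G_I(\boldsymbol Y_I/t)\right|=o\{r_*(t)\}.\tag{b}$$ Then, as $t\to\infty$, $$\Pr\!\left(\sum_{i=1}^mw_iY_i>t\right)=\frac1t+D_{G,\boldsymbol w}\,t^{-q_{\rho_*}}(\log t)^{-\beta_{\rho_*}}+o\!\left(t^{-q_{\rho_*}}(\log t)^{-\beta_{\rho_*}}\right),$$ $$D_{G,\boldsymbol w}=K_{\rho_*}\,C(a_{\rho_*})\sum_{(i,j)\in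 E_*}(w_iw_j)^{a_{\rho_*}}.$$ For the Half-Cauchy scores $H_i=\cot[\pi\{1-\Phi(Z_i)\}/2]$ and $c=2/\pi$, $$\Pr\!\left(\sum_{i=1}^mw_iH_i>t\right)=\frac ct+c^{q_{\rho_*}}D_{G,\boldsymbol w}\,t^{-q_{\rho_*}}(\log t)^{-\beta_{\rho_*}}+o\!\left(t^{-q_{\rho_*}}(\log t)^{-\beta_{\rho_*}}\right).$$ For two-sided $p$-values $U_i=2\{1-\Phi(|Z_i|)\}$, with $Y_i=1/U_i$ and $H_i=\cot(\pi U_i/2)$, replace $\rho_*$ by $\rho_*^{\mathrm{abs}}=\max_{i<j,\ i,j\in A}|\rho_{ij}|$, replace $E_*$ by the set of pairs $i<j$ in $A$ with $|\rho_{ij}|=\rho_*^{\mathrm{abs}}$, and replace $K_{\rho_*}$ by $2^{1-q_\rho}K_\rho$ evaluated at $\rho=\rho_*^{\mathrm{abs}}$. Then the two expansions hold with these replacements whenever $\rho_*^{\mathrm{abs}}>0$ and the analogues of (a) and (b) hold for the two-sided scores $Y_i$ with these replacements.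
   Context: Simplex weights: $w_i\ge0$, $\sum_iw_i=1$; at least two weights are positive (so $\rho_*$ is defined). $\Phi$ is the standard normal distribution function. For $0<\rho<1$, $$a_\rho=\frac1{1+\rho},\quad q_\rho=2a_\rho,\quad \beta_\rho=1-a_\rho,\quad K_\rho=\frac{(1+\rho)^2}{\sqrt{1-\rho^2}}(4\pi)^{a_\rho-1},$$ and for $1/2<a<1$, $C(a)=-\Gamma(1-a)^2/\Gamma(1-2a)$. For nonempty $I\subseteq\{1,\dots,m\}$ and $\boldsymbol x_I=(x_i)_{i\in I}\in[0,\infty)^I$, the face increment is $G_I(\boldsymbol x_I)=\sum_{\varnothing\neq J\subseteq I}(-1)^{|I|-|J|}\mathbf 1\{\sum_{j\in J}w_jx_j>1\}$. *)

(* Defs.v *)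
From HB Require Import structures.
From mathcomp Require Import all_boot all_order all_algebra.
From mathcomp Require Import all_classical all_reals all_analysis.

Set Implicit Arguments.
Unset Strict Implicit.
Unset Printing Implicit Defensive.

Import Order.TTheory GRing.Theory Num.Theory.
Import numFieldNormedType.Exports.

Local Open Scope classical_set_scope.
Local Open Scope ring_scope.

(* Lets the little-o notations be used at +oo. *)
Canonical pinfty_nbhs_filter_on (R : numFieldType) :=
  FilterType (pinfty_nbhs R) (@filter_filter _ _ proper_pinfty_nbhs).

Section Constants.
Context {R : realType}.
Implicit Types rho a s t : R.

Definition Phi (z : R) : R := fine (normal_prob 0 1 `]-oo, z]).

Definition cot (x : R) : R := cos x / sin x.

Definition Euler_Gamma s : R :=
  fine (\int[lebesgue_measure]_(t in `]0%R, +oo[)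
          ((t `^ (s - 1) * expR (- t))%R)%:E)%E.

(* The Gamma function on the whole line: for s <= 0 the Euler integral diverges
   and Gamma is extended by the functional equation, s + n being the first
   positive translate of s.  The value at the poles 0, -1, -2, ... is 0. *)
Definition Gamma s : R :=
  if 0 < s then Euler_Gamma s
  else let n := (Num.truncn (- s)).+1 in
       Euler_Gamma (s + n%:R) / \prod_(k < n) (s + k%:R).

Definition a_ rho : R := (1 + rho)^-1.

Definition q_ rho : R := 2 * a_ rho.

Definition beta_ rho : R := 1 - a_ rho.

Definition K_ rho : R :=
  (1 + rho) ^+ 2 / Num.sqrt (1 - rho ^+ 2) * (4 * pi) `^ (a_ rho - 1).

(* Only used for 1/2 < a < 1, where 1 - 2 * a lies in ]-1, 0[. *)
Definition C_ a : R := - (Gamma (1 - a) ^+ 2 / Gamma (1 - 2 * a)).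

Definition rate rho t : R := t `^ (- q_ rho) * ln t `^ (- beta_ rho).

End Constants.

Section Weights.
Context {R : realType} {m : nat}.
Implicit Types (S : 'M[R]_m) (w : 'I_m -> R).

Definition simplex_weights w :=
  (forall i, 0 <= w i) /\ \sum_(i < m) w i = 1.

Definition active w : {set 'I_m} := [set i : 'I_m | 0 < w i]%SET.

Definition active_pairs w : {set 'I_m * 'I_m} :=
  [set p : 'I_m * 'I_m |
     [&& (p.1 < p.2)%N, p.1 \in active w & p.2 \in active w]]%SET.

(* The base value -1 of the iterated maximum is a lower bound of all
   correlations (and of all their absolute values), so it never exceeds the
   maximum over the nonempty set of active pairs. *)
Definition rho_star S w : R :=
  \big[Num.max/-1]_(p in active_pairs w) S p.1 p.2.

Definition E_star S w : {set 'I_m * 'I_m} :=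
  [set p in active_pairs w | S p.1 p.2 == rho_star S w]%SET.

(* G_I only depends on the coordinates of x in I. *)
Definition face_increment w (I : {set 'I_m}) (x : 'I_m -> R) : R :=
  \sum_(J : {set 'I_m} | (J != finset.set0) && (J \subset I))
     (-1) ^+ (#|I| - #|J|) * (1 < \sum_(j in J) w j * x j)%R%:R.

Definition D_ (K rho : R) (E : {set 'I_m * 'I_m}) w : R :=
  K * C_ (a_ rho) * \sum_(p in E) (w p.1 * w p.2) `^ a_ rho.

Definition posdef_correlation S :=
  [/\ S^T = S, forall i, S i i = 1 &
      forall v : 'rV[R]_m, v != 0 -> 0 < (v *m S *m v^T) 0 0].

End Weights.

Section Laws.
Context {R : realType} {d : measure_display} {T : measurableType d}.
Context (P : probability T R) {m : nat}.
Implicit Types (Y : 'I_m -> T -> R) (w : 'I_m -> R) (r : R -> R).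

(* Centered multivariate normal law with positive-definite covariance S: every
   nontrivial linear combination of the coordinates is a univariate normal
   variable with the corresponding variance.  The second argument of
   normal_prob is the standard deviation. *)
Definition multivariate_normal (Z : 'I_m -> {RV P >-> R}) (S : 'M[R]_m) :=
  forall v : 'rV[R]_m, v != 0 -> forall B : set R, measurable B ->
    P [set x | B (\sum_(i < m) v 0 i * Z i x)] =
    normal_prob 0 (Num.sqrt ((v *m S *m v^T) 0 0)) B.

Definition mean_increment Y w (I : {set 'I_m}) (t : R) : R :=
  fine 'E_P[fun x => face_increment w I (fun k => Y k x / t)].

Definition boundary_increment Y w (i j : 'I_m) (eps M t : R) (x : T) : R :=
  `|face_increment w [set i; j]%SET (fun k => Y k x / t)| *
  (~~ ((Y i x / t \in `[eps, M]) && (Y j x / t \in `[eps, M])))%:R.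

Definition boundary_negligible Y w r (i j : 'I_m) :=
  (fun p : R * R =>
     limf_esup (fun t : R =>
       ((r t)^-1%:E * 'E_P[boundary_increment Y w i j p.1 p.2 t])%E)
     (pinfty_nbhs R))
  @ filter_prod 0^'+ (pinfty_nbhs R) --> 0%E.

Definition remaining_faces_negligible Y w (E : {set 'I_m * 'I_m}) r :=
  (fun t : R =>
     \sum_(p : 'I_m * 'I_m | (p.1 < p.2)%N && (p \notin E))
        `|mean_increment Y w [set p.1; p.2]%SET t|
     + \sum_(I : {set 'I_m} | (I \subset active w) && (3 <= #|I|)%N)
        `|mean_increment Y w I t|)
  =o_ +oo r.

Definition tail_prob Y w (t : R) : R :=
  fine (P [set x | t < \sum_(i < m) w i * Y i x]).

End Laws.

(* Main.v *)
From HB Require Import structures.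
Require Import Defs.
From mathcomp Require Import all_boot all_order all_algebra.
From mathcomp Require Import all_classical all_reals all_analysis.
From mathcomp Require Import measurable_realfun ring lra.

(* Inclusion-exclusion writes the indicator of {sum_i w_i Y_i > t} as the sum of
   the face increments over the nonempty sets of active indices.  Singletons
   contribute sum_i w_i / t = 1 / t exactly, so only the maximally correlated
   pairs remain to be computed.

   The two coordinates of such a pair have a density c(x, z) with respect to the
   product of their marginals, and Y = s(Z) is a function of Z that is standard
   Pareto.  The quadratic form in log c is (rho / (1 + rho)) (x^2 + z^2) / 2 up
   to a multiple of (x - z)^2; by Mills' ratio the former turns into a power of
   s(x) s(z) / log t, and the latter vanishes when s(x) / t and s(z) / t stay in
   a compact subset of ]0, +oo[.  Hence c(x, z) ~ kappa (s(x) s(z) / log t)^beta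
   there, and after rescaling by t the mean pair increment restricted to a box is
   kappa * rate(t) times the integral of G(u, v) (u v)^(beta - 2); the boundary
   condition removes the box.  With a = 1 - beta the full integral is
   (w_i w_j)^a (M+ - M-), where an integration by parts turns
   a^2 M+ into 1 + (2 a - 1) B(1 - a, 1 - a) = 1 + C(a), while a^2 M- = 1.

   Two-sided scores are even, so they only see the average of the densities for
   rho and - rho, in which the term of sign - is negligible.  For half-Cauchy
   scores, c Y - 1 <= H <= c Y, so the tail of sum_i w_i H_i at t lies between the
   tails of sum_i w_i Y_i at (t + 1) / c and t / c, and the rate is regularly
   varying and dominates t^-2. *)

Set Implicit Arguments.
Unset Strict Implicit.
Unset Printing Implicit Defensive.

Import Order.TTheory GRing.Theory Num.Theory.
Import numFieldNormedType.Exports.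

Local Open Scope classical_set_scope.
Local Open Scope ring_scope.

(** * Laws in the plane determined by their trigonometric moments *)

(** The hypothesis on [Z] describes one linear combination at a time, whereas a joint density is
    needed. The passage goes through cosines: their means under a pair are known and determine a law
    in the plane. The density is relative to the product of the marginals, so that each score can be
    replaced by a Pareto variable in its own coordinate. The equivalent of the density is uniform
    only while both scores are comparable to t. The pair increment changes sign, so it is split into
    two nonnegative parts; on a box each is squeezed, then the box grows by monotone convergence in
    the extended reals. The box is fixed before t tends to infinity, and its complement is
    controlled by condition (a) alone. The constant has three sources: [copula_cst] is the kappa of
    the density, (1 + rho)^2 is a^-2 from M+ and M-, and (w_i w_j)^a comes from rescaling the axes.
    In the two-sided case 2^(1 - q) is 4^beta / 2: halving both scores gives 4^beta, averaging over
    the sign of rho gives 1/2. *)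

Section bounded_pointwise_closure.
Context d (T : measurableType d) (R : realType).

(** Limits are a constructor, so integral identities propagate by induction: sums and multiples by
    linearity, limits by dominated convergence. For this purpose the bound [M] in [bp_lim] is
    uniform in both the index and the point. *)
Inductive bp_closure (A : set (T -> R)) : (T -> R) -> Prop :=
| bp_base f : A f -> bp_closure A f
| bp_add f g : bp_closure A f -> bp_closure A g ->
    bp_closure A (fun x => f x + g x)
| bp_scale c f : bp_closure A f -> bp_closure A (fun x => c * f x)
| bp_lim (f_ : nat -> T -> R) (f : T -> R) (M : R) : (forall n, bp_closure A (f_ n)) ->
    (forall n x, `|f_ n x| <= M) -> (forall x, f_ ^~ x @ \oo --> f x) ->
    bp_closure A f.

Variable A : set (T -> R).
Hypothesis A_bounded : forall f, A f -> exists M : R, forall x, `|f x| <= M.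
Hypothesis A_measurable : forall f, A f -> measurable_fun setT f.

Lemma bp_closure_bounded f : bp_closure A f -> exists M : R, forall x, `|f x| <= M.
Proof.
elim=> [{}f /A_bounded//|{}f g _ [M fM] _ [N gN]|c {}f _ [M fM]|f_ {}f M _ _ fM fl].
- by exists (M + N) => x; rewrite (le_trans (ler_normD _ _))// lerD.
- by exists (`|c| * M) => x; rewrite normrM ler_wpM2l.
- exists M => x; have : `|f_ n x| @[n --> \oo] --> `|f x| by apply: cvg_norm.
  move=> /cvgr_to_le; apply.
  by near=> n; exact: fM.
Unshelve. all: by end_near. Qed.

Lemma bp_closure_measurable f : bp_closure A f -> measurable_fun setT f.
Proof.
elim=> [{}f /A_measurable//|{}f g _ mf _ mg|c {}f _ mf|f_ {}f M _ mf fM fl].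
- by apply: measurable_funD.
- exact: measurable_funM.
- by apply: (measurable_fun_cvg (h := f_)) => //.
Qed.

(** Induction on [g] with [f] fixed in the closure; when [g] is a generator, a second induction runs
    on [f]. Each limit case needs a bound on the other factor, supplied by the boundedness of the
    closure or of the generators. *)
Lemma bp_closure_mul : (forall f g, A f -> A g -> bp_closure A (fun x => f x * g x)) ->
  forall f g, bp_closure A f -> bp_closure A g ->
  bp_closure A (fun x => f x * g x).
Proof.
move=> Amul f g Af; have [N fN] := bp_closure_bounded Af.
elim=> [{}g Ag|g1 g2 _ IH1 _ IH2|c {}g _ IH|g_ {}g M _ IH gM gl].
- elim: Af {N fN} => [{}f Af|f1 f2 _ IH1 _ IH2|c {}f _ IH|f_ {}f M _ IH fM fl].
  + exact: Amul.
  + by under eq_fun do rewrite mulrDl; apply: bp_add.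
  + by under eq_fun do rewrite -mulrA; apply: bp_scale.
  + have [N gN] := A_bounded Ag.
    apply: (bp_lim (f_ := fun n x => f_ n x * g x) (M := M * N)) => //.
    * by move=> n x; rewrite normrM ler_pM.
    * by move=> x; apply: cvgMl.
- by under eq_fun do rewrite mulrDr; apply: bp_add.
- by under eq_fun do rewrite mulrCA; apply: bp_scale.
- apply: (bp_lim (f_ := fun n x => f x * g_ n x) (M := N * M)) => //.
  * by move=> n x; rewrite normrM ler_pM.
  * by move=> x; apply: cvgMr.
Qed.

Lemma bp_closure_integral (mu nu : probability T R) :
  (forall f, A f -> \int[mu]_x (f x)%:E = \int[nu]_x (f x)%:E)%E ->
  forall f, bp_closure A f -> (\int[mu]_x (f x)%:E = \int[nu]_x (f x)%:E)%E.
Proof.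
move=> Aeq.
have itg f (m : probability T R) : bp_closure A f -> m.-integrable setT (EFin \o f).
  move=> Af; have [M fM] := bp_closure_bounded Af.
  apply: (@le_integrable _ _ _ m setT measurableT _ (EFin \o cst M)).
  - by apply/measurable_EFinP; exact: bp_closure_measurable.
  - by move=> x _ /=; rewrite lee_fin (le_trans (fM x))// ler_norm.
  - exact: finite_measure_integrable_cst.
move=> f; elim=> [{}f /Aeq//|{}f g Af IHf Ag IHg|c {}f Af IH|f_ {}f M Af_ IH fM fl].
- under eq_integral do rewrite EFinD.
  under [RHS]eq_integral do rewrite EFinD.
  rewrite !integralD ?IHf ?IHg//; exact: itg.
- under eq_integral do rewrite EFinM.
  under [RHS]eq_integral do rewrite EFinM.
  rewrite !integralZl ?IH//; exact: itg.
- have key (m : probability T R) :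
    (\int[m]_x (f_ n x)%:E @[n --> \oo] --> \int[m]_x (f x)%:E)%E.
    have [] := @dominated_convergence _ _ _ m setT measurableT
      (fun n x => (f_ n x)%:E) (fun x => (f x)%:E) (EFin \o cst M) => //.
    + by move=> n; apply/measurable_EFinP; exact: bp_closure_measurable.
    + apply/measurable_EFinP/bp_closure_measurable; exact: (bp_lim Af_ fM fl).
    + by apply/aeW => x _; apply: cvg_EFin; [exact: nearW|exact: fl].
    + exact: finite_measure_integrable_cst.
    + by apply/aeW => x n _ /=; rewrite lee_fin.
  apply/esym; have := key mu; under eq_fun do rewrite IH.
  by move=> hmu; exact: (cvg_unique _ (key nu) hmu).
Qed.

End bounded_pointwise_closure.

Section two_dimensional.
Context {R : realType}.
Local Notation RR := (measurableTypeR R * measurableTypeR R)%type.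
Implicit Types f g : RR -> R.

Definition wave : set (RR -> R) :=
  [set f | exists a b th : R, f = fun p => cos (a * p.1 + b * p.2 + th)].

Local Notation bpw := (bp_closure wave).

Lemma wave_bounded f : wave f -> exists M : R, forall x, `|f x| <= M.
Proof.
move=> [a [b [th ->]]]; exists 1 => x.
by rewrite ler_norml cos_geN1 cos_le1.
Qed.

Lemma wave_measurable f : wave f -> measurable_fun setT f.
Proof.
move=> [a [b [th ->]]].
apply: measurableT_comp; first by apply: continuous_measurable_fun; exact: continuous_cos.
by apply: measurable_funD => //; apply: measurable_funD => //;
  apply: measurable_funM => //.
Qed.

Lemma bpw_mul f g : bpw f -> bpw g -> bpw (fun x => f x * g x).
Proof.
apply: bp_closure_mul; first exact: wave_bounded.
move=> {}f {}g [a [b [th ->]]] [a' [b' [th' ->]]].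
have -> : (fun x : RR => cos (a * x.1 + b * x.2 + th) * cos (a' * x.1 + b' * x.2 + th')) =
  (fun x => 2^-1 * (cos ((a - a') * x.1 + (b - b') * x.2 + (th - th')) +
   cos ((a + a') * x.1 + (b + b') * x.2 + (th + th')))).
  apply/funext => x.
  have -> : (a - a') * x.1 + (b - b') * x.2 + (th - th') =
    (a * x.1 + b * x.2 + th) - (a' * x.1 + b' * x.2 + th') by ring.
  have -> : (a + a') * x.1 + (b + b') * x.2 + (th + th') =
    (a * x.1 + b * x.2 + th) + (a' * x.1 + b' * x.2 + th') by ring.
  move: (a * x.1 + b * x.2 + th) (a' * x.1 + b' * x.2 + th') => u v.
  by rewrite cosB cosD; field.
apply: bp_scale; apply: bp_add; apply: bp_base.
  by exists (a - a'), (b - b'), (th - th').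
by exists (a + a'), (b + b'), (th + th').
Qed.

Lemma bpw_cst (c : R) : bpw (fun=> c).
Proof.
have -> : (fun=> c) = (fun x : RR => c * cos (0 * x.1 + 0 * x.2 + 0)).
  by apply/funext => x; rewrite !mul0r !addr0 cos0 mulr1.
by apply: bp_scale; apply: bp_base; exists 0, 0, 0.
Qed.

(* Iterating [step] on [-1, 1] converges to the sign. *)
Let step (u : R) := (3 * u - u ^+ 3) / 2.

Lemma bpw_step f : bpw f -> bpw (fun x => step (f x)).
Proof.
move=> hf; rewrite /step.
have -> : (fun x => (3 * f x - f x ^+ 3) / 2) =
  (fun x => (3 / 2) * f x + (- 2^-1) * (f x * (f x * f x))).
  by apply/funext => x; field.
by apply: bp_add; apply: bp_scale => //; do !apply: bpw_mul.
Qed.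

Lemma step_iter_bound (u : R) n : `|u| <= 1 -> `|iter n step u| <= 1.
Proof.
move=> u1; elim: n => // n; rewrite iterS; set v := iter n _ _.
rewrite !ler_norml /step => /andP[v1 v2].
(* This quantity and the next are [2 * (1 + step v)] and [2 * (1 - step v)]. *)
have : 0 <= (1 + v) ^+ 2 * (2 - v) by rewrite mulr_ge0 ?sqr_ge0//; lra.
have : 0 <= (1 - v) ^+ 2 * (2 + v) by rewrite mulr_ge0 ?sqr_ge0//; lra.
by move=> h1 h2; apply/andP; split; lra.
Qed.

Lemma step_iterN (u : R) n : iter n step (- u) = - iter n step u.
Proof. by elim: n => // n IH; rewrite !iterS IH /step; field. Qed.

(** The iterates increase, hence stay above u, and 1 - step v = (1 - v) (1 - (v + v^2) / 2). The
    distance to 1 therefore shrinks at each step by a factor at most 1 - u / 2. *)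
Lemma step_iter_gt0 (u : R) : 0 < u -> u <= 1 -> iter n step u @[n --> \oo] --> (1 : R).
Proof.
move=> u0 u1.
have ub n : u <= iter n step u <= 1 /\ 1 - iter n step u <= (1 - u / 2) ^+ n.
  elim: n => [|n]; first by rewrite /= lexx u1 expr0; split=> //; lra.
  rewrite iterS exprS; set v := iter n _ _; set e := _ ^+ n => -[/andP[uv v1] ve].
  have v0 : 0 < v by exact: lt_le_trans uv.
  have h1 : 0 <= (1 - v) ^+ 2 * (2 + v) by rewrite mulr_ge0 ?sqr_ge0//; lra.
  have h2 : 0 <= v * (1 - v) * (1 + v) by rewrite !mulr_ge0//; lra.
  rewrite /step; split; first by apply/andP; split; lra.
  have -> : 1 - (3 * v - v ^+ 3) / 2 = (1 - v) * (1 - (v + v ^+ 2) / 2) by field.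
  apply: (@le_trans _ _ ((1 - v) * (1 - u / 2))); first (apply: ler_wpM2l; first lra).
    have : 0 <= v ^+ 2 by exact: sqr_ge0.
    by lra.
  by rewrite mulrC; apply: ler_wpM2l => //; lra.
apply: (@squeeze_cvgr _ _ _ _ (fun n => 1 - (1 - u / 2) ^+ n) (fun=> 1)).
- by near=> n; have [/andP[_ v1] ve] := ub n; rewrite v1 andbT; lra.
- rewrite -[X in _ --> X](subr0 1); apply: cvgB; first exact: cvg_cst.
  by apply: cvg_expr; rewrite ger0_norm; lra.
- exact: cvg_cst.
Unshelve. all: by end_near. Qed.

Lemma bpw_sg f : bpw f -> (forall x, `|f x| <= 1) -> bpw (fun x => Num.sg (f x)).
Proof.
move=> hf f1.
apply: (bp_lim (f_ := fun n x => iter n step (f x)) (M := 1)).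
- elim=> //= n IH; exact: bpw_step.
- by move=> n x; exact: step_iter_bound.
- move=> x; have := f1 x; rewrite ler_norml => /andP[fN1 f1x].
  case: (sgrP (f x)) => [f0|f0|f0].
  + have -> : (fun n => iter n step (f x)) = (fun=> 0); last exact: cvg_cst.
    apply/funext; elim=> [|n IH]; first by rewrite f0.
    by rewrite iterS IH /step; field.
  + exact: step_iter_gt0.
  + have -> : (fun n => iter n step (f x)) = (fun n => - iter n step (- f x)).
      by apply/funext => n; rewrite step_iterN opprK.
    by apply: cvgN; apply: step_iter_gt0; lra.
Qed.

(** The sine of an affine form is a wave with phase shifted by pi / 2. If t is the value of the form
    and n exceeds |t|, then t / (n + 1) lies in ]-pi, pi[, where sin has the sign of its argument;
    the sequence is eventually constant. *)
Lemma bpw_sg_affine (a b c : R) : bpw (fun p => Num.sg (a * p.1 + b * p.2 - c)).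
Proof.
apply: (bp_lim (f_ := fun n (p : RR) => Num.sg (sin ((a * p.1 + b * p.2 - c) / n.+1%:R))) (M := 1)).
- move=> n; apply: bpw_sg; last first.
    by move=> x; rewrite ler_norml sin_geN1 sin_le1.
  have -> : (fun x : RR => sin ((a * x.1 + b * x.2 - c) / n.+1%:R)) =
    (fun p => cos (a / n.+1%:R * p.1 + b / n.+1%:R * p.2 + (- (c / n.+1%:R) - pi / 2))).
    apply/funext => p.
    rewrite -cosBpihalf; congr cos; ring.
  by apply: bp_base; eexists; eexists; eexists.
- move=> n x; case: (sgrP (sin _)) => _; rewrite ?normrN ?normr0 ?normr1//.
- move=> x; set t := _ - c.
  apply: cvg_near_cst; near=> n.
  have n0 : 0 < n.+1%:R :> R by rewrite ltr0n.
  have tn : `|t| / n.+1%:R < pi.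
    rewrite ltr_pdivrMr//; apply: (@lt_le_trans _ _ (n.+1%:R)); last first.
      rewrite ler_peMl ?ltW//; have := pi_ge2 R; lra.
    apply: (@lt_trans _ _ n%:R); last by rewrite ltr_nat.
    near: n; exact: nbhs_infty_gtr.
  case: (sgrP t) => t0.
  + by rewrite t0 mul0r sin0 sgr0.
  + rewrite gtr0_sg//; apply: sin_gt0_pi.
    by rewrite divr_gt0//= -{1}(gtr0_norm t0).
  + rewrite ltr0_sg// -oppr_gt0 -sinN -mulNr; apply: sin_gt0_pi.
    by rewrite -(ltr0_norm t0) tn andbT divr_gt0// normr_gt0 lt_eqF.
Unshelve. all: by end_near. Qed.

(** These sets form a sigma-algebra: complements come from affine combinations of indicators,
    intersections from products, countable intersections from bounded limits of finite ones. *)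
Let bpset : set_system RR := [set E | bpw (\1_E : RR -> R)].

Let bpsetC E : bpset E -> bpset (~` E).
Proof.
move=> hE; rewrite /bpset /=.
have -> : (\1_(~` E) : RR -> R) = (fun x => 1 + (-1) * \1_E x).
  by apply/funext => x; rewrite indicC indicE; case: (x \in E) => /=; lra.
by apply: bp_add; [exact: bpw_cst|exact: bp_scale].
Qed.

Let bpsetI E F : bpset E -> bpset F -> bpset (E `&` F).
Proof.
by move=> hE hF; rewrite /bpset /= indicI; exact: bpw_mul.
Qed.

Let bpset_bigcap (F : (set RR)^nat) :
  (forall n, bpset (F n)) -> bpset (\bigcap_n F n).
Proof.
move=> hF; apply: (bp_lim (f_ := fun n => \1_(\bigcap_(i in `I_n) F i)) (M := 1)).
- elim=> [|n IH].
    by rewrite II0 bigcap_set0 indicT; exact: bpw_cst.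
  have -> : \bigcap_(i in `I_n.+1) F i = (\bigcap_(i in `I_n) F i) `&` F n.
    by rewrite IIS bigcap_setU bigcap_set1.
  exact: bpsetI.
- by move=> n x; rewrite indicE; case: (x \in _); rewrite ?normr1 ?normr0.
- move=> x; rewrite indicE; have [Fx|Fx] := boolP (x \in \bigcap_n F n).
    apply: cvg_near_cst; near=> n; rewrite indicE mem_set//.
    by move: Fx => /set_mem Fx i _; exact: Fx.
  move: Fx; rewrite notin_setE /bigcap /= => /existsNP[k /not_implyP[_ Fk]].
  apply: cvg_near_cst; near=> n; rewrite indicE memNset// => /(_ k); apply: contra_not Fk.
  by apply => /=; near: n; exact: nbhs_infty_gt.
Unshelve. all: by end_near. Qed.

Let bpset_sigma : sigma_algebra [set: RR] bpset.
Proof.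
split.
- by rewrite /bpset /= indic0; exact: bpw_cst.
- by move=> A hA; rewrite setTD; exact: bpsetC.
- move=> F hF; rewrite -[X in bpset X]setCK setC_bigcup.
  by apply: bpsetC; apply: bpset_bigcap => n; exact: bpsetC.
Qed.

Let bpset_halfplane (a b c : R) : bpset [set p | a * p.1 + b * p.2 < c].
Proof.
rewrite /bpset /=.
(* With s the sign in {-1, 0, 1}, (s^2 - s) / 2 is 1 exactly when s = -1, which is the strict
   inequality. *)
have -> : (\1_[set p : RR | a * p.1 + b * p.2 < c] : RR -> R) =
  (fun p => 2^-1 * (Num.sg (a * p.1 + b * p.2 - c) * Num.sg (a * p.1 + b * p.2 - c))
     + (- 2^-1) * Num.sg (a * p.1 + b * p.2 - c)).
  apply/funext => p; rewrite indicE; case: (sgrP (_ - c)) => h.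
  - rewrite memNset /=; first lra.
    by apply/negP; rewrite -leNgt; lra.
  - rewrite memNset /=; first lra.
    by apply/negP; rewrite -leNgt; lra.
  - rewrite mem_set /=; first lra.
    by lra.
apply: bp_add; apply: bp_scale; first apply: bpw_mul; exact: bpw_sg_affine.
Qed.

Let bpset_preimage (pr : RR -> R) :
  (forall c, bpset [set p | pr p < c]) ->
  forall B, measurable B -> bpset (pr @^-1` B).
Proof.
move=> hpr B; have -> : measurable B = (@RGenInftyO.G R).-sigma.-measurable B.
  by rewrite -RGenInftyO.measurableE.
apply: (smallest_sub (X := [set B | bpset (pr @^-1` B)])).
  have [h0 hC hU] := bpset_sigma; split => //=.
  - by move=> A hA; rewrite setTD preimage_setC; exact: bpsetC.
  - by move=> F hF; rewrite preimage_bigcup; exact: hU.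
by move=> _ [c ->]; exact: hpr.
Qed.

Let bpset_measurable E : measurable E -> bpset E.
Proof.
rewrite measurable_prod_measurableType; apply: smallest_sub => //.
move=> _ [A mA [B mB <-]].
have -> : A `*` B = (fst @^-1` A) `&` (snd @^-1` B) by [].
apply: bpsetI; apply: bpset_preimage => // c.
- have := bpset_halfplane 1 0 c; congr bpset; apply/seteqP; split => p /=;
  by rewrite mul1r mul0r addr0.
- have := bpset_halfplane 0 1 c; congr bpset; apply/seteqP; split => p /=;
  by rewrite mul1r mul0r add0r.
Qed.

(* Products of waves are combinations of waves, and bounded pointwise limits of
   polynomials in waves contain the indicators of half-planes. *)
Lemma eq_probability_wave (mu nu : probability RR R) :
  (forall a b th : R, \int[mu]_p (cos (a * p.1 + b * p.2 + th))%:E =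
     \int[nu]_p (cos (a * p.1 + b * p.2 + th))%:E)%E ->
  forall E, measurable E -> mu E = nu E.
Proof.
move=> h E mE.
have := bp_closure_integral wave_bounded wave_measurable (mu := mu) (nu := nu).
move=> /(_ _ _ (bpset_measurable mE)); rewrite !integral_indic// !setIT; apply.
by move=> f [a [b [th ->]]]; exact: h.
Qed.

End two_dimensional.

(** * Changes of variables on the line *)

Section density.
Local Open Scope ereal_scope.
Context d (T : measurableType d) (R : realType).
Variables (mu nu : {measure set T -> \bar R}) (h : T -> R).
Hypotheses (mh : measurable_fun setT h) (h0 : forall x, (0 <= h x)%R).
Hypothesis nuE : forall A, measurable A -> nu A = \int[mu]_(x in A) (h x)%:E.

Import HBNNSimple.

Let density_indic (r : R) A : (0 <= r)%R -> measurable A ->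
  \int[nu]_x (r * \1_A x)%:E = \int[mu]_x ((r * \1_A x)%:E * (h x)%:E).
Proof.
move=> r0 mA; under eq_integral do rewrite EFinM.
under [RHS]eq_integral do rewrite EFinM -muleA.
rewrite !ge0_integralZl//; last 3 first.
- by apply: emeasurable_funM; apply/measurable_EFinP.
- by move=> x _; rewrite mule_ge0// lee_fin.
- by apply/measurable_EFinP.
congr (_ * _); rewrite integral_indic// setIT nuE// integral_mkcond.
apply: eq_integral => x _; rewrite patchE indicE; case: ifPn => _.
  by rewrite mul1e.
by rewrite mul0e.
Qed.

Let density_nnsfun (f : {nnsfun T >-> R}) :
  \int[nu]_x (f x)%:E = \int[mu]_x ((f x)%:E * (h x)%:E).
Proof.
under [LHS]eq_integral do rewrite fimfunE -fsumEFin//.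
rewrite [LHS]ge0_integral_fsum//; last 2 first.
  - by move=> r; apply/measurable_EFinP/measurableT_comp.
  - by move=> n x _; rewrite EFinM nnfun_muleindic_ge0.
have hE x : (f x)%:E * (h x)%:E =
    \sum_(y \in range f) ((y * \1_(f @^-1` [set y]) x)%:E * (h x)%:E).
  rewrite {1}fimfunE -fsumEFin// ge0_mule_fsuml//.
  by move=> r; rewrite EFinM nnfun_muleindic_ge0.
under [RHS]eq_integral do rewrite hE.
rewrite [RHS]ge0_integral_fsum//; last 2 first.
  - move=> r; apply: emeasurable_funM; last exact/measurable_EFinP.
    by apply/measurable_EFinP/measurableT_comp.
  - by move=> n x _; apply: mule_ge0; [rewrite EFinM nnfun_muleindic_ge0|rewrite lee_fin].
apply: eq_fsbigr => r /set_mem[x _ <-]; exact: density_indic.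
Qed.

(** The density is only assumed on sets; the formula extends to simple functions by linearity and to
    nonnegative functions by monotone approximation. It serves for both the normal and the Pareto
    laws. *)
Lemma ge0_integral_density (f : T -> \bar R) : measurable_fun setT f ->
  (forall x, 0 <= f x) -> \int[nu]_x f x = \int[mu]_x (f x * (h x)%:E).
Proof.
move=> mf f0; pose f_ := nnsfun_approx measurableT mf.
have fE x : limn (fun n => (f_ n x)%:E) = f x.
  by apply/cvg_lim => //; exact: cvg_nnsfun_approx.
transitivity (limn (fun n => \int[nu]_x (f_ n x)%:E)).
  rewrite -monotone_convergence//=.
  - by apply: eq_integral => x _; rewrite fE.
  - by move=> n; exact/measurable_EFinP/measurable_funTS.
  - by move=> n ? _; rewrite lee_fin.
  - by move=> ? _ ? ? mn; rewrite lee_fin; exact/lefP/nd_nnsfun_approx.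
transitivity (limn (fun n => \int[mu]_x ((f_ n x)%:E * (h x)%:E))).
  by apply: congr_lim; apply/funext => n; exact: density_nnsfun.
rewrite -monotone_convergence//=.
- apply: eq_integral => x _; apply/cvg_lim => //.
  by apply: cvgeZr => //; exact: cvg_nnsfun_approx.
- move=> n; apply: emeasurable_funM; last exact/measurable_EFinP.
  by apply/measurable_EFinP/measurable_funTS.
- by move=> n x _; rewrite mule_ge0 ?lee_fin.
- by move=> x _ m n mn; rewrite lee_wpmul2r ?lee_fin//; exact/lefP/nd_nnsfun_approx.
Qed.

End density.

Section lebesgue_affine.
Local Open Scope ereal_scope.
Context {R : realType}.
Local Notation mu := (@lebesgue_measure R).

(** Lebesgue measure is c times its own image under x -> c x + b: by uniqueness it suffices to
    compare the two on half-open intervals. *)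
Lemma ge0_integral_affine (c b : R) (f : R -> \bar R) : (0 < c)%R ->
  measurable_fun setT f -> (forall x, 0 <= f x) ->
  \int[mu]_x f x = c%:E * \int[mu]_x f (c * x + b)%R.
Proof.
move=> c0 mf f0.
pose phi : measurableTypeR R -> measurableTypeR R := fun x => (c * x + b)%R.
have mphi : measurable_fun setT phi.
  by apply: measurable_funD => //; apply: measurable_funM.
have [nu nuE] : exists nu : {measure set (measurableTypeR R) -> \bar R},
    nu = pushforward mu phi :> (set (measurableTypeR R) -> \bar R).
  by unshelve eexists (pushforward mu phi) => //; exact: mphi.
pose k : {nonneg R} := NngNum (ltW c0).
have muE A : measurable A -> mu A = mscale k nu A.
  apply: lebesgue_measure_unique => _ [[a1 a2] _ <-].
  rewrite -[RHS]/(c%:E * nu `]a1, a2]%classic) nuE /pushforward /=.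
  have -> : phi @^-1` `]a1, a2] = `]((a1 - b) / c)%R, ((a2 - b) / c)%R]%classic.
    apply/seteqP; split => x; rewrite /phi /= !in_itv/=;
    by rewrite ltr_pdivrMr// ler_pdivlMr// ltrBlDr lerBrDr mulrC.
  rewrite !lebesgue_measure_itv /= !lte_fin ltr_pM2r ?invr_gt0// ltrD2r.
  case: ifP => _; last by rewrite mule0.
  by rewrite -!EFinB -EFinM; congr _%:E; field; rewrite gt_eqF.
transitivity (\int[mscale k nu]_x f x).
  by apply: eq_measure_integral => A mA _; exact: muE.
rewrite ge0_integral_mscale//; congr (_ * _).
rewrite -[RHS](@ge0_integral_pushforward _ _ _ _ _ _ mphi mu setT f)//.
by apply: eq_measure_integral => A mA _; exact: (congr1 (fun m => m A) nuE).
Qed.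

Lemma ge0_integral_oppr (f : R -> \bar R) :
  measurable_fun setT f -> (forall x, 0 <= f x) ->
  \int[mu]_x f x = \int[mu]_x f (- x)%R.
Proof.
move=> mf f0.
transitivity (\int[pushforward mu (-%R : measurableTypeR R -> measurableTypeR R)]_x f x).
  by apply: eq_measure_integral => A mA _; exact/esym/lebesgue_measureN.
by rewrite ge0_integral_pushforward.
Qed.

End lebesgue_affine.

Section ftc_open.
Local Open Scope ereal_scope.
Context {R : realType}.
Local Notation mu := (@lebesgue_measure R).

(* Improper integral of a nonnegative derivative; no continuity is asked at the
   end points, where the derivative may be unbounded. *)
Lemma ge0_FTC_oo (f F : R -> R) (a b A B : R) : (a < b)%R ->
  (forall x, x \in `]a, b[ -> {for x, continuous f}) ->
  (forall x, x \in `]a, b[ -> (0 <= f x)%R) ->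
  (forall x, x \in `]a, b[ -> is_derive x (1 : R)%R F (f x)) ->
  F x @[x --> a^'+] --> A -> F x @[x --> b^'-] --> B ->
  \int[mu]_(x in `]a, b[) (f x)%:E = (B - A)%:E.
Proof.
move=> ab cf f0 dF FA FB.
pose e n : R := ((b - a) / 2 / n.+1%:R)%R.
have e0 n : (0 < e n)%R by rewrite !divr_gt0// subr_gt0.
have e_lt n : (0 < n)%N -> (e n < (b - a) / 2)%R.
  by move=> n0; rewrite /e ltr_pdivrMr// ltr_pMr ?divr_gt0 ?subr_gt0// ltr1n.
pose l n := (a + e n)%R; pose r n := (b - e n)%R.
have lr n : (0 < n)%N -> (l n < r n)%R.
  by move=> /e_lt; rewrite /l /r; lra.
have sub n : `[l n, r n] `<=` `]a, b[.
  move=> x /=; rewrite !in_itv/= => /andP[lx xr].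
  by rewrite (lt_le_trans _ lx) ?ltrDl//= (le_lt_trans xr)// ltrBlDr ltrDl.
have ei n : (e n.+1 <= e n)%R.
  rewrite /e ler_pM2l ?divr_gt0 ?subr_gt0// lef_pV2 ?posrE//.
  by rewrite ler_nat.
have e_cvg : e @ \oo --> (0 : R)%R.
  rewrite /e -[X in _ --> X](mulr0 ((b - a) / 2)%R).
  by apply: cvgM; [exact: cvg_cst|exact: cvg_harmonic].
have dF' n (x : R) : x \in `[l n, r n] -> is_derive x 1%R F (f x).
  by move=> xI; apply: dF; exact: (sub n).
have cF n (x : R) : x \in `[l n, r n] -> {for x, continuous F}.
  by move=> /dF'[dFx _]; apply/differentiable_continuous/derivable1_diffP.
have cfn n : {within `[l n, r n], continuous f}.
  apply: continuous_in_subspaceT => x xI; apply: cf.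
  by apply: (sub n); exact: set_mem.
have intE n : (0 < n)%N ->
    \int[mu]_(x in `[l n, r n]) (f x)%:E = (F (r n) - F (l n))%R%:E.
  move=> n0; have lrn := lr _ n0.
  rewrite (@continuous_FTC2 _ f F)// ?EFinB//.
  - split => [x /subset_itv_oo_cc xI||].
    + by have [] := dF' _ _ xI.
    + apply: cvg_at_right_filter; apply: (cF n).
      by rewrite in_itv/= lexx ltW.
    + apply: cvg_at_left_filter; apply: (cF n).
      by rewrite in_itv/= lexx ltW.
  - move=> x /subset_itv_oo_cc xI; rewrite derive1E.
    by have [_ ->] := dF' _ _ xI.
have l_cvg : l @ \oo --> a.
  by rewrite -[X in _ --> X]addr0; apply: cvgD => //; exact: cvg_cst.
have r_cvg : r @ \oo --> b.
  by rewrite -[X in _ --> X]subr0; apply: cvgB => //; exact: cvg_cst.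
(* The shift skips n = 0, where [e 0 = (b - a) / 2] reduces the interval to its midpoint. *)
pose S n := `[l n.+1, r n.+1]%classic.
have SU : `]a, b[%classic = \bigcup_n S n.
  apply/seteqP; split => [x /= xab|x [n _]]; last exact: sub.
  move: xab; rewrite in_itv/= => /andP[ax xb].
  have : \forall n \near \oo, (l n <= x)%R /\ (x <= r n)%R.
    near=> n; split; near: n.
      by apply: (cvgr_le _ l_cvg).
    by apply: (cvgr_ge _ r_cvg).
  move=> [N _ /(_ N.+1 (leqnSn _))[h1 h2]]; exists N => //.
  by rewrite /S /= in_itv/= h1.
have mf : measurable_fun `]a, b[ f.
  by apply: open_continuous_measurable_fun => // x /set_mem; exact: cf.
have : \int[mu]_(x in S n) (f x)%:E @[n --> \oo] --> \int[mu]_(x in `]a, b[) (f x)%:E.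
  rewrite SU; apply: ge0_nondecreasing_set_cvg_integral.
  - apply/nondecreasing_seqP => n; rewrite subsetEset => x.
    rewrite /S /= !in_itv/= /l /r => /andP[h1 h2].
    by have := ei n.+1 => h3; apply/andP; split; lra.
  - by move=> n; exact: measurable_itv.
  - move=> n; apply/measurable_EFinP; apply: measurable_funS mf => //.
    exact: sub.
  - by move=> n x /sub xab; rewrite lee_fin; exact: f0.
move=> /cvg_unique; apply; first exact: ereal_hausdorff.
rewrite /=; under eq_fun do rewrite /S intE//.
apply: cvg_EFin; first exact: nearW.
apply: cvgB.
  move/cvg_at_leftP : FB; apply; split.
    by move=> n; rewrite /r ltrBlDr ltrDl.
  by rewrite (cvg_shiftS r).
move/cvg_at_rightP : FA; apply; split.
  by move=> n; rewrite /l ltrDl.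
by rewrite (cvg_shiftS l).
Unshelve. all: by end_near. Qed.

End ftc_open.

(** * Gaussian integrals *)

Lemma integrable_scale d (T : measurableType d) (R : realType)
    (m : {measure set T -> \bar R}) (h : T -> R) (c : R) :
  m.-integrable setT (EFin \o h) -> m.-integrable setT (EFin \o (fun x => c * h x)).
Proof. by move=> ih; exact: (integrableZl measurableT c ih). Qed.

Section gaussian_characteristic.
Context {R : realType}.
Local Notation mu := (@lebesgue_measure R).
Implicit Types x b : R.

Lemma integrable_cvg_itv (h : R -> R) : mu.-integrable setT (EFin \o h) ->
  (\int[mu]_(x in `[(- n%:R)%R, n%:R]) (h x)%:E @[n --> \oo] --> \int[mu]_x (h x)%:E)%E.
Proof.
move=> ih; have /measurable_EFinP mh := measurable_int _ ih.
under eq_fun do rewrite integral_mkcond.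
have [] := @dominated_convergence _ _ _ mu setT measurableT
  (fun n => (EFin \o h) \_ `[(- n%:R)%R, n%:R]) (EFin \o h) (abse \o (EFin \o h)) => //.
- by move=> n; apply/(measurable_restrictT _ _).1 => //; apply: measurable_funTS; exact/measurable_EFinP.
- by apply/measurable_EFinP.
- apply/aeW => x _; apply: cvg_near_cst; near=> n; rewrite patchE mem_set//=.
  rewrite in_itv/= -ler_norml; near: n; exact: nbhs_infty_ger.
- exact: integrable_abse.
- by apply/aeW => x n _ /=; rewrite patchE; case: ifP => // _; rewrite abse0.
Unshelve. all: by end_near. Qed.

Definition stdpdf x : R := normal_peak 1 * expR (- (x ^+ 2 / 2)).

Lemma stdpdfE : normal_pdf 0 1 = stdpdf.
Proof.
apply/funext => x; rewrite normal_pdfE ?oner_eq0// /normal_fun /stdpdf.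
by rewrite subr0 expr1n mulNr.
Qed.

Lemma stdpdf_gt0 x : 0 < stdpdf x.
Proof. by rewrite mulr_gt0 ?expR_gt0 ?normal_peak_gt0 ?oner_neq0. Qed.

Lemma stdpdfN x : stdpdf (- x) = stdpdf x.
Proof. by rewrite /stdpdf sqrrN. Qed.

Lemma measurable_stdpdf : measurable_fun setT stdpdf.
Proof. by rewrite -stdpdfE; exact: measurable_normal_pdf. Qed.

Lemma is_derive_stdpdf x : is_derive x (1 : R) stdpdf (- x * stdpdf x).
Proof.
rewrite /stdpdf; apply: is_derive_eq.
by rewrite /GRing.scale /=; field.
Qed.

Lemma continuous_stdpdf : continuous stdpdf.
Proof. by rewrite -stdpdfE; apply: continuous_normal_pdf; rewrite oner_eq0. Qed.

Lemma integrable_stdpdf : mu.-integrable setT (EFin \o stdpdf).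
Proof. by rewrite -stdpdfE; exact: integrable_normal_pdf. Qed.

Lemma integrable_bounded_stdpdf (h : R -> R) (M : R) : measurable_fun setT h ->
  (forall x, `|h x| <= M) -> mu.-integrable setT (EFin \o (fun x => h x * stdpdf x)).
Proof.
move=> mh hM.
apply: (@le_integrable _ _ _ mu setT measurableT _ (EFin \o (fun x => M * stdpdf x))).
- by apply/measurable_EFinP; apply: measurable_funM => //; exact: measurable_stdpdf.
- move=> x _ /=; rewrite lee_fin normrM (le_trans _ (ler_norm _))//.
  by rewrite (gtr0_norm (stdpdf_gt0 _)) ler_wpM2r// ltW// stdpdf_gt0.
- exact: integrable_scale integrable_stdpdf.
Qed.

(** The majorant is a multiple of the normal density of variance 2: exp(-x^2 / 2) is the square of
    exp(-x^2 / 4), and |x| exp(-x^2 / 4) <= 1 because |x| <= 1 + x^2 / 4 <= exp(x^2 / 4). *)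
Lemma integrable_abs_stdpdf : mu.-integrable setT (EFin \o (fun x => `|x| * stdpdf x)).
Proof.
pose s : R := Num.sqrt 2.
have s0 : s != 0 by rewrite gt_eqF// sqrtr_gt0.
pose c := normal_peak 1 / normal_peak s.
apply: (@le_integrable _ _ _ mu setT measurableT _ (EFin \o (fun x => c * normal_pdf 0 s x))).
- by apply/measurable_EFinP; apply: measurable_funM; [exact: normr_measurable|exact: measurable_stdpdf].
- move=> x _ /=; rewrite lee_fin normrM normr_id (gtr0_norm (stdpdf_gt0 _)).
  rewrite (le_trans _ (ler_norm _))// normal_pdfE//.
  have p0 := normal_peak_gt0 s0.
  rewrite /c mulrA divfK ?gt_eqF// /stdpdf mulrCA ler_pM2l ?normal_peak_gt0 ?oner_neq0//.
  rewrite /normal_fun subr0 sqr_sqrtr//.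
  have -> : - (x ^+ 2 / 2) = - x ^+ 2 / (2 *+ 2) + - x ^+ 2 / (2 *+ 2) by field.
  rewrite expRD mulrA ler_piMl ?expR_ge0// -ler_pdivlMr ?expR_gt0// -expRN mul1r.
  rewrite (le_trans _ (expR_ge1Dx _))//.
  have : 0 <= (`|x| / 2 - 1) ^+ 2 by exact: sqr_ge0.
  have -> : (`|x| / 2 - 1) ^+ 2 = `|x| ^+ 2 / 4 - `|x| + 1 by field.
  by rewrite real_normK ?num_real//; lra.
- apply: integrable_scale; exact: integrable_normal_pdf.
Qed.

Lemma cvg_stdpdf0 : stdpdf n%:R @[n --> \oo] --> (0 : R).
Proof.
rewrite -[X in _ --> X](mulr0 (normal_peak 1)).
apply: cvgM; first exact: cvg_cst.
apply: (@squeeze_cvgr _ _ _ _ (fun=> 0) (fun n => (n%:R)^-1)).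
- near=> n; rewrite expR_ge0 /=.
  have n0 : (0 : R) < n%:R by rewrite ltr0n; near: n; exact: nbhs_infty_gt.
  have h : n%:R <= expR (n%:R ^+ 2 / 2) :> R.
    rewrite (le_trans _ (expR_ge1Dx _))//.
    by have h := sqr_ge0 ((n%:R : R) - 1); lra.
  by rewrite expRN lef_pV2 ?posrE ?expR_gt0.
- exact: cvg_cst.
- apply/gtr0_cvgV0; last exact: cvgr_idn.
  by near=> n; rewrite ltr0n; near: n; exact: nbhs_infty_gt.
Unshelve. all: by end_near. Qed.

(** The difference of the two integrands is the derivative of sin(b x) [stdpdf x]; its integral over
    [-n, n] is a boundary term that vanishes in the limit. *)
Lemma by_parts_stdpdf b :
  \int[mu]_x (x * sin (b * x) * stdpdf x) = b * \int[mu]_x (cos (b * x) * stdpdf x).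
Proof.
have msin : measurable_fun setT (fun x => sin (b * x)).
  apply: measurableT_comp; last exact: measurable_funM.
  by apply: continuous_measurable_fun; exact: continuous_sin.
have mcos : measurable_fun setT (fun x => cos (b * x)).
  apply: measurableT_comp; last exact: measurable_funM.
  by apply: continuous_measurable_fun; exact: continuous_cos.
have i1 : mu.-integrable setT (EFin \o (fun x => x * sin (b * x) * stdpdf x)).
  apply: le_integrable integrable_abs_stdpdf => //.
  - apply/measurable_EFinP; apply: measurable_funM; last exact: measurable_stdpdf.
    exact: measurable_funM.
  - move=> x _ /=; rewrite lee_fin !normrM normr_id ler_wpM2r//.
    by rewrite ler_piMr// ler_norml sin_geN1 sin_le1.
have i2 : mu.-integrable setT (EFin \o (fun x => b * (cos (b * x) * stdpdf x))).
  apply: integrable_scale; apply: (@integrable_bounded_stdpdf _ 1 mcos) => x.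
  by rewrite ler_norml cos_geN1 cos_le1.
have i3 : mu.-integrable setT (EFin \o (fun x => b * cos (b * x) * stdpdf x - x * sin (b * x) * stdpdf x)).
  rewrite (_ : _ \o _ = fun x => ((b * (cos (b * x) * stdpdf x))%:E -
    (x * sin (b * x) * stdpdf x)%:E)%E); first exact: integrableB.
  by apply/funext => x /=; rewrite EFinB mulrA.
have int0 : (\int[mu]_x (b * cos (b * x) * stdpdf x - x * sin (b * x) * stdpdf x)%:E = 0)%E.
  apply: (cvg_unique _ (integrable_cvg_itv i3)) => //=.
  pose F x := sin (b * x) * stdpdf x.
  have dF x : is_derive x (1 : R) F (b * cos (b * x) * stdpdf x - x * sin (b * x) * stdpdf x).
    have := is_derive_stdpdf x => h; rewrite /F; apply: is_derive_eq.
    by rewrite /GRing.scale /=; ring.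
  have cf : continuous (fun x => b * cos (b * x) * stdpdf x - x * sin (b * x) * stdpdf x).
    move=> x; apply: cvgB; apply: cvgM; try exact: continuous_stdpdf.
    - apply: cvgM; first exact: cvg_cst.
      by apply: continuous_comp; [exact: mulrl_continuous|exact: continuous_cos].
    - apply: cvgM; first exact: cvg_id.
      by apply: continuous_comp; [exact: mulrl_continuous|exact: continuous_sin].
  have FE n : (\int[mu]_(x in `[(- n.+1%:R)%R, n.+1%:R])
      (b * cos (b * x) * stdpdf x - x * sin (b * x) * stdpdf x)%:E =
      (F n.+1%:R - F (- n.+1%:R))%:E)%E.
    rewrite (@continuous_FTC2 _ _ F)//.
    + by rewrite (@lt_trans _ _ 0) ?oppr_lt0 ?ltr0n.
    + exact: continuous_subspaceT.
    + split.
      * by move=> x _; have [] := dF x.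
      * apply: cvg_at_right_filter; have [+ _] := dF (- n.+1%:R).
        by move=> /derivable1_diffP/differentiable_continuous.
      * apply: cvg_at_left_filter; have [+ _] := dF n.+1%:R.
        by move=> /derivable1_diffP/differentiable_continuous.
    + by move=> x _; rewrite derive1E; have [_ ->] := dF x.
  rewrite -(cvg_shiftS (fun n => \int[mu]_(x in `[(- n%:R)%R, n%:R]) _)%E) /=.
  under eq_fun do rewrite FE.
  apply: cvg_EFin; first exact: nearW.
  rewrite [X in X @ _ --> _](_ : _ = (fun n : nat => 2 * sin (b * n.+1%:R) * stdpdf n.+1%:R)); last first.
    by apply/funext => n /=; rewrite /F mulrN sinN stdpdfN; ring.
  have c0 : (2 * stdpdf n.+1%:R) @[n --> \oo] --> (0 : R).
    rewrite -[X in _ --> X](mulr0 2); apply: cvgM; first exact: cvg_cst.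
    rewrite (cvg_shiftS (fun n : nat => stdpdf n%:R)).
    exact: cvg_stdpdf0.
  apply: (@squeeze_cvgr _ _ _ _ (fun n => - (2 * stdpdf n.+1%:R)) (fun n => 2 * stdpdf n.+1%:R)) => //.
    near=> n; rewrite -ler_norml normrM (gtr0_norm (stdpdf_gt0 _)) normrM gtr0_norm//.
    rewrite ler_pM2r ?stdpdf_gt0// ler_piMr// ler_norml sin_geN1 sin_le1//.
  by rewrite -oppr0; exact: cvgN.
have h : \int[mu]_x (b * (cos (b * x) * stdpdf x)) - \int[mu]_x (x * sin (b * x) * stdpdf x) = 0.
  rewrite -RintegralB// /Rintegral.
  under eq_integral do rewrite mulrA.
  by rewrite int0.
move/eqP: h; rewrite subr_eq0 => /eqP <-; rewrite RintegralZl//.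
apply: (@integrable_bounded_stdpdf _ 1 mcos) => x.
by rewrite ler_norml cos_geN1 cos_le1.
Unshelve. all: by end_near. Qed.

Definition gauss_cf b : R := \int[mu]_x (cos (b * x) * stdpdf x).

(** Differentiation under the integral, dominated by |x| [stdpdf x], followed by integration by
    parts: the characteristic function solves y' = - b y. *)
Lemma is_derive_gauss_cf b : is_derive b (1 : R) gauss_cf (- b * gauss_cf b).
Proof.
have mcos c : measurable_fun setT (fun x => cos (c * x)).
  apply: measurableT_comp; last exact: measurable_funM.
  by apply: continuous_measurable_fun; exact: continuous_cos.
have df c x : is_derive c (1 : R) (fun c => cos (c * x) * stdpdf x) (- (x * sin (c * x) * stdpdf x)).
  by apply: is_derive_eq; rewrite /GRing.scale /=; ring.
have bI : b \in `](b - 1), (b + 1)[ by rewrite in_itv/=; lra.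
have h1 c : mu.-integrable setT (EFin \o (fun x => cos (c * x) * stdpdf x)).
  by apply: (@integrable_bounded_stdpdf _ 1 (mcos c)) => x; rewrite ler_norml cos_geN1 cos_le1.
have G_ub c x : `|partial1of2 (fun c x => cos (c * x) * stdpdf x) c x| <= `|x| * stdpdf x.
  rewrite partial1of2E; have [_ ->] := df c x.
  rewrite normrN normrM (gtr0_norm (stdpdf_gt0 _)) ler_wpM2r ?(ltW (stdpdf_gt0 _))//.
  by rewrite normrM ler_piMr// ler_norml sin_geN1 sin_le1.
have G0 x : 0 <= `|x| * stdpdf x by rewrite mulr_ge0// ltW// stdpdf_gt0.
split.
  apply: (@derivable_under_integral _ _ _ mu (fun c x => cos (c * x) * stdpdf x) setT
    measurableT b (b - 1) (b + 1) bI (fun c _ => h1 c) _ (fun x => `|x| * stdpdf x)) => //.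
  exact: integrable_abs_stdpdf.
rewrite -derive1E (@differentiation_under_integral _ _ _ mu (fun c x => cos (c * x) * stdpdf x) setT
    measurableT b (b - 1) (b + 1) bI (fun c _ => h1 c) _ (fun x => `|x| * stdpdf x))//.
  rewrite mulNr /gauss_cf -by_parts_stdpdf -mulN1r -RintegralZl//.
    apply: eq_Rintegral => x _; rewrite partial1of2E; have [_ ->] := df b x.
    by rewrite mulN1r.
  apply: le_integrable integrable_abs_stdpdf => //.
  - apply/measurable_EFinP; apply: measurable_funM; last exact: measurable_stdpdf.
    apply: measurable_funM => //.
    apply: measurableT_comp; last exact: measurable_funM.
    by apply: continuous_measurable_fun; exact: continuous_sin.
  - move=> x _ /=; rewrite lee_fin (ger0_norm (G0 x)) normrM (gtr0_norm (stdpdf_gt0 _)).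
    rewrite ler_wpM2r ?(ltW (stdpdf_gt0 _))//.
    by rewrite normrM ler_piMr// ler_norml sin_geN1 sin_le1.
exact: integrable_abs_stdpdf.
Qed.

(** The product with exp(b^2 / 2) has zero derivative, and [gauss_cf 0] is the total mass of the
    density. *)
Lemma gauss_cfE b : gauss_cf b = expR (- (b ^+ 2 / 2)).
Proof.
have d c : is_derive c (1 : R) (fun c => gauss_cf c * expR (c ^+ 2 / 2)) 0.
  have := is_derive_gauss_cf c => h; apply: is_derive_eq.
  by rewrite /GRing.scale /=; field.
have := is_derive_0_is_cst b 0 d.
rewrite expr0n/= mul0r expR0 mulr1 => h.
have -> : gauss_cf b = gauss_cf 0 * expR (- (b ^+ 2 / 2)).
  by rewrite -h -mulrA -expRD subrr expR0 mulr1.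
suff -> : gauss_cf 0 = 1 by rewrite mul1r.
rewrite /gauss_cf; under eq_Rintegral do rewrite mul0r cos0 mul1r.
by rewrite /Rintegral -stdpdfE integral_normal_pdf.
Qed.

End gaussian_characteristic.

(** * Expectations under a normal law *)

Section normal_integrals.
Context {R : realType}.
Local Notation mu := (@lebesgue_measure R).
Local Notation N01 := (@normal_prob R 0 1).

Lemma ge0_integral_normal (m s : R) (f : R -> \bar R) :
  measurable_fun setT f -> (forall x, 0 <= f x)%E ->
  (\int[normal_prob m s]_x f x = \int[mu]_x (f x * (normal_pdf m s x)%:E))%E.
Proof.
move=> mf f0.
apply: (@ge0_integral_density _ _ _ mu (normal_prob m s) (normal_pdf m s)) => //.
  exact: measurable_normal_pdf.
by move=> x; exact: normal_pdf_ge0.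
Qed.

Lemma ge0_integral_normal01 (f : R -> \bar R) :
  measurable_fun setT f -> (forall x, 0 <= f x)%E ->
  (\int[N01]_x f x = \int[mu]_x (f x * (stdpdf x)%:E))%E.
Proof. by move=> mf f0; rewrite ge0_integral_normal// stdpdfE. Qed.

Lemma normal_pdf_std (m s x : R) : 0 < s ->
  normal_pdf m s x = s^-1 * (normal_peak 1 * expR (- ((x - m) ^+ 2 / (2 * s ^+ 2)))).
Proof.
move=> s0; rewrite normal_pdfE ?gt_eqF// /normal_fun mulrA; congr (_ * expR _).
  rewrite /normal_peak expr1n mul1r -mulrnAr sqrtrM ?sqr_ge0//.
  by rewrite sqrtr_sqr gtr0_norm// invfM.
by field; rewrite gt_eqF.
Qed.

Lemma measurable_affine (m s : R) : measurable_fun setT (fun x : R => m + s * x).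
Proof. by apply: measurable_funD => //; exact: measurable_funM. Qed.

Lemma ge0_integral_normal_std (m s : R) (f : R -> \bar R) : 0 < s ->
  measurable_fun setT f -> (forall x, 0 <= f x)%E ->
  (\int[normal_prob m s]_x f x = \int[N01]_x f (m + s * x)%R)%E.
Proof.
move=> s0 mf f0; rewrite ge0_integral_normal//.
rewrite ge0_integral_normal01//; last by apply: measurableT_comp => //; exact: measurable_affine.
rewrite (ge0_integral_affine m s0)//; last 2 first.
- apply: emeasurable_funM => //; apply/measurable_EFinP; exact: measurable_normal_pdf.
- by move=> x; rewrite mule_ge0// lee_fin normal_pdf_ge0.
rewrite -ge0_integralZl//; last 3 first.
- apply: emeasurable_funM => //.
    apply: measurableT_comp => //; under eq_fun do rewrite addrC.
    exact: measurable_affine.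
  apply/measurable_EFinP; apply: measurableT_comp; first exact: measurable_normal_pdf.
  under eq_fun do rewrite addrC; exact: measurable_affine.
- by move=> x _; rewrite mule_ge0// lee_fin normal_pdf_ge0.
- by rewrite lee_fin ltW.
apply: eq_integral => x _; rewrite muleCA (addrC m); congr (_ * _)%E.
rewrite -EFinM; congr EFin; rewrite normal_pdf_std// addrK mulVKf ?gt_eqF//.
by rewrite /stdpdf; congr (_ * expR _); field; rewrite gt_eqF.
Qed.

Lemma measurable_cos (a b : R) : measurable_fun setT (fun x => cos (a * x + b)).
Proof.
apply: measurableT_comp; first exact: continuous_measurable_fun (@continuous_cos R).
by apply: measurable_funD => //; exact: measurable_funM.
Qed.

Lemma onePcos_ge0 (x : R) : 0 <= 1 + cos x.
Proof. by have := cos_geN1 x; lra. Qed.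

(* Shifting cos by 1 keeps the integrands nonnegative, so that Tonelli applies. *)
Lemma integral_normal01_cos (b th : R) :
  (\int[N01]_z (1 + cos (b * z + th))%:E = (1 + expR (- (b ^+ 2 / 2)) * cos th)%:E)%E.
Proof.
rewrite ge0_integral_normal01; last 2 first.
- by apply/measurable_EFinP; apply: measurable_funD => //; exact: measurable_cos.
- by move=> x; rewrite lee_fin onePcos_ge0.
have mcos : measurable_fun setT (fun x => cos (b * x)).
  by have := measurable_cos b 0; under eq_fun do rewrite addr0.
have msin : measurable_fun setT (fun x => sin (b * x)).
  by have := measurable_cos b (- (pi / 2)); under eq_fun do rewrite cosBpihalf.
have i1 := integrable_stdpdf (R := R).
have i2 : mu.-integrable setT (EFin \o (fun x => cos (b * x) * stdpdf x)).
  by apply: (@integrable_bounded_stdpdf _ _ 1 mcos) => x; rewrite ler_norml cos_geN1 cos_le1.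
have i3 : mu.-integrable setT (EFin \o (fun x => sin (b * x) * stdpdf x)).
  by apply: (@integrable_bounded_stdpdf _ _ 1 msin) => x; rewrite ler_norml sin_geN1 sin_le1.
(* The density is even, so the reflection x -> - x exchanges the integrals of 1 + sin and 1 -
   sin. *)
have sin0 : \int[mu]_x (sin (b * x) * stdpdf x) = 0.
  have : (\int[mu]_x ((1 + sin (b * x))%:E * (stdpdf x)%:E) =
      \int[mu]_x ((1 - sin (b * x))%:E * (stdpdf x)%:E))%E.
    rewrite ge0_integral_oppr.
    - by apply: eq_integral => x _; rewrite stdpdfN mulrN sinN.
    - apply: emeasurable_funM; apply/measurable_EFinP; last exact: measurable_stdpdf.
      exact: measurable_funD.
    - move=> x; rewrite mule_ge0// lee_fin ?(ltW (stdpdf_gt0 _))//; have := sin_geN1 (b * x); lra.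
  under eq_integral do rewrite -EFinM mulrDl mul1r EFinD.
  under [RHS]eq_integral do rewrite -EFinM mulrBl mul1r EFinB.
  rewrite integralD// integralB//.
  rewrite -(@fineK _ (\int[mu]_x (stdpdf x)%:E)%E); last exact: integrable_fin_num.
  rewrite -(@fineK _ (\int[mu]_x (sin (b * x) * stdpdf x)%:E)%E); last exact: integrable_fin_num.
  by rewrite -EFinD -EFinB /Rintegral => -[]; lra.
have -> : (fun x => (1 + cos (b * x + th))%:E * (stdpdf x)%:E)%E =
  (fun x => ((stdpdf x)%:E + ((cos th)%:E * (cos (b * x) * stdpdf x)%:E - (sin th)%:E * (sin (b * x) * stdpdf x)%:E))%E).
  apply/funext => x; rewrite -!EFinM -EFinB -EFinD; congr EFin.
  by rewrite cosD; ring.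
rewrite integralD//; last first.
  by apply: integrableB => //; apply: integrableZl.
rewrite integralB//; [|exact: integrableZl..].
rewrite !integralZl// -stdpdfE integral_normal_pdf stdpdfE.
rewrite -(@fineK _ (\int[mu]_x (cos (b * x) * stdpdf x)%:E)%E); last exact: integrable_fin_num.
rewrite -(@fineK _ (\int[mu]_x (sin (b * x) * stdpdf x)%:E)%E); last exact: integrable_fin_num.
rewrite -/(Rintegral mu setT _) -/(Rintegral mu setT _) sin0 mule0 sube0.
by rewrite -/(gauss_cf b) gauss_cfE -EFinM -EFinD mulrC.
Qed.

End normal_integrals.

(** * The bivariate normal law and its copula density *)

Lemma measurable_section1 {R : realType}
    (h : measurableTypeR R * measurableTypeR R -> \bar R) (x : R) :
  measurable_fun setT h ->
  measurable_fun setT (fun z : measurableTypeR R => h (x, z)).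
Proof.
move=> mh; apply: (measurableT_comp mh).
by apply: measurable_fun_pair; [exact: measurable_cst|exact: measurable_id].
Qed.

Lemma integral_probability_cst d (T : measurableType d) (R : realType)
  (P : probability T R) (c : R) : (\int[P]__ c%:E = c%:E)%E.
Proof.
have := integral_cst P measurableT c%:E; rewrite /cst => ->.
by rewrite -[RHS]mule1; congr (_ * _)%E; exact: probability_setT.
Qed.

Section bivariate_normal.
Context d (T : measurableType d) (R : realType) (P : probability T R).
Variables (X Y : {RV P >-> R}) (rho : R).
Local Notation N01 := (@normal_prob R 0 1).
Local Notation RR := (measurableTypeR R * measurableTypeR R)%type.

(** What [multivariate_normal] says about vectors supported by two coordinates. This is the
    Cramer-Wold description of the joint law; the joint law itself is recovered in
    [bivariate_normal_law]. *)
Definition bivariate_normal := forall a b : R, (a != 0) || (b != 0) ->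
  forall B, measurable B -> P [set x | B (a * X x + b * Y x)] =
    normal_prob 0 (Num.sqrt (a ^+ 2 + 2 * a * b * rho + b ^+ 2)) B.

Hypothesis rho1 : `|rho| < 1.
Hypothesis XY : bivariate_normal.

Let tau := Num.sqrt (1 - rho ^+ 2).

Let tau_gt0 : 0 < tau.
Proof. by rewrite sqrtr_gt0 subr_gt0 -real_normK ?num_real// expr_lt1. Qed.

Let tau2 : tau ^+ 2 = 1 - rho ^+ 2.
Proof. by rewrite sqr_sqrtr// subr_ge0 -real_normK ?num_real// expr_le1// ltW. Qed.

(** Cholesky factor of the correlation matrix: it sends two independent standard normals to a pair
    of correlation rho, the second coordinate being normal of mean rho x and deviation tau given the
    first one x. *)
Let phi (p : RR) : RR := (p.1, rho * p.1 + tau * p.2).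

Let mphi : measurable_fun setT phi.
Proof.
apply: measurable_fun_pair => //.
by apply: measurable_funD; apply: measurable_funM.
Qed.

Let pXY (x : T) : RR := (X x, Y x).

Let mpXY : measurable_fun setT pXY.
Proof.
have mX (V : {RV P >-> R}) : measurable_fun setT (V : T -> measurableTypeR R).
  exact: (@measurable_funPT _ _ _ _ V).
by apply: measurable_fun_pair; exact: mX.
Qed.

Let law_XY (a b th : R) :
  (\int[P]_x (1 + cos (a * X x + b * Y x + th))%:E =
   (1 + expR (- ((a ^+ 2 + 2 * a * b * rho + b ^+ 2) / 2)) * cos th)%:E)%E.
Proof.
(* [bivariate_normal] says nothing about the zero combination; there the integrand is constant. *)
have [/andP[/eqP -> /eqP ->]|ab] := boolP ((a == 0) && (b == 0)).
  rewrite !(mul0r, mulr0, expr0n, addr0, oppr0)/= expR0 mul1r.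
  under eq_integral do rewrite !mul0r !add0r.
  by rewrite integral_probability_cst.
have {}ab : (a != 0) || (b != 0) by rewrite negb_and in ab.
set s2 := _ + b ^+ 2.
have s2_gt0 : 0 < s2.
  (* Completing the square shows that the variance of a nonzero combination is positive. *)
  have -> : s2 = (a + rho * b) ^+ 2 + (tau * b) ^+ 2 by rewrite exprMn tau2 /s2; ring.
  have [b0|b0] := eqVneq b 0.
    move: ab; rewrite b0 eqxx orbF !mulr0 addr0 expr0n addr0 => a0.
    by rewrite exprn_even_gt0.
  apply: ltr_wpDl; first exact: sqr_ge0.
  by rewrite exprn_even_gt0//= mulf_neq0// gt_eqF.
pose L x := a * X x + b * Y x.
have mL : measurable_fun setT L by apply: measurable_funD; apply: measurable_funM.
have mf : measurable_fun setT (fun y : R => (1 + cos (y + th))%:E).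
  apply/measurable_EFinP; apply: measurable_funD => //.
  by have := measurable_cos 1 th; under eq_fun do rewrite mul1r.
have mL' : measurable_fun setT (L : T -> measurableTypeR R) by exact: mL.
pose fL : {mfun T >-> measurableTypeR R} := HB.pack L (isMeasurableFun.Build _ _ _ _ _ mL').
transitivity (\int[distribution P fL]_y (1 + cos (y + th))%:E)%E.
  by rewrite ge0_integral_distribution// => y; rewrite lee_fin onePcos_ge0.
transitivity (\int[normal_prob 0 (Num.sqrt s2)]_y (1 + cos (y + th))%:E)%E.
  by apply: eq_measure_integral => B mB _; exact: XY.
rewrite ge0_integral_normal_std ?sqrtr_gt0//.
under eq_integral do rewrite add0r.
by rewrite integral_normal01_cos sqr_sqrtr// ltW.
Qed.

Let law_phi (a b th : R) :
  (\int[(N01 \x N01)%E]_p (1 + cos (a * (phi p).1 + b * (phi p).2 + th))%:E =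
   (1 + expR (- ((a ^+ 2 + 2 * a * b * rho + b ^+ 2) / 2)) * cos th)%:E)%E.
Proof.
rewrite fubini_tonelli1/=; last 2 first.
- apply/measurable_EFinP; apply: measurable_funD => //.
  apply: measurableT_comp; first exact: continuous_measurable_fun (@continuous_cos R).
  by do !apply: measurable_funD => //; do ?apply: measurable_funM => //;
    do ?apply: measurable_funD => //; apply: measurable_funM.
- by move=> p; rewrite lee_fin onePcos_ge0.
rewrite /fubini_F /=.
pose k := expR (- ((b * tau) ^+ 2 / 2)).
have k1 : k <= 1 by rewrite -expR0 ler_expR oppr_le0 divr_ge0// sqr_ge0.
have k0 : 0 <= k by exact: expR_ge0.
(* Conditionally on x the cosine is damped by [k <= 1]; writing the result as (1 - k) + k (1 + cos)
   keeps both terms nonnegative for the outer integral. *)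
have inner x : (\int[N01]_y (1 + cos (a * x + b * (rho * x + tau * y) + th))%:E =
    (1 - k)%:E + k%:E * (1 + cos ((a + b * rho) * x + th))%:E)%E.
  under eq_integral => y _.
    rewrite (_ : a * x + b * (rho * x + tau * y) + th =
      (b * tau) * y + ((a + b * rho) * x + th)); last by ring.
    over.
  by rewrite integral_normal01_cos -EFinM -EFinD; congr EFin; rewrite -/k; ring.
under eq_integral do rewrite inner.
have mcos : measurable_fun setT (fun x : R => (1 + cos ((a + b * rho) * x + th))%:E).
  by apply/measurable_EFinP; apply: measurable_funD => //; exact: measurable_cos.
rewrite ge0_integralD//; last 3 first.
- by move=> x _; rewrite lee_fin subr_ge0.
- by move=> x _; rewrite mule_ge0 ?lee_fin// onePcos_ge0.
- by apply: emeasurable_funM.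
rewrite ge0_integralZl//.
rewrite (integral_probability_cst N01) integral_normal01_cos.
rewrite -EFinM -EFinD; congr EFin.
rewrite mulrDr mulr1 addrA subrK; congr (_ + _).
rewrite mulrA /k -expRD; congr (expR _ * _).
by rewrite exprMn tau2; field.
Qed.

(** The laws of (X, Y) and of [phi] have the same cosine means by [law_XY] and [law_phi], hence
    coincide on measurable sets by [eq_probability_wave]. *)
Lemma bivariate_normal_law (h : RR -> \bar R) : measurable_fun setT h ->
  (forall p, 0 <= h p)%E ->
  (\int[P]_x h (X x, Y x) = \int[(N01 \x N01)%E]_p h (p.1, rho * p.1 + tau * p.2)%R)%E.
Proof.
move=> mh h0.
pose fXY : {mfun T >-> RR} := HB.pack pXY (isMeasurableFun.Build _ _ _ _ _ mpXY).
pose fphi : {mfun RR >-> RR} := HB.pack phi (isMeasurableFun.Build _ _ _ _ _ mphi).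
have wave_eq a b th :
    (\int[distribution P fXY]_p (cos (a * p.1 + b * p.2 + th))%:E =
     \int[distribution (N01 \x N01)%E fphi]_p (cos (a * p.1 + b * p.2 + th))%:E)%E.
  have mc : measurable_fun setT (fun p : RR => cos (a * p.1 + b * p.2 + th)).
    by apply: wave_measurable; exists a, b, th.
  have shift (m : probability RR R) :
    (\int[m]_p (cos (a * p.1 + b * p.2 + th))%:E =
     \int[m]_p (1 + cos (a * p.1 + b * p.2 + th))%:E - 1)%E.
    under [in RHS]eq_integral do rewrite EFinD.
    rewrite integralD//; last 2 first.
    - exact: finite_measure_integrable_cst.
    - apply: (@le_integrable _ _ _ m setT measurableT _ (EFin \o cst 1)).
      + by apply/measurable_EFinP.
      + by move=> p _ /=; rewrite lee_fin normr1 ler_norml cos_geN1 cos_le1.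
      + exact: finite_measure_integrable_cst.
    by rewrite integral_probability_cst addeAC subee// add0e.
  rewrite !shift; congr (_ - _)%E.
  rewrite !ge0_integral_distribution//.
  - by rewrite -[LHS]/(\int[P]_x _)%E law_XY law_phi.
  - by apply/measurable_EFinP; exact: measurable_funD.
  - by apply/measurable_EFinP; exact: measurable_funD.
have := @eq_probability_wave _ _ _ wave_eq => hE.
transitivity (\int[distribution P fXY]_p h p)%E.
  by rewrite ge0_integral_distribution.
transitivity (\int[distribution (N01 \x N01)%E fphi]_p h p)%E.
  by apply: eq_measure_integral => E mE _; exact: hE.
by rewrite ge0_integral_distribution.
Qed.

(* The density of the law with respect to the product of the marginals. *)
Definition gauss_copula (r x z : R) : R := (Num.sqrt (1 - r ^+ 2))^-1 *
  expR (- ((r ^+ 2 * x ^+ 2 - 2 * r * x * z + r ^+ 2 * z ^+ 2) / (2 * (1 - r ^+ 2)))).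

Lemma gauss_copula_ge0 r x z : 0 <= gauss_copula r x z.
Proof. by rewrite mulr_ge0 ?expR_ge0// invr_ge0 sqrtr_ge0. Qed.

Lemma measurable_gauss_copula r :
  measurable_fun setT (fun p : RR => gauss_copula r p.1 p.2).
Proof.
apply: measurable_funM => //; apply: measurableT_comp => //.
apply: measurableT_comp => //; apply: measurable_funM => //.
apply: measurable_funD; last by apply: measurable_funM => //; exact: measurable_funX.
apply: measurable_funB; first by apply: measurable_funM => //; exact: measurable_funX.
by apply: measurable_funM => //; exact: measurable_funM.
Qed.

Lemma bivariate_normal_copula (h : RR -> \bar R) : measurable_fun setT h ->
  (forall p, 0 <= h p)%E ->
  (\int[P]_x h (X x, Y x) =
   \int[N01]_x \int[N01]_z (h (x, z) * (gauss_copula rho x z)%:E))%E.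
Proof.
move=> mh h0; rewrite bivariate_normal_law// fubini_tonelli1/=; last 2 first.
- exact: measurableT_comp mphi.
- by move=> p.
rewrite /fubini_F /=; apply: eq_integral => x _.
have mhx := measurable_section1 x mh.
apply: (etrans (esym (@ge0_integral_normal_std _ (rho * x) tau (fun z => h (x, z)) tau_gt0 mhx (fun z => h0 (x, z))))).
apply: (etrans (@ge0_integral_normal _ _ _ _ mhx (fun z => h0 (x, z)))).
rewrite ge0_integral_normal01; last 2 first.
- apply: emeasurable_funM => //; apply/measurable_EFinP.
  have /measurable_EFinP := measurable_gauss_copula rho.
  by move=> /(measurable_section1 x)/measurable_EFinP.
- by move=> z; rewrite mule_ge0// lee_fin gauss_copula_ge0.
apply: eq_integral => z _; rewrite -muleA -EFinM; congr (_ * _%:E)%E.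
rewrite normal_pdf_std// /gauss_copula -/tau /stdpdf.
(* The conditional normal density of z given x is divided by the standard one; the remaining
   exponent is symmetric in x and z. *)
have -> : - ((z - rho * x) ^+ 2 / (2 * tau ^+ 2)) =
    - ((rho ^+ 2 * x ^+ 2 - 2 * rho * x * z + rho ^+ 2 * z ^+ 2) /
       (2 * (1 - rho ^+ 2))) + - (z ^+ 2 / 2).
  by rewrite tau2; field; rewrite -tau2 gt_eqF// exprn_gt0.
rewrite expRD -!mulrA; congr (_ * _); exact: mulrCA.
Qed.

End bivariate_normal.

(** * Mills' ratio and Pareto scores *)

Section gaussian_tail.
Context {R : realType}.
Local Notation mu := (@lebesgue_measure R).
Local Notation N01 := (@normal_prob R 0 1).
Implicit Types x y z : R.

Lemma normal01E A : N01 A = (\int[mu]_(x in A) (stdpdf x)%:E)%E.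
Proof. by rewrite /normal_prob stdpdfE. Qed.

Lemma measurable_EFin_stdpdf (D : set R) :
  measurable_fun D (fun x : R => (stdpdf x)%:E).
Proof.
by apply: measurable_funTS; apply/measurable_EFinP; exact: measurable_stdpdf.
Qed.

Lemma normal01_fin A : measurable A -> N01 A \is a fin_num.
Proof. by move=> mA; exact: fin_num_measure. Qed.

Lemma onem_Phi z : (1 - Phi z)%:E = N01 `]z, +oo[.
Proof.
rewrite /Phi EFinB fineK ?normal01_fin//.
have -> : `]z, +oo[%classic = ~` `]-oo, z]%classic :> set R by rewrite setCitvl.
by rewrite probability_setC.
Qed.

Lemma normal01_itv_cy z : N01 `]z, +oo[ = N01 `[z, +oo[.
Proof.
rewrite !normal01E; apply: integral_itv_obnd_cbnd.
exact: measurable_EFin_stdpdf.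
Qed.

Lemma normal01_opp z : N01 `]-oo, z[ = N01 `]- z, +oo[.
Proof.
rewrite !normal01E integral_mkcond [RHS]integral_mkcond.
apply: (etrans (ge0_integral_oppr _ _)).
- by apply/(measurable_restrictT _ _).1 => //; exact: measurable_EFin_stdpdf.
- by move=> x; rewrite patchE; case: ifP => // _; rewrite lee_fin ltW// stdpdf_gt0.
apply: eq_integral => x _; rewrite !patchE.
have -> : (- x \in `]-oo, z[%classic) = (x \in `](- z)%R, +oo[%classic).
  by apply/idP/idP => /set_mem /= h; apply/mem_set; move: h;
    rewrite /= !in_itv/= ?andbT ltrNl.
by case: ifP => // _; rewrite stdpdfN.
Qed.

Lemma Phi_ocitv x y : x <= y -> (Phi y - Phi x)%:E = N01 `]x, y].
Proof.
move=> xy; rewrite /Phi EFinB !fineK ?normal01_fin//.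
have -> : `]x, y]%classic = `]-oo, y]%classic `\` `]-oo, x]%classic :> set R.
  by rewrite setDE setCitvl; apply/seteqP; split=> u /=; rewrite !in_itv/= ?andbT;
    [move=> /andP[]|move=> [? ?]; apply/andP].
rewrite measureD// ?setIidr//.
  by move=> u /=; rewrite !in_itv/= => /le_trans; apply.
by rewrite (le_lt_trans (probability_le1 _ _)) ?ltry.
Qed.

Lemma Phi_sub_le x y : x <= y -> Phi y - Phi x <= normal_peak 1 * (y - x).
Proof.
move=> xy; rewrite -lee_fin Phi_ocitv// normal01E.
apply: (@le_trans _ _ (\int[mu]_(u in `]x, y]) (normal_peak 1)%:E)%E).
  apply: ge0_le_integral => //=.
  - by move=> u _; rewrite lee_fin ltW// stdpdf_gt0.
  - exact: measurable_EFin_stdpdf.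
  - by move=> u _; rewrite lee_fin -stdpdfE normal_pdf_ub// oner_eq0.
rewrite integral_cst//= lebesgue_measure_itv/= lte_fin.
case: ifPn => [_|]; first by rewrite EFinM EFinB.
by move=> _; rewrite mule0 lee_fin mulr_ge0 ?normal_peak_ge0 ?subr_ge0.
Qed.

Lemma Phi_lt x y : x < y -> Phi x < Phi y.
Proof.
move=> xy; rewrite -subr_gt0 -lte_fin Phi_ocitv ?ltW// normal01E.
pose m := Num.max `|x| `|y|.
apply: (@lt_le_trans _ _ (\int[mu]_(u in `]x, y]) (stdpdf m)%:E)%E).
  rewrite integral_cst//= lebesgue_measure_itv/= lte_fin xy.
  by rewrite -EFinB -EFinM lte_fin mulr_gt0 ?stdpdf_gt0 ?subr_gt0.
apply: ge0_le_integral => //=.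
- by move=> u _; rewrite lee_fin ltW// stdpdf_gt0.
- exact: measurable_EFin_stdpdf.
- move=> u; rewrite in_itv/= => /andP[xu uy].
  rewrite lee_fin /stdpdf ler_pM2l ?normal_peak_gt0 ?oner_neq0//.
  rewrite ler_expR lerN2 ler_pM2r ?invr_gt0//.
  rewrite -(real_normK (num_real u)) ler_sqr ?nnegrE ?le_max ?normr_ge0//.
  have [u0|u0] := leP 0 u.
    by rewrite (ger0_norm u0) (le_trans uy (ler_norm _)) orbT.
  by rewrite (ltr0_norm u0) -(normrN x) (le_trans _ (ler_norm _))// lerN2 ltW.
Qed.

Lemma Phi_le x y : (Phi x <= Phi y) = (x <= y).
Proof.
have [xy|yx] := leP x y; last by rewrite leNgt Phi_lt.
by move: xy; rewrite le_eqVlt => /predU1P[->|/Phi_lt/ltW //]; rewrite lexx.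
Qed.

Lemma Phi_ltE x y : (Phi x < Phi y) = (x < y).
Proof. by rewrite !ltNge Phi_le. Qed.

Lemma continuous_Phi : continuous (@Phi R).
Proof.
have p0 : 0 < normal_peak 1 :> R by rewrite normal_peak_gt0 ?oner_neq0.
move=> x; apply/cvgrPdist_le => e e0.
have c0 : 0 < (normal_peak 1)^-1 * e.
  apply: mulr_gt0; last exact: e0.
  by rewrite invr_gt0.
near=> y.
apply: (@le_trans _ _ (normal_peak 1 * `|x - y|)).
  have [xy|/ltW yx] := leP x y.
    rewrite distrC ger0_norm ?subr_ge0 ?Phi_le//.
    by rewrite (le_trans (Phi_sub_le xy))// ler_wpM2l ?(ltW p0)// distrC ler_norm.
  rewrite ger0_norm ?subr_ge0 ?Phi_le//.
  by rewrite (le_trans (Phi_sub_le yx))// ler_wpM2l ?(ltW p0)// ler_norm.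
rewrite -ler_pdivlMl//; near: y.
Unshelve. all: by end_near. Qed.

Lemma PhiN x : Phi (- x) = 1 - Phi x.
Proof.
have h : N01 `]-oo, (- x)%R] = N01 `]x, +oo[.
  rewrite -[in RHS](opprK x) -normal01_opp !normal01E; apply/esym.
  by apply: integral_itv_bndo_bndc; exact: measurable_EFin_stdpdf.
by apply/EFin_inj; rewrite onem_Phi -h /Phi fineK// normal01_fin.
Qed.

Lemma Phi0 : Phi (0 : R) = 2^-1.
Proof. by have := PhiN 0; rewrite oppr0; lra. Qed.

Lemma cvg_stdpdfy : stdpdf x @[x --> +oo] --> (0 : R).
Proof.
rewrite -[X in _ --> X](mulr0 (normal_peak 1)).
apply: cvgM; first exact: cvg_cst.
apply: (@squeeze_cvgr _ _ _ _ (fun=> 0) (fun x => x^-1)).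
- near=> x; rewrite expR_ge0 /=.
  have x0 : 0 < x by near: x; exact: nbhs_pinfty_gt.
  have h : x <= expR (x ^+ 2 / 2).
    rewrite (le_trans _ (expR_ge1Dx _))//; have h := sqr_ge0 (x - 1); lra.
  by rewrite expRN lef_pV2 ?posrE ?expR_gt0.
- exact: cvg_cst.
- by apply/gtr0_cvgV0 => //; near=> x; near: x; exact: nbhs_pinfty_gt.
Unshelve. all: by end_near. Qed.

(** On [z, +oo[ one has z [stdpdf x] <= x [stdpdf x], and the right-hand side has primitive -
    [stdpdf x]. *)
Lemma mills_upper z : 0 < z -> 1 - Phi z <= stdpdf z / z.
Proof.
move=> z0; rewrite ler_pdivlMr// -lee_fin mulrC EFinM onem_Phi normal01_itv_cy.
have cs : continuous (fun x : R => x * stdpdf x).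
  by move=> x; apply: cvgM; [exact: cvg_id|exact: continuous_stdpdf].
have ds x : is_derive x (1 : R) (fun x => - stdpdf x) (x * stdpdf x).
  have h := is_derive_stdpdf x; apply: is_derive_eq.
  by rewrite mulNr opprK.
have <- : (\int[mu]_(x in `[z, +oo[) (x * stdpdf x)%:E = (stdpdf z)%:E)%E.
  rewrite (@ge0_continuous_FTC2y _ _ (fun x => - stdpdf x) z 0).
  - by rewrite -EFinB sub0r opprK.
  - by move=> x zx; rewrite mulr_ge0 ?(ltW (stdpdf_gt0 _))// (le_trans (ltW z0)).
  - exact: continuous_subspaceT.
  - by rewrite -[X in _ --> X]oppr0; apply: cvgN; exact: cvg_stdpdfy.
  - by move=> x _; have [] := ds x.
  - by apply: cvg_at_right_filter; apply: cvgN; exact: continuous_stdpdf.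
  - by move=> x _; rewrite derive1E; have [_ ->] := ds x.
have ms : measurable_fun `[z, +oo[ (fun x : R => (stdpdf x)%:E).
  exact: measurable_EFin_stdpdf.
rewrite normal01E -ge0_integralZl//; last 2 first.
- by move=> x _; rewrite lee_fin ltW// stdpdf_gt0.
- by rewrite lee_fin ltW.
apply: ge0_le_integral => //=.
- by move=> x _; rewrite mule_ge0// lee_fin ?(ltW z0)// ltW// stdpdf_gt0.
- exact: emeasurable_funM.
- by apply: measurable_funTS; apply/measurable_EFinP; exact: continuous_measurable_fun.
- move=> x; rewrite in_itv/= andbT => zx.
  by rewrite -EFinM lee_fin ler_wpM2r// ltW// stdpdf_gt0.
Qed.

(** The primitive - [stdpdf x] / x has derivative (1 + x^-2) [stdpdf x], which is at most (1 + z^-2)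
    [stdpdf x] for x >= z. *)
Lemma mills_lower z : 0 < z -> stdpdf z / z <= (1 + z ^- 2) * (1 - Phi z).
Proof.
move=> z0; rewrite -lee_fin [leRHS]EFinM onem_Phi normal01_itv_cy.
pose f x := (1 + x ^- 2) * stdpdf x.
pose F x := - (stdpdf x / x).
have ds x : 0 < x -> is_derive x (1 : R) F (f x).
  move=> x0; have h := is_derive_stdpdf x; rewrite /F /f.
  have xn0 : x != 0 by rewrite gt_eqF.
  have hV := is_deriveV xn0 (is_derive_id x (1 : R)).
  have hN := is_deriveN (is_deriveM h hV).
  apply: (is_derive_eq hN); rewrite /GRing.scale /=.
  by field.
have f0 x : 0 < x -> 0 <= f x.
  by move=> x0; rewrite mulr_ge0 ?(ltW (stdpdf_gt0 _))// addr_ge0// invr_ge0 exprn_ge0 ?ltW.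
have cf x : 0 < x -> {for x, continuous f}.
  move=> x0; apply: cvgM; last exact: continuous_stdpdf.
  apply: cvgD; first exact: cvg_cst.
  by apply: cvgV; [rewrite gt_eqF// exprn_gt0|exact: exprn_continuous].
have cF x : 0 < x -> {for x, continuous F}.
  by move=> /ds[dFx _]; apply/differentiable_continuous/derivable1_diffP.
have cwf : {within `[z, +oo[, continuous f}.
  apply: continuous_in_subspaceT => x /set_mem /=; rewrite in_itv/= andbT => zx.
  by apply: cf; exact: lt_le_trans zx.
have <- : (\int[mu]_(x in `[z, +oo[) (f x)%:E = (stdpdf z / z)%:E)%E.
  rewrite (@ge0_continuous_FTC2y _ f F z 0).
  - by rewrite -EFinB sub0r opprK.
  - by move=> x zx; apply: f0; exact: lt_le_trans zx.
  - exact: cwf.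
  - rewrite -[X in _ --> X]oppr0; apply: cvgN.
    rewrite -[X in _ --> X](mulr0 0); apply: cvgM; first exact: cvg_stdpdfy.
    by apply/gtr0_cvgV0 => //; near=> x; near: x; exact: nbhs_pinfty_gt.
  - by move=> x zx; have [] := ds _ (lt_trans z0 zx).
  - by apply: cvg_at_right_filter; exact: cF.
  - move=> x; rewrite in_itv/= andbT => zx; rewrite derive1E.
    by have [_ ->] := ds _ (lt_trans z0 zx).
rewrite normal01E -ge0_integralZl//; last 3 first.
- exact: measurable_EFin_stdpdf.
- by move=> x _; rewrite lee_fin ltW// stdpdf_gt0.
- by rewrite lee_fin addr_ge0// invr_ge0 exprn_ge0// ltW.
apply: ge0_le_integral => //=.
- by move=> x; rewrite in_itv/= andbT => zx; rewrite lee_fin f0// (lt_le_trans z0).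
- apply/measurable_EFinP; apply: subspace_continuous_measurable_fun => //.
- by apply: emeasurable_funM => //; exact: measurable_EFin_stdpdf.
- move=> x; rewrite in_itv/= andbT => zx; rewrite -EFinM lee_fin.
  apply: ler_wpM2r; first by rewrite ltW// stdpdf_gt0.
  rewrite lerD2l lef_pV2 ?posrE ?exprn_gt0 ?(lt_le_trans z0)//.
  by rewrite ler_sqr ?nnegrE ?(ltW z0)// (le_trans (ltW z0)).
Unshelve. all: by end_near. Qed.

Lemma Phi_gt0 z : 0 < Phi z.
Proof.
have h : 0 <= Phi (z - 1) by rewrite /Phi fine_ge0.
by apply: le_lt_trans h _; rewrite Phi_ltE; lra.
Qed.

Lemma Phi_lt1 z : Phi z < 1.
Proof. by have := Phi_gt0 (- z); rewrite PhiN; lra. Qed.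

Lemma Phi_near1 (e : R) : 0 < e -> exists2 z, 0 < z & 1 - Phi z < e.
Proof.
move=> e0; have p0 : 0 < normal_peak 1 :> R by rewrite normal_peak_gt0 ?oner_neq0.
pose z := 2 * normal_peak 1 / e.
have z0 : 0 < z by rewrite divr_gt0// mulr_gt0.
exists z => //.
apply: (le_lt_trans (mills_upper z0)); rewrite ltr_pdivrMr//.
have -> : e * z = 2 * normal_peak 1 by rewrite /z mulrC divfK// gt_eqF.
rewrite (@le_lt_trans _ _ (normal_peak 1))//; last by lra.
by rewrite -stdpdfE normal_pdf_ub// oner_eq0.
Qed.

Lemma Phi_surj p : 0 < p < 1 -> exists z, Phi z = p.
Proof.
move=> /andP[p0 p1].
have [b b0 hb] : exists2 z, 0 < z & 1 - Phi z < 1 - p by apply: Phi_near1; lra.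
have [a a0 ha] := Phi_near1 p0.
have ab : - a <= b by lra.
have ha' : Phi (- a) <= p by rewrite PhiN ltW.
have hb' : p <= Phi b by lra.
have cP : {within `[- a, b], continuous (@Phi R)}.
  exact: continuous_subspaceT continuous_Phi.
have hp : Num.min (Phi (- a)) (Phi b) <= p <= Num.max (Phi (- a)) (Phi b).
  by rewrite ge_min ha' /= le_max hb' orbT.
by have [z _ zp] := IVT ab cP hp; exists z.
Qed.

End gaussian_tail.

(** * The standard Pareto law and its scores *)

Section pareto.
Context {R : realType}.
Local Notation mu := (@lebesgue_measure R).
Local Notation N01 := (@normal_prob R 0 1).

Lemma eq_probability_ray (m1 m2 : probability (measurableTypeR R) R) :
  (forall y, m1 `]y, +oo[%classic = m2 `]y, +oo[%classic) ->
  forall A, measurable A -> m1 A = m2 A.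
Proof.
move=> h; apply: (@measure_unique _ R (measurableTypeR R) (@RGenOInfty.G R)
    (fun n : nat => `](- n%:R)%R, +oo[%classic) _ _ _ _ m1 m2).
- exact: RGenOInfty.measurableE.
- move=> _ _ [x ->] [y ->]; exists (Num.max x y).
  apply/seteqP; split => u /=; rewrite !in_itv/= !andbT gt_max.
    by move=> [-> ->].
  by move=> /andP[].
- by move=> n; exists (- n%:R).
- apply/seteqP; split => // x _; exists (Num.truncn `|x|).+1 => //=.
  rewrite in_itv/= andbT ltrNl (le_lt_trans _ (truncnS_gt _))//.
  by rewrite -normrN ler_norm.
- by move=> _ [y ->]; exact: h.
- by move=> n; rewrite (le_lt_trans (probability_le1 _ _))// ltry.
Qed.

Definition pareto_pdf (y : R) : R := y `^ (-2) * (1 <= y)%R%:R.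

Lemma pareto_pdf_ge0 y : 0 <= pareto_pdf y.
Proof. by rewrite mulr_ge0// powR_ge0. Qed.

Lemma measurable_pareto_pdf : measurable_fun setT pareto_pdf.
Proof.
apply: measurable_funM; first exact: measurable_powR.
have -> : (fun y : R => (1 <= y)%R%:R) = \1_`[1%R, +oo[ :> (R -> R).
  apply/funext => y; rewrite indicE; congr (nat_of_bool _)%:R.
  by apply/idP/idP => [h|/set_mem]; [apply/mem_set|]; rewrite /= in_itv/= andbT.
exact: measurable_indic.
Qed.

Definition pareto (A : set (measurableTypeR R)) : \bar R :=
  (\int[mu]_(y in A) (pareto_pdf y)%:E)%E.

Lemma pareto_ray y : 1 <= y -> pareto `]y, +oo[ = (y^-1)%:E.
Proof.
move=> y1; have y0 : 0 < y by lra.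
have mp := measurable_pareto_pdf.
rewrite /pareto integral_itv_obnd_cbnd; last first.
  by apply: measurable_funTS; apply/measurable_EFinP.
have E u : y <= u -> pareto_pdf u = u ^- 2.
  move=> yu; rewrite /pareto_pdf (le_trans y1 yu) mulr1.
  by rewrite powRN powR_mulrn// (le_trans (ltW y0)).
under eq_integral => u /set_mem /=.
  rewrite in_itv/= andbT => /E ->; over.
rewrite (@ge0_continuous_FTC2y _ (fun u => u ^- 2) (fun u => - u^-1) y 0).
- by rewrite -EFinB sub0r opprK.
- by move=> u yu; rewrite invr_ge0 exprn_ge0// (le_trans (ltW y0)).
- apply: continuous_in_subspaceT => u /set_mem /=; rewrite in_itv/= andbT => yu.
  by apply: cvgV; [rewrite gt_eqF// exprn_gt0// (lt_le_trans y0)|exact: exprn_continuous].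
- rewrite -[X in _ --> X]oppr0; apply: cvgN.
  by apply/gtr0_cvgV0 => //; near=> x; near: x; exact: nbhs_pinfty_gt.
- move=> u yu; apply: derivableN; apply: derivableV => //.
  by rewrite gt_eqF// (lt_trans y0).
- apply: cvg_at_right_filter; apply: cvgN; apply: cvgV => //.
  by rewrite gt_eqF.
- move=> u; rewrite in_itv/= andbT => yu.
  have u0 : u != 0 by rewrite gt_eqF// (lt_trans y0).
  have h := is_deriveN (is_deriveV u0 (is_derive_id u (1 : R))).
  by rewrite derive1E; have [_ ->] := h; rewrite /GRing.scale /=; field.
Unshelve. all: by end_near. Qed.

Let pareto0 : pareto set0 = 0%E.
Proof. by rewrite /pareto integral_set0. Qed.

Let pareto_ge0 A : (0 <= pareto A)%E.
Proof. by apply: integral_ge0 => y _; rewrite lee_fin pareto_pdf_ge0. Qed.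

Let pareto_sigma_additive : semi_sigma_additive pareto.
Proof.
move=> F mF tF mUF; rewrite /pareto ge0_integral_bigcup//; last 2 first.
- apply: measurable_funTS; apply/measurable_EFinP; exact: measurable_pareto_pdf.
- by move=> y _; rewrite lee_fin pareto_pdf_ge0.
apply: is_cvg_ereal_nneg_natsum_cond => n _ _.
by apply: integral_ge0 => y _; rewrite lee_fin pareto_pdf_ge0.
Qed.

HB.instance Definition _ := isMeasure.Build _ _ _
  pareto pareto0 pareto_ge0 pareto_sigma_additive.

Let pareto_setT : pareto [set: _] = 1%E.
Proof.
rewrite -invr1 -(pareto_ray (lexx 1)) /pareto integral_itv_obnd_cbnd; last first.
  by apply: measurable_funTS; apply/measurable_EFinP; exact: measurable_pareto_pdf.
rewrite [RHS]integral_mkcond; apply: eq_integral => u _; rewrite patchE.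
case: ifPn => // /negP u1; rewrite /pareto_pdf leNgt.
have -> : u < 1; last by rewrite mulr0.
by rewrite ltNge; apply/negP => h; apply: u1; apply/mem_set; rewrite /= in_itv/= h.
Qed.

HB.instance Definition _ :=
  @Measure_isProbability.Build _ _ R pareto pareto_setT.

(** A function that sends a standard normal variable to a standard Pareto one. Levels y >= 1 suffice
    to fix the law, since the tail at level 1 already has full mass. *)
Definition is_score (s : R -> R) :=
  measurable_fun setT s /\ forall y, 1 <= y -> N01 [set x | y < s x] = (y^-1)%:E.

Lemma is_score_measurable s y : is_score s -> measurable [set x : measurableTypeR R | y < s x].
Proof.
move=> [ms _]; have := ms measurableT `]y, +oo[%classic (measurable_itv _).
by rewrite setTI; congr measurable; apply/seteqP; split=> x /=; rewrite in_itv/= andbT.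
Qed.

Lemma integral_score (s : R -> R) (f : R -> \bar R) : is_score s ->
  measurable_fun setT f -> (forall y, 0 <= f y)%E ->
  (\int[N01]_x f (s x) = \int[mu]_y (f y * (pareto_pdf y)%:E))%E.
Proof.
move=> hs mf f0; have [ms sE] := hs.
have ms' : measurable_fun setT (s : measurableTypeR R -> measurableTypeR R) by exact: ms.
pose fs : {mfun measurableTypeR R >-> measurableTypeR R} :=
  HB.pack (s : measurableTypeR R -> measurableTypeR R) (isMeasurableFun.Build _ _ _ _ _ ms').
transitivity (\int[distribution N01 fs]_y f y)%E.
  by apply/esym; exact: ge0_integral_distribution.
transitivity (\int[pareto]_y f y)%E.
  apply: eq_measure_integral => A mA _; apply: eq_probability_ray mA => y.
  have E z : distribution N01 fs `]z, +oo[%classic = N01 [set x | z < s x].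
    by rewrite /distribution /pushforward; congr (N01 _); apply/seteqP;
      split=> x /=; rewrite in_itv/= andbT.
  rewrite -[RHS]/(pareto `]y, +oo[%classic); apply: (etrans (E y)).
  have [y1|y1] := leP 1 y; first by rewrite sE// pareto_ray.
  (* Below level 1 both tails contain the tail at level 1, of mass 1, so both have mass 1. *)
  have h1 : (1 <= N01 [set x | (y < s x)%R])%E.
    have <- : N01 [set x | 1 < s x] = 1%E by rewrite sE// invr1.
    apply: (@le_measure _ _ _ N01).
    - by apply/mem_set; exact: is_score_measurable.
    - by apply/mem_set; exact: is_score_measurable.
    - by move=> x /=; exact: lt_trans.
  have h2 : (1 <= pareto `]y, +oo[%classic)%E.
    have <- : pareto `]1%R, +oo[%classic = 1%E by rewrite pareto_ray// invr1.
    apply: (@le_measure _ _ _ pareto).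
    - by apply/mem_set; exact: measurable_itv.
    - by apply/mem_set; exact: measurable_itv.
    - by move=> x /=; rewrite !in_itv/= !andbT; exact: lt_trans.
  apply/eqP; rewrite eq_le.
  apply/andP; split.
    by apply: (le_trans _ h2); apply: (@probability_le1 _ _ _ N01); exact: is_score_measurable.
  by apply: (le_trans _ h1); apply: (@probability_le1 _ _ _ pareto).
apply: (@ge0_integral_density _ _ _ mu pareto pareto_pdf) => //.
- exact: measurable_pareto_pdf.
- exact: pareto_pdf_ge0.
Qed.

End pareto.

(** * One-sided and two-sided scores, and Mills' ratio in logarithmic form *)

Section scores.
Context {R : realType}.
Local Notation N01 := (@normal_prob R 0 1).
Implicit Types x z t : R.

Definition score1 x : R := (1 - Phi x)^-1.

Definition score2 x : R := (2 * (1 - Phi `|x|))^-1.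

Lemma onem_Phi_gt0 x : 0 < 1 - Phi x.
Proof. by rewrite subr_gt0 Phi_lt1. Qed.

Lemma score1_gt0 x : 0 < score1 x.
Proof. by rewrite invr_gt0 onem_Phi_gt0. Qed.

Lemma score2E x : score2 x = score1 `|x| / 2.
Proof. by rewrite /score2 invfM mulrC. Qed.

Lemma lt_score1 x z : (score1 x < score1 z) = (x < z).
Proof. by rewrite ltf_pV2 ?posrE ?onem_Phi_gt0// ltrD2l ltrN2 Phi_ltE. Qed.

Lemma continuous_score1 : continuous score1.
Proof.
move=> x; apply: cvgV; first by rewrite gt_eqF// onem_Phi_gt0.
by apply: cvgB; [exact: cvg_cst|exact: continuous_Phi].
Qed.

Lemma score1_ray (y : R) : 1 < y -> exists2 z, Phi z = 1 - y^-1 & forall x, (y < score1 x) = (z < x).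
Proof.
move=> y1; have y0 : 0 < y by lra.
have [|z zy] := @Phi_surj R (1 - y^-1).
  by rewrite subr_gt0 invf_lt1// y1/= gtrBl invr_gt0.
exists z => // x; rewrite -[RHS]lt_score1.
by have -> : score1 z = y by rewrite /score1 zy subKr invrK.
Qed.

Lemma is_score1 : is_score score1.
Proof.
split; first exact: continuous_measurable_fun continuous_score1.
(* Level 1 is apart: 1 - 1 / y = 0 is not a value of [Phi], but every score exceeds 1. *)
move=> y; rewrite le_eqVlt => /predU1P[<-|y1].
  have -> : [set x | 1 < score1 x] = setT.
    apply/seteqP; split => // x _ /=.
    by rewrite /score1 invf_gt1 ?onem_Phi_gt0//; have := Phi_gt0 x; lra.
  by rewrite invr1; exact: probability_setT.
have [z zy yE] := score1_ray y1.
have -> : [set x | y < score1 x] = `]z, +oo[%classic.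
  by apply/seteqP; split => x /=; rewrite in_itv/= andbT yE.
by rewrite -onem_Phi zy; congr EFin; lra.
Qed.

Lemma is_score2 : is_score score2.
Proof.
split.
  have -> : score2 = (fun x => score1 `|x| / 2) by apply/funext => x; exact: score2E.
  apply: measurable_funM => //; apply: measurableT_comp => //.
  exact: continuous_measurable_fun continuous_score1.
move=> y y1; have y20 : 1 < 2 * y by lra.
have [z zy yE] := score1_ray y20.
(* Since 1 / (2 y) <= 1 / 2, the level z is nonnegative and the two rays of |x| > z are disjoint. *)
have z0 : 0 <= z.
  rewrite -Phi_le Phi0 zy invfM; have : y^-1 <= 1 by rewrite invf_le1; lra.
  by lra.
have -> : [set x | y < score2 x] = `]z, +oo[%classic `|` `]-oo, (- z)%R[%classic.
  apply/seteqP; split => x /=; rewrite !in_itv/= andbT score2E ltr_pdivlMr// mulrC yE ltr_normr ltrNr.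
    by move=> /orP.
  by move=> ?; apply/orP.
rewrite measureU//; last first.
  by rewrite -subset0 => x /=; rewrite !in_itv/= andbT => -[]; lra.
transitivity (N01 `]z, +oo[%classic + N01 `]-oo, (- z)%R[%classic)%E; first by [].
rewrite normal01_opp opprK -onem_Phi zy -EFinD; congr EFin.
by rewrite invfM; lra.
Qed.

Definition log_peak : R := - ln (normal_peak 1).

Lemma log_peakE : 2 * log_peak = ln (2 * pi).
Proof.
have p0 : 0 < (pi : R) by exact: pi_gt0.
have hs : 0 < Num.sqrt (2 * pi) :> R by rewrite sqrtr_gt0 mulr_gt0.
rewrite /log_peak /normal_peak.
have -> : (1 : R) ^+ 2 * pi *+ 2 = 2 * pi by ring.
rewrite lnV ?posrE// opprK -[in RHS](@sqr_sqrtr _ (2 * pi)) ?mulr_ge0 ?ltW//.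
by rewrite expr2 lnM ?posrE//; lra.
Qed.

Lemma ln_stdpdf x : ln (stdpdf x) = - log_peak - x ^+ 2 / 2.
Proof.
by rewrite /stdpdf lnM ?posrE ?expR_gt0 ?normal_peak_gt0 ?oner_neq0// expRK /log_peak opprK.
Qed.

Definition mills_err x : R := ln (score1 x) - x ^+ 2 / 2 - ln x - log_peak.

(** Logarithm of the two Mills inequalities, with ln(1 + x^-2) <= x^-2. *)
Lemma mills_err_bound x : 0 < x -> 0 <= mills_err x <= x ^- 2.
Proof.
move=> x0; have q0 := onem_Phi_gt0 x; have p0 := stdpdf_gt0 x.
have x20 : 0 < 1 + x ^- 2 by rewrite ltr_wpDr// invr_ge0 exprn_ge0// ltW.
have lnQ : ln (score1 x) = - ln (1 - Phi x) by rewrite /score1 lnV ?posrE.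
have lnpx : ln (stdpdf x / x) = - log_peak - x ^+ 2 / 2 - ln x.
  by rewrite ln_div ?posrE// ln_stdpdf.
have h1 : ln (1 - Phi x) <= ln (stdpdf x / x).
  by rewrite ler_ln ?posrE ?divr_gt0//; exact: mills_upper.
have h2 : ln (stdpdf x / x) <= ln (1 + x ^- 2) + ln (1 - Phi x).
  have ml := mills_lower x0.
  have pm : 0 < (1 + x ^- 2) * (1 - Phi x) by rewrite mulr_gt0.
  have pd : 0 < stdpdf x / x by rewrite divr_gt0.
  by rewrite -lnM ?posrE// ler_ln ?posrE.
have h3 : ln (1 + x ^- 2) <= x ^- 2.
  by apply: le_ln1Dx; rewrite (lt_le_trans (ltrN10 _))// invr_ge0 exprn_ge0// ltW.
by rewrite /mills_err lnQ; apply/andP; split; lra.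
Qed.

Lemma ln_dist x z : 1 <= x -> 1 <= z -> `|ln x - ln z| <= `|x - z|.
Proof.
wlog xz : x z / z <= x.
  move=> h x1 z1; have [zx|/ltW xz] := leP z x; first exact: h.
  by rewrite distrC (distrC x); exact: h.
move=> x1 z1; have x0 : 0 < x by lra. have z0 : 0 < z by lra.
rewrite !ger0_norm ?subr_ge0 ?ler_ln ?posrE//.
rewrite -ln_div ?posrE//.
have -> : x / z = 1 + (x - z) / z by field; rewrite gt_eqF.
have h : 0 <= (x - z) / z by rewrite divr_ge0 ?subr_ge0// ltW.
rewrite (le_trans (le_ln1Dx _))//; first by lra.
by rewrite ler_pdivrMr// ler_peMr ?subr_ge0.
Qed.

Lemma ln_near1 (u e : R) : e <= 2^-1 -> `|1 - u| <= e -> `|ln u| <= 2 * e.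
Proof.
move=> e2; rewrite ler_norml => /andP[h1 h2].
have u0 : 0 < u by lra.
have hu : ln u <= u - 1.
  have := @le_ln1Dx _ (u - 1); have -> : 1 + (u - 1) = u by ring.
  apply; lra.
have hv : - ln u <= u^-1 - 1.
  rewrite -lnV ?posrE//.
  have := @le_ln1Dx _ (u^-1 - 1); have -> : 1 + (u^-1 - 1) = u^-1 by ring.
  apply; have : 0 < u^-1 by rewrite invr_gt0.
  by lra.
have hw : u^-1 - 1 <= 2 * e.
  rewrite lerBlDr -[u^-1]mul1r ler_pdivrMr//.
  nra.
by rewrite ler_norml; apply/andP; split; lra.
Qed.

Lemma expR_near0 (u e : R) : e <= 2^-1 -> `|u| <= e -> `|expR u - 1| <= 2 * e.
Proof.
move=> e2; rewrite ler_norml => /andP[h1 h2].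
have h3 := expR_ge1Dx u; have h4 := expR_ge1Dx (- u).
have h5 : expR u <= 1 + 2 * e.
  have : expR (- u) * expR u = 1 by rewrite -expRD addNr expR0.
  have := expR_gt0 u; nra.
by rewrite ler_norml; apply/andP; split; lra.
Qed.

End scores.

(** * Asymptotics of the copula density *)

Section copula_asymptotics.
Context {R : realType}.
Implicit Types r x z t L B l e : R.

Definition copula_exponent r x z : R :=
  - ((r ^+ 2 * x ^+ 2 - 2 * r * x * z + r ^+ 2 * z ^+ 2) / (2 * (1 - r ^+ 2))).

(** Logarithm of the ratio between the density and its equivalent [copula_cst r] (score1 x score1 z
    / L)^beta, with [L] in the role of ln t; see [gauss_copulaE]. *)
Definition copula_err r L x z : R :=
  copula_exponent r x z -
  beta_ r * (ln (score1 x) + ln (score1 z) - ln (4 * pi) - ln L).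

Lemma beta_E r : 0 < r -> beta_ r = r / (1 + r).
Proof. by move=> r0; rewrite /beta_ /a_; field; apply/lt0r_neq0; lra. Qed.

Lemma beta_itv r : 0 < r < 1 -> 0 < beta_ r < 1.
Proof.
move=> /andP[r0 r1]; rewrite beta_E// divr_gt0 ?addr_gt0//=.
by rewrite ltr_pdivrMr ?addr_gt0// mul1r ltrDr.
Qed.

(* The exponent is r / (1 + r) (x^2 + z^2) / 2 - r (x - z)^2 / (2 (1 - r^2)), and
   Mills' ratio expresses x^2 / 2 by ln (score1 x). *)
Lemma copula_errE r L x z : 0 < r < 1 -> 0 < x -> 0 < z ->
  copula_err r L x z = - beta_ r * ((ln x - (ln 2 + ln L) / 2) + (ln z - (ln 2 + ln L) / 2)
     + mills_err x + mills_err z) - r * (x - z) ^+ 2 / (2 * (1 - r ^+ 2)).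
Proof.
move=> /andP[r0 r1] x0 z0.
rewrite /copula_err /copula_exponent /mills_err.
have -> : ln (4 * pi) = ln 2 + 2 * log_peak :> R.
  by rewrite log_peakE -lnM ?posrE ?mulr_gt0 ?pi_gt0//; congr ln; ring.
rewrite beta_E//; field.
have r2 : r ^+ 2 < 1 by rewrite expr_lt1// ltW.
by rewrite !gt_eqF//; [nra|lra..].
Qed.

Let norm_bound4 (a b c e f l D h : R) : `|a| <= l -> `|b| <= l -> `|c| <= D ->
  0 <= e <= h -> 0 <= f <= h -> h <= 1 -> `|a - b - c - (e - f)| <= 2 * l + D + 1.
Proof.
rewrite !ler_norml => /andP[a1 a2] /andP[b1 b2] /andP[c1 c2] /andP[e1 e2] /andP[f1 f2] h1.
have h2 : -1 <= e - f <= 1 by apply/andP; split; lra.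
move: h2 => /andP[h2 h3]; clear -a1 a2 b1 b2 c1 c2 h2 h3.
by apply/andP; split; lra.
Qed.

Let norm_bound5 (u v e f k h : R) : `|u| <= k -> `|v| <= k ->
  0 <= e <= h -> 0 <= f <= h -> `|u + v + e + f| <= 2 * k + 2 * h.
Proof.
rewrite !ler_norml => /andP[a1 a2] /andP[b1 b2] /andP[e1 e2] /andP[f1 f2].
by apply/andP; split; lra.
Qed.

(** If ln(score1 y) is within l of L, Mills' ratio gives y^2 / 2 = L + O(y), hence ln y = (ln 2 + ln
    L) / 2 + O(1 / y). Subtracting the relations for x and z bounds (x - z) (x + z) by a constant
    plus a multiple of |x - z|, so x - z = O(1 / B). Both estimates enter the formula of
    [copula_errE]. *)
Lemma copula_err_bound r l : 0 < r < 1 -> 0 <= l -> exists A : R, 0 < A /\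
  forall B L x z, 2 <= B -> A / B <= 2^-1 -> B <= x -> B <= z -> 0 < L ->
  `|ln (score1 x) - L| <= l -> `|ln (score1 z) - L| <= l ->
  `|copula_err r L x z| <= A / B.
Proof.
move=> r01 l0; have /andP[r0 r1] := r01.
have r2 : r ^+ 2 < 1 by rewrite expr_lt1// ltW.
pose C := l + `|log_peak| + 1 : R.
pose cr := r / (2 * (1 - r ^+ 2)).
have cr0 : 0 < cr by rewrite divr_gt0// mulr_gt0// subr_gt0.
have C0 : 0 <= C by rewrite !addr_ge0.
(* In order: the two logarithmic deviations, each at most 2 (C + 1) / B; the two Mills remainders,
   each at most 1 / B; the term in (x - z)^2. *)
pose A := 4 * (C + 1) + 2 + cr * (4 * (2 * l + 1) ^+ 2).
have A0 : 0 < A.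
  have : 0 <= cr * (4 * (2 * l + 1) ^+ 2) by rewrite mulr_ge0 ?(ltW cr0)// mulr_ge0// sqr_ge0.
  by rewrite /A; lra.
have hA : 2 * (C + 1) <= A.
  have : 0 <= cr * (4 * (2 * l + 1) ^+ 2) by rewrite mulr_ge0 ?(ltW cr0)// mulr_ge0// sqr_ge0.
  by rewrite /A; lra.
have AE B : A / B = 4 * (C + 1) / B + 2 / B + cr * (4 * (2 * l + 1) ^+ 2) / B by rewrite /A; ring.
clearbody A.
exists A; split => // B L x z B2 AB Bx Bz L0 hx hz.
have B0 : 0 < B by lra.
have x1 : 1 <= x by lra. have z1 : 1 <= z by lra.
have mills y : B <= y -> 0 <= mills_err y <= B^-1.
  move=> By; have y0 : 0 < y by lra.
  have /andP[-> h] := mills_err_bound y0; rewrite /= (le_trans h)//.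
  rewrite lef_pV2 ?posrE ?exprn_gt0//; nra.
have hB : B^-1 <= 2^-1 by rewrite lef_pV2 ?posrE//; lra.
have hlog y : B <= y -> `|ln (score1 y) - L| <= l ->
    `|ln y - (ln 2 + ln L) / 2| <= 2 * (C + 1) / B.
  move=> By hy; have y0 : 0 < y by lra.
  have /andP[m0 m1] := mills y By.
  have lny0 : 0 <= ln y by rewrite ln_ge0//; lra.
  have lny : ln y <= y.
    have := @le_ln1Dx _ (y - 1); have -> : 1 + (y - 1) = y by ring.
    have y1 : -1 < y - 1 by lra.
    by move=> /(_ y1); lra.
  have h1 : `|y ^+ 2 / 2 - L| <= C + y.
    have hp : `|log_peak| <= `|log_peak : R| by [].
    move: hy hp m0 m1 lny0 lny; rewrite /C /mills_err !ler_norml.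
    by move=> /andP[? ?] /andP[? ?] ? ? ? ?; apply/andP; split; lra.
  have y2 : 0 < y ^+ 2 by rewrite exprn_gt0.
  have h2 : `|1 - 2 * L / y ^+ 2| <= 2 * (C + 1) / B.
    have -> : 1 - 2 * L / y ^+ 2 = (y ^+ 2 / 2 - L) * (2 / y ^+ 2).
      by field; rewrite gt_eqF.
    rewrite normrM [`|2 / _|]ger0_norm; last by rewrite divr_ge0// ltW.
    apply: (@le_trans _ _ ((C + y) * (2 / y ^+ 2))).
      by rewrite ler_wpM2r// divr_ge0// ltW.
    apply: (@le_trans _ _ (((C + 1) * y) * (2 / y ^+ 2))).
      by apply: ler_wpM2r; [rewrite divr_ge0// ltW|nra].
    have -> : (C + 1) * y * (2 / y ^+ 2) = 2 * (C + 1) / y by field; rewrite gt_eqF.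
    by apply: ler_wpM2l; [lra|rewrite lef_pV2 ?posrE].
  have h3 : `|ln (2 * L / y ^+ 2)| <= 2 * (2 * (C + 1) / B).
    apply: ln_near1 h2; apply: (le_trans _ AB).
    apply: ler_wpM2r; first by rewrite invr_ge0 ltW.
    exact: hA.
  have E : ln (2 * L / y ^+ 2) = ln 2 + ln L - 2 * ln y.
    by rewrite ln_div ?posrE ?mulr_gt0// lnM ?posrE// expr2 lnM ?posrE//; ring.
  have -> : ln y - (ln 2 + ln L) / 2 = - ln (2 * L / y ^+ 2) / 2 by rewrite E; field.
  rewrite normrM normrN [`|2^-1|]ger0_norm// ler_pdivrMr//.
  by rewrite [leRHS]mulrC.
have hdist : (x - z) ^+ 2 <= 4 * (2 * l + 1) ^+ 2 / B.
  have /andP[mx0 mx1] := mills x Bx; have /andP[mz0 mz1] := mills z Bz.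
  have hln := ln_dist x1 z1.
  set D := `|x - z| in hln.
  have D0 : 0 <= D by exact: normr_ge0.
  (* Difference of the two Mills expansions, with x^2 - z^2 factored. *)
  have e1 : (x - z) * (x + z) / 2 =
    (ln (score1 x) - L) - (ln (score1 z) - L) - (ln x - ln z) - (mills_err x - mills_err z).
    by rewrite /mills_err; ring.
  have e2 : D * (x + z) / 2 <= 2 * l + D + 1.
    have -> : D * (x + z) / 2 = `|(x - z) * (x + z) / 2|.
      have xz0 : 0 <= x + z by lra.
      by rewrite !normrM (ger0_norm xz0) [`|2^-1|]ger0_norm.
    rewrite e1; apply: (norm_bound4 hx hz hln (mills x Bx) (mills z Bz)).
    by rewrite (le_trans hB)// invf_le1//; lra.
  have DE : (x - z) ^+ 2 = D ^+ 2 by rewrite real_normK// num_real.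
  (* As B >= 2, the D on the right of [e2] is at most half of D B and is absorbed. *)
  have e3 : D * B <= 2 * (2 * l + 1).
    have h1 : D * B <= D * (x + z) / 2 by rewrite -mulrA; apply: ler_wpM2l => //; lra.
    have h2 : D * 2 <= D * B by apply: ler_wpM2l.
    by clear -h1 h2 e2; lra.
  rewrite DE; clear -D0 e3 B2 l0.
  have B0 : 0 < B by lra.
  rewrite ler_pdivlMr//.
  apply: (@le_trans _ _ ((D * B) ^+ 2)).
    by rewrite exprMn; apply: ler_wpM2l; [exact: sqr_ge0|nra].
  have -> : 4 * (2 * l + 1) ^+ 2 = (2 * (2 * l + 1)) ^+ 2 by ring.
  by rewrite ler_sqr ?nnegrE//; [rewrite mulr_ge0// ltW|lra].
have x0 : 0 < x by lra. have z0 : 0 < z by lra.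
rewrite copula_errE//.
have /andP[mx0 mx1] := mills x Bx; have /andP[mz0 mz1] := mills z Bz.
have /andP[b0 b1] := beta_itv r01.
have := hlog _ Bx hx; have := hlog _ Bz hz.
set u := ln x - _; set v := ln z - _ => hv hu.
have h1 : `|- beta_ r * (u + v + mills_err x + mills_err z)| <=
    4 * (C + 1) / B + 2 / B.
  rewrite normrM normrN (gtr0_norm b0).
  have h : `|u + v + mills_err x + mills_err z| <= 4 * (C + 1) / B + 2 / B.
    have -> : 4 * (C + 1) / B = 2 * (2 * (C + 1) / B) by ring.
    exact: norm_bound5 hu hv (mills x Bx) (mills z Bz).
  rewrite (le_trans _ h)// ler_piMl//; exact: ltW.
have h2 : `|r * (x - z) ^+ 2 / (2 * (1 - r ^+ 2))| <= cr * (4 * (2 * l + 1) ^+ 2) / B.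
  have -> : r * (x - z) ^+ 2 / (2 * (1 - r ^+ 2)) = cr * (x - z) ^+ 2 by rewrite /cr mulrAC.
  rewrite ger0_norm; last by rewrite mulr_ge0 ?sqr_ge0// ltW.
  by rewrite -mulrA; apply: ler_wpM2l => //; exact: ltW.
by rewrite (le_trans (ler_normB _ _))// (le_trans (lerD h1 h2))// AE.
Qed.

End copula_asymptotics.

(** * Equivalents of the copula densities, uniform on boxes *)

Section kernel_asymptotics.
Context {R : realType}.
Implicit Types (r x z t eps M eta b kap : R) (s : R -> R) (k : R -> R -> R).

(** The error is relative to the main term, so integrating a nonnegative function against the kernel
    only perturbs the constant [kap] by eta. The threshold on t depends on the box [eps, M]^2 but
    not on the point in it. *)
Definition kernel_asymp s k b kap := forall eps M eta, 0 < eps -> 0 < eta ->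
  \forall t \near +oo, forall x z, eps <= s x / t <= M -> eps <= s z / t <= M ->
  `|k x z - kap * (s x * s z / ln t) `^ b| <= eta * (s x * s z / ln t) `^ b.

Lemma score1_ge_near B eps : 0 < eps ->
  \forall t \near +oo, forall x, eps <= score1 x / t -> B <= x.
Proof.
move=> e0; near=> t => x.
have t0 : 0 < t by near: t; exact: nbhs_pinfty_gt.
have tB : score1 B / eps < t by near: t; apply: nbhs_pinfty_gt; rewrite num_real.
rewrite ler_pdivlMr// => h; apply/ltW; rewrite -lt_score1.
by apply: lt_le_trans h; rewrite mulrC -ltr_pdivrMr.
Unshelve. all: by end_near. Qed.

Lemma copula_err_near r eps M eta : 0 < r < 1 -> 0 < eps -> 0 < eta ->
  \forall t \near +oo, forall x z,
  eps <= score1 x / t <= M -> eps <= score1 z / t <= M ->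
  `|expR (copula_err r (ln t) x z) - 1| <= eta.
Proof.
move=> r01 e0 eta0.
pose l := `|ln eps| + `|ln M|.
have l0 : 0 <= l by rewrite addr_ge0.
have [A [A0 hA]] := copula_err_bound r01 l0.
pose e := Num.min 2^-1 (eta / 2).
have e_gt0 : 0 < e by rewrite lt_min invr_gt0 divr_gt0//= andbT.
(* Chosen so that A / B <= e, where e <= 1 / 2 is the range of [expR_near0] and 2 e <= eta is the
   target. *)
pose B := Num.max 2 (A / e).
have B2 : 2 <= B by rewrite le_max lexx.
have B0 : 0 < B by lra.
have ABe : A / B <= e.
  by rewrite ler_pdivrMr// mulrC -ler_pdivrMr// le_max lexx orbT.
have e2 : e <= 2^-1 by rewrite ge_min lexx.
have ee : 2 * e <= eta by rewrite mulrC -ler_pdivlMr// ge_min lexx orbT.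
near=> t => x z hx hz.
have t1 : 1 < t by near: t; exact: nbhs_pinfty_gt.
have L0 : 0 < ln t by rewrite ln_gt0.
have t0 : 0 < t by lra.
have hB : forall y, eps <= score1 y / t -> B <= y by near: t; exact: score1_ge_near.
have hl y : eps <= score1 y / t <= M -> `|ln (score1 y) - ln t| <= l.
  move=> /andP[h1 h2]; have s0 := score1_gt0 y.
  have q0 : 0 < score1 y / t by rewrite divr_gt0.
  rewrite -ln_div ?posrE//.
  have M0 : 0 < M by exact: lt_le_trans h2.
  have h3 : ln eps <= ln (score1 y / t) by rewrite ler_ln ?posrE.
  have h4 : ln (score1 y / t) <= ln M by rewrite ler_ln ?posrE.
  have h5 := ler_norm (- ln eps); have h6 := ler_norm (ln M).
  have h7 := normr_ge0 (ln eps); have h8 := normr_ge0 (ln M).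
  by rewrite normrN in h5; rewrite ler_norml /l; apply/andP; split; lra.
rewrite (le_trans _ ee)//; apply: expR_near0 => //.
apply: (le_trans _ ABe); apply: hA => //.
- exact: le_trans ABe e2.
- by apply: hB; case/andP: hx.
- by apply: hB; case/andP: hz.
- exact: hl.
- exact: hl.
Unshelve. all: by end_near. Qed.

(** The factor of [K_] due to the density; the other factor (1 + r)^2 comes from the limiting
    masses, see [K_E]. *)
Definition copula_cst r : R := (Num.sqrt (1 - r ^+ 2))^-1 * (4 * pi) `^ (- beta_ r).

Lemma copula_cst_gt0 r : 0 < r < 1 -> 0 < copula_cst r.
Proof.
move=> /andP[r0 r1]; rewrite mulr_gt0 ?powR_gt0 ?mulr_gt0 ?pi_gt0//.
by rewrite invr_gt0 sqrtr_gt0 subr_gt0 expr_lt1// ltW.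
Qed.

Lemma gauss_copulaE r t x z : 1 < t ->
  gauss_copula r x z = copula_cst r * (score1 x * score1 z / ln t) `^ (beta_ r) *
    expR (copula_err r (ln t) x z).
Proof.
move=> t1; have L0 : 0 < ln t by rewrite ln_gt0.
have sx := score1_gt0 x; have sz := score1_gt0 z.
have p4 : 0 < 4 * pi :> R by rewrite mulr_gt0 ?pi_gt0.
have q0 : 0 < score1 x * score1 z / ln t by rewrite divr_gt0// mulr_gt0.
have pe (a u : R) : 0 < a -> a `^ u = expR (u * ln a) by move=> a0; rewrite /powR gt_eqF.
rewrite /gauss_copula /copula_cst -/(copula_exponent r x z).
rewrite (pe _ _ q0) (pe _ _ p4).
rewrite -[RHS]mulrA -[RHS]mulrA -!expRD; congr (_ * expR _).
rewrite ln_div ?posrE ?(mulr_gt0 sx sz)// [ln (score1 x * _)]lnM ?posrE//.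
by rewrite /copula_err; ring.
Qed.

Lemma kernel_asymp1 r : 0 < r < 1 ->
  kernel_asymp score1 (gauss_copula r) (beta_ r) (copula_cst r).
Proof.
move=> r01 eps M eta e0 eta0; have c0 := copula_cst_gt0 r01.
near=> t => x z hx hz.
have t1 : 1 < t by near: t; exact: nbhs_pinfty_gt.
rewrite (gauss_copulaE r x z t1); set P := _ `^ _.
have P0 : 0 <= P by exact: powR_ge0.
have -> : copula_cst r * P * expR (copula_err r (ln t) x z) - copula_cst r * P =
  P * (copula_cst r * (expR (copula_err r (ln t) x z) - 1)) by ring.
rewrite normrM (ger0_norm P0) mulrC; apply: ler_wpM2r => //.
rewrite normrM (gtr0_norm c0) mulrC -ler_pdivlMr//.
move: x z hx hz {P P0}; near: t; apply: copula_err_near => //; exact: divr_gt0.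
Unshelve. all: by end_near. Qed.

(* The even part of the Gaussian copula density, seen on absolute values. *)
Definition abs_copula r x z := (gauss_copula r `|x| `|z| + gauss_copula (- r) `|x| `|z|) / 2.

Lemma gauss_copulaN_le r x z : 0 < r < 1 -> 0 <= x -> 0 <= z ->
  gauss_copula (- r) x z <= (Num.sqrt (1 - r ^+ 2))^-1.
Proof.
move=> /andP[r0 r1] x0 z0; have r2 : r ^+ 2 < 1 by rewrite expr_lt1// ltW.
rewrite /gauss_copula sqrrN ler_piMr ?invr_ge0 ?sqrtr_ge0//.
rewrite -[leRHS]expR0 ler_expR oppr_le0 divr_ge0//; last by rewrite mulr_ge0// subr_ge0 ltW.
rewrite !(mulrN, mulNr) opprK; rewrite !addr_ge0 ?mulr_ge0 ?sqr_ge0//; exact: ltW.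
Qed.

(** Halved scores turn the power into 4^-b times the one-sided one, which is compensated by 4^b in
    the constant; the average over r and - r gives the factor 1 / 2, and 4^b / 2 = 2^(1 - q). *)
Lemma kernel_asymp2 r : 0 < r < 1 ->
  kernel_asymp score2 (abs_copula r) (beta_ r) (2 `^ (1 - q_ r) * copula_cst r).
Proof.
move=> r01 eps M eta e0 eta0; have c0 := copula_cst_gt0 r01.
have /andP[b0 b1] := beta_itv r01.
set b := beta_ r in b0 b1 *.
pose m := (Num.sqrt (1 - r ^+ 2))^-1.
have m0 : 0 <= m by rewrite invr_ge0 sqrtr_ge0.
have k4 : 0 < (4 : R) `^ b by exact: powR_gt0.
have k42 : 2 `^ (1 - q_ r) = 4 `^ b / 2 :> R.
  have -> : (4 : R) = 2 `^ 2 by rewrite powR_mulrn//; ring.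
  rewrite -powRrM -[X in _ = _ / X]powRr1// -powRN -powRD ?pnatr_eq0 ?implybT//.
  by congr (_ `^ _); rewrite /b /beta_ /q_; ring.
(* The main term is 4^-b P with P the power of the undivided scores; errors eta' P from the two
   densities are then averaged. *)
pose eta' := eta / 4 `^ b.
have eta'0 : 0 < eta' by rewrite divr_gt0.
near=> t => x z.
have t1 : 1 < t by near: t; exact: nbhs_pinfty_gt.
have t0 : 0 < t by lra.
have L0 : 0 < ln t by rewrite ln_gt0.
rewrite !score2E => hx hz.
have box (y : R) : eps <= score1 `|y| / 2 / t <= M -> 2 * eps <= score1 `|y| / t <= 2 * M.
  by rewrite mulrAC ler_pdivlMr// ler_pdivrMr// ![_ * 2]mulrC.
have {}hx := box _ hx; have {}hz := box _ hz.
have -> : score1 `|x| / 2 * (score1 `|z| / 2) / ln t = 4^-1 * (score1 `|x| * score1 `|z| / ln t).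
  by field; rewrite gt_eqF.
have s0 := score1_gt0 `|x|; have s0' := score1_gt0 `|z|.
have P0 : 0 < score1 `|x| * score1 `|z| / ln t by rewrite divr_gt0// mulr_gt0.
have hQ := ltW P0.
have P41 : (4^-1 : R) `^ b = (4 `^ b)^-1 by rewrite -powR_inv1// -powRrM mulN1r powRN.
rewrite powRM ?invr_ge0 ?(ltW P0)// P41 k42.
set P := (_ * _ / ln t) `^ b.
have {}P0 : 0 < P by exact: powR_gt0.
have h1 : `|gauss_copula r `|x| `|z| - copula_cst r * P| <= eta' * P.
  by move: (`|x|) (`|z|) hx hz @P {s0 s0' P0 hQ}; near: t; apply: kernel_asymp1 => //; rewrite mulr_gt0.
have h2 : gauss_copula (- r) `|x| `|z| <= eta' * P.
  rewrite (le_trans (gauss_copulaN_le r01 (normr_ge0 _) (normr_ge0 _)))// -/m.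
  rewrite mulrC -ler_pdivrMr//.
  have K0 : 0 <= m / eta' by rewrite divr_ge0// ltW.
  have -> : m / eta' = ((m / eta') `^ b^-1) `^ b.
    by rewrite -powRrM mulVf ?gt_eqF// powRr1.
  apply: ge0_ler_powR; rewrite ?nnegrE ?powR_ge0 ?(ltW b0)//.
  rewrite ler_pdivlMr//.
  have /andP[hx1 _] := hx; have /andP[hz1 _] := hz.
  rewrite ler_pdivlMr// in hx1; rewrite ler_pdivlMr// in hz1.
  apply: (@le_trans _ _ (2 * eps * t * (2 * eps * t))); last first.
    by apply: ler_pM => //; rewrite mulr_ge0// ?mulr_ge0// ltW.
  (* On the box P^(1/b) is at least 4 eps^2 t^2 / ln t, hence at least 4 eps^2 t because ln t <= t;
     this threshold brings it above (m / eta')^(1/b). *)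
  have hK : (m / eta') `^ b^-1 / (4 * eps ^+ 2) <= t.
    by near: t; apply: nbhs_pinfty_ge; rewrite num_real.
  rewrite ler_pdivrMr ?mulr_gt0 ?exprn_gt0// in hK.
  have -> : 2 * eps * t * (2 * eps * t) = (t * (4 * eps ^+ 2)) * t by ring.
  apply: ler_pM => //; [exact: powR_ge0|exact: ltW|].
  have := @le_ln1Dx _ (t - 1); have -> : 1 + (t - 1) = t by ring.
  have h : -1 < t - 1 by lra.
  by move=> /(_ h); lra.
have h3 : 0 <= gauss_copula (- r) `|x| `|z| by exact: gauss_copula_ge0.
have -> : abs_copula r x z - 4 `^ b / 2 * copula_cst r * ((4 `^ b)^-1 * P) =
  ((gauss_copula r `|x| `|z| - copula_cst r * P) + gauss_copula (- r) `|x| `|z|) / 2.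
  by rewrite /abs_copula -/P; field; rewrite gt_eqF.
have -> : eta * ((4 `^ b)^-1 * P) = eta' * P by rewrite /eta' mulrA.
rewrite normrM [`|2^-1|]ger0_norm// ler_pdivrMr//.
rewrite (le_trans (ler_normD _ _))// (ger0_norm h3).
by rewrite (le_trans (lerD h1 h2))//; lra.
Unshelve. all: by end_near. Qed.

End kernel_asymptotics.

(** * Mean increments restricted to a box *)

Section pareto_product.
Context {R : realType}.
Local Notation mu := (@lebesgue_measure R).
Local Notation N01 := (@normal_prob R 0 1).
Local Notation RR := (measurableTypeR R * measurableTypeR R)%type.

Lemma integral_score2 (s : R -> R) (H : RR -> \bar R) : is_score s ->
  measurable_fun setT H -> (forall p, 0 <= H p)%E ->
  (\int[(N01 \x N01)%E]_p H (s p.1, s p.2) =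
   \int[mu]_y \int[mu]_y' (H (y, y') * (pareto_pdf y)%:E * (pareto_pdf y')%:E))%E.
Proof.
move=> hs mH H0; have [ms _] := hs.
have mss : measurable_fun setT (fun p : RR => (s p.1, s p.2) : RR).
  by apply: measurable_fun_pair; exact: measurableT_comp.
have mp := measurable_pareto_pdf (R := R).
rewrite fubini_tonelli1; last 2 first.
- exact: measurableT_comp mss.
- by move=> p; exact: H0.
rewrite /fubini_F /=.
have mHp : measurable_fun setT (fun p : RR => H p * (pareto_pdf p.2)%:E)%E.
  by apply: emeasurable_funM => //; apply/measurable_EFinP; apply: measurableT_comp.
have Hp0 (p : RR) : (0 <= H p * (pareto_pdf p.2)%:E)%E.
  by rewrite mule_ge0// lee_fin pareto_pdf_ge0.
pose F (y : R) := (\int[mu]_y' (H (y, y') * (pareto_pdf y')%:E))%E.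
transitivity (\int[N01]_x F (s x))%E.
  apply: eq_integral => x _.
  apply: (integral_score (f := fun y' => H (s x, y')) hs) => //.
  exact: measurable_section1.
have mF : measurable_fun setT F.
  exact: (measurable_fun_fubini_tonelli_F (m2 := mu) _ mHp Hp0).
rewrite (integral_score hs mF); last by move=> y; apply: integral_ge0 => y' _; exact: Hp0.
apply: eq_integral => y _.
rewrite muleC -ge0_integralZl//.
- by apply: eq_integral => y' _; rewrite muleA (muleC (_%:E)).
- by apply: emeasurable_funM; [exact: measurable_section1|apply/measurable_EFinP].
- by rewrite lee_fin pareto_pdf_ge0.
Qed.

Lemma ge0_integral_scale2 (t : R) (H : RR -> \bar R) : 0 < t ->
  measurable_fun setT H -> (forall p, 0 <= H p)%E ->
  (\int[mu]_y \int[mu]_y' H (y, y') =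
   \int[mu]_u \int[mu]_v ((t ^+ 2)%:E * H ((t * u)%R, (t * v)%R)))%E.
Proof.
move=> t0 mH H0.
pose F (y : R) := (\int[mu]_y' H (y, y'))%E.
have mF : measurable_fun setT F.
  exact: (measurable_fun_fubini_tonelli_F (m2 := mu) _ mH H0).
have F0 y : (0 <= F y)%E by apply: integral_ge0.
have mtF : measurable_fun setT (fun u => F (t * u)).
  by apply: measurableT_comp mF _; exact: measurable_funM.
apply: (etrans (ge0_integral_affine 0 t0 mF F0)).
under eq_integral do rewrite addr0.
rewrite -ge0_integralZl//; last by rewrite lee_fin ltW.
apply: eq_integral => u _.
have mHu : measurable_fun setT (fun v : R => H (t * u, v)) by exact: measurable_section1.
have mHtu : measurable_fun setT (fun v : R => H (t * u, t * v)).
  by apply: (measurableT_comp mHu); exact: measurable_funM.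
rewrite /F (ge0_integral_affine 0 t0 mHu)//.
under eq_integral do rewrite addr0.
rewrite muleA -EFinM -expr2 -ge0_integralZl//.
by rewrite lee_fin sqr_ge0.
Qed.

End pareto_product.

Section box_limit.
Context d (T : measurableType d) (R : realType) (P : probability T R).
Local Notation mu := (@lebesgue_measure R).
Local Notation N01 := (@normal_prob R 0 1).
Local Notation RR := (measurableTypeR R * measurableTypeR R)%type.
Variables (s : R -> R) (k : R -> R -> R) (b kap : R) (X1 X2 : T -> R).
Hypothesis hs : is_score s.
Hypothesis k_ge0 : forall x z, 0 <= k x z.
Hypothesis mk : measurable_fun setT (fun p : RR => k p.1 p.2).
Hypothesis hk : kernel_asymp s k b kap.
Hypothesis hP : forall h : RR -> \bar R, measurable_fun setT h ->
  (forall p, 0 <= h p)%E ->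
  (\int[P]_x h (s (X1 x), s (X2 x)) =
   \int[(N01 \x N01)%E]_p (h (s p.1, s p.2) * (k p.1 p.2)%:E))%E.
Hypothesis kap_gt0 : 0 < kap.

Definition in_box (eps M : R) (p : R * R) : bool :=
  (p.1 \in `[eps, M]) && (p.2 \in `[eps, M]).

(** [rate rho] written in terms of b = [beta_ rho], so that 1 - b is [a_ rho]; see [rateE]. *)
Definition power_rate (t : R) : R := t `^ (- (2 * (1 - b))) * ln t `^ (- b).

Definition box_mass (g : R * R -> R) (eps M : R) : \bar R :=
  (\int[mu]_u \int[mu]_v (g (u, v) * (in_box eps M (u, v))%:R * (u * v) `^ (b - 2))%:E)%E.

Lemma measurable_in_box eps M : measurable_fun setT (fun p : RR => (in_box eps M p)%:R : R).
Proof.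
have -> : (fun p : RR => (in_box eps M p)%:R : R) = \1_(`[eps, M] `*` `[eps, M]) :> (RR -> R).
  apply/funext => p; rewrite indicE; congr (nat_of_bool _)%:R.
  by apply/idP/idP => [/andP[h1 h2]|/set_mem [h1 h2]]; [apply/mem_set|apply/andP].
by apply: measurable_indic; exact: measurableX.
Qed.

Let mscaled (g : R * R -> R) eps M t : measurable_fun setT (g : RR -> R) ->
  measurable_fun setT (fun p : RR => g (p.1 / t, p.2 / t) * (in_box eps M (p.1 / t, p.2 / t))%:R).
Proof.
move=> mg.
have mt : measurable_fun setT (fun p : RR => (p.1 / t, p.2 / t) : RR).
  by apply: measurable_fun_pair; apply: measurable_funM.
apply: measurable_funM; first exact: (measurableT_comp mg mt).
exact: (measurableT_comp (measurable_in_box eps M) mt).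
Qed.

(** An exact identity once t > 1 / eps: on the box both rescaled points exceed 1, where the Pareto
    density is a pure power. The powers of t collect as t^2 (t^2 / ln t)^b t^-4. *)
Lemma box_scaling (g : R * R -> R) eps M : measurable_fun setT (g : RR -> R) ->
  (forall p, 0 <= g p) -> 0 < eps -> \forall t \near +oo,
  (\int[(N01 \x N01)%E]_p (g (s p.1 / t, s p.2 / t) *
      (in_box eps M (s p.1 / t, s p.2 / t))%:R * (s p.1 * s p.2 / ln t) `^ b)%:E =
   (power_rate t)%:E * box_mass g eps M)%E.
Proof.
move=> mg g0 e0; near=> t.
have t1 : 1 < t by near: t; exact: nbhs_pinfty_gt.
have te : eps^-1 < t by near: t; apply: nbhs_pinfty_gt; rewrite num_real.
have t0 : 0 < t by lra.
have L0 : 0 < ln t by rewrite ln_gt0.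
pose H (p : RR) := (g (p.1 / t, p.2 / t) * (in_box eps M (p.1 / t, p.2 / t))%:R *
  (p.1 * p.2 / ln t) `^ b)%:E.
have mH : measurable_fun setT H.
  apply/measurable_EFinP; apply: measurable_funM; first exact: mscaled.
  apply: (measurableT_comp (measurable_powR _)).
  by apply: measurable_funM => //; apply: measurable_funM.
have H0 p : (0 <= H p)%E by rewrite lee_fin mulr_ge0 ?powR_ge0// mulr_ge0.
rewrite (integral_score2 hs mH H0).
pose H' (p : RR) := (H p * (pareto_pdf p.1)%:E * (pareto_pdf p.2)%:E)%E.
have mp := measurable_pareto_pdf (R := R).
have mH' : measurable_fun setT H'.
  by apply: emeasurable_funM; [apply: emeasurable_funM => //|];
    apply/measurable_EFinP; apply: measurableT_comp.
have H'0 p : (0 <= H' p)%E by rewrite !mule_ge0// lee_fin pareto_pdf_ge0.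
apply: (etrans (ge0_integral_scale2 t0 mH' H'0)).
have r0 : 0 <= power_rate t by rewrite mulr_ge0// powR_ge0.
pose V (p : RR) := (g (p.1, p.2) * (in_box eps M (p.1, p.2))%:R * (p.1 * p.2) `^ (b - 2))%:E.
have mV : measurable_fun setT V.
  apply/measurable_EFinP; apply: measurable_funM.
    have := mscaled eps M 1 mg; under eq_fun do rewrite !divr1.
    by [].
  by apply: (measurableT_comp (measurable_powR _)); apply: measurable_funM.
have V0 p : (0 <= V p)%E by rewrite lee_fin mulr_ge0 ?powR_ge0// mulr_ge0.
rewrite /box_mass -ge0_integralZl//; last 2 first.
- exact: (measurable_fun_fubini_tonelli_F (m2 := mu) _ mV V0).
- by move=> u _; apply: integral_ge0 => v _; exact: (V0 (u, v)).
apply: eq_integral => u _; rewrite -ge0_integralZl//; last 2 first.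
- exact: (measurable_section1 u mV).
- by move=> v _; exact: (V0 (u, v)).
apply: eq_integral => v _.
rewrite /H' /H /= ![t * _]mulrC !mulfK ?gt_eqF//.
have [uv|] := boolP (in_box eps M (u, v)); last by rewrite !(mulr0, mul0r, mul0e, mule0).
rewrite mulr1; have /andP[/=] := uv; rewrite !in_itv/= => /andP[eu _] /andP[ev _].
have tu : 1 <= u * t.
  by rewrite mulrC -ler_pdivrMr ?(lt_le_trans e0)// mul1r (le_trans _ (ltW te))// lef_pV2 ?posrE// (lt_le_trans e0).
have tv : 1 <= v * t.
  by rewrite mulrC -ler_pdivrMr ?(lt_le_trans e0)// mul1r (le_trans _ (ltW te))// lef_pV2 ?posrE// (lt_le_trans e0).
have u0 : 0 < u by exact: lt_le_trans eu.
have v0 : 0 < v by exact: lt_le_trans ev.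
rewrite /pareto_pdf tu tv !mulr1 -!EFinM; congr EFin.
have pe (a w : R) : 0 < a -> a `^ w = expR (w * ln a) by move=> a0; rewrite /powR gt_eqF.
have uv0 : 0 < u * v by rewrite mulr_gt0.
have ut0 : 0 < u * t by rewrite mulr_gt0.
have vt0 : 0 < v * t by rewrite mulr_gt0.
have Q0 : 0 < u * t * (v * t) / ln t by rewrite divr_gt0// mulr_gt0.
have E : t ^+ 2 * ((u * t * (v * t) / ln t) `^ b * (u * t) `^ (-2) * (v * t) `^ (-2)) =
    power_rate t * (u * v) `^ (b - 2).
  have -> : t ^+ 2 = expR (2 * ln t) by rewrite -pe// powR_mulrn// ltW.
  rewrite /power_rate (pe _ _ Q0) (pe _ _ ut0) (pe _ _ vt0) (pe _ _ uv0) (pe _ _ t0) (pe _ _ L0).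
  rewrite -!expRD; congr expR.
  rewrite ln_div ?posrE ?mulr_gt0// (lnM (x := u * t)) ?posrE//.
  rewrite !(lnM (y := t)) ?posrE// (lnM (x := u)) ?posrE//.
  by ring.
transitivity (g (u, v) * (t ^+ 2 * ((u * t * (v * t) / ln t) `^ b * (u * t) `^ (-2) * (v * t) `^ (-2)))).
  by ring.
by rewrite E mulrCA.
Unshelve. all: by end_near. Qed.

(** The relative error of the kernel passes through the nonnegative integrand; [eta <= kap] keeps
    the lower factor nonnegative, so that it too can be moved in and out of the integral. *)
Lemma box_limit (g : R * R -> R) eps M eta : measurable_fun setT (g : RR -> R) ->
  (forall p, 0 <= g p) -> 0 < eps -> 0 < eta <= kap ->
  \forall t \near +oo,
  ((kap - eta)%:E * ((power_rate t)%:E * box_mass g eps M) <=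
  \int[P]_x (g (s (X1 x) / t, s (X2 x) / t) *
      (in_box eps M (s (X1 x) / t, s (X2 x) / t))%:R)%:E <=
  (kap + eta)%:E * ((power_rate t)%:E * box_mass g eps M))%E.
Proof.
move=> mg g0 e0 /andP[eta0 etak]; near=> t.
have <- : (\int[(N01 \x N01)%E]_p (g (s p.1 / t, s p.2 / t) *
      (in_box eps M (s p.1 / t, s p.2 / t))%:R * (s p.1 * s p.2 / ln t) `^ b)%:E =
   (power_rate t)%:E * box_mass g eps M)%E by near: t; exact: box_scaling.
have hkt : forall x z, eps <= s x / t <= M -> eps <= s z / t <= M ->
  `|k x z - kap * (s x * s z / ln t) `^ b| <= eta * (s x * s z / ln t) `^ b.
  by near: t; exact: hk.
pose h (p : RR) := (g (p.1 / t, p.2 / t) * (in_box eps M (p.1 / t, p.2 / t))%:R)%:E.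
have mh : measurable_fun setT h by apply/measurable_EFinP; exact: mscaled.
have h0 p : (0 <= h p)%E by rewrite lee_fin mulr_ge0.
rewrite (hP mh h0).
have [ms _] := hs.
have mss : measurable_fun setT (fun p : RR => (s p.1, s p.2) : RR).
  by apply: measurable_fun_pair; exact: measurableT_comp.
have mhs : measurable_fun setT (fun p : RR => h (s p.1, s p.2)) by exact: (measurableT_comp mh mss).
have mQ : measurable_fun setT (fun p : RR => (s p.1 * s p.2 / ln t) `^ b).
  apply: (measurableT_comp (measurable_powR _)).
  by apply: measurable_funM => //; apply: measurable_funM; exact: measurableT_comp.
pose W (p : RR) := (h (s p.1, s p.2) * ((s p.1 * s p.2 / ln t) `^ b)%:E)%E.
have mW : measurable_fun setT W by apply: emeasurable_funM => //; exact/measurable_EFinP.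
have W0 p : (0 <= W p)%E by rewrite mule_ge0// lee_fin powR_ge0.
have mhk : measurable_fun setT (fun p : RR => h (s p.1, s p.2) * (k p.1 p.2)%:E)%E.
  by apply: emeasurable_funM => //; exact/measurable_EFinP.
have key p : ((kap - eta)%:E * W p <= h (s p.1, s p.2) * (k p.1 p.2)%:E <= (kap + eta)%:E * W p)%E.
  rewrite /W /h /= -!EFinM !lee_fin.
  have [hb|] := boolP (in_box _ _ _); last by rewrite !(mulr0, mul0r) lexx.
  rewrite mulr1; move/andP: hb => -[/=]; rewrite !in_itv/= => b1 b2.
  have := hkt _ _ b1 b2; set Q := _ `^ b; set G := g _.
  have G0 : 0 <= G by exact: g0.
  rewrite ler_norml => /andP[q1 q2].
  by rewrite ![_ * (G * _)]mulrCA; apply/andP; split; apply: ler_wpM2l => //; lra.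
have -> : (\int[(N01 \x N01)%E]_p (g (s p.1 / t, s p.2 / t) *
      (in_box eps M (s p.1 / t, s p.2 / t))%:R * (s p.1 * s p.2 / ln t) `^ b)%:E =
   \int[(N01 \x N01)%E]_p W p)%E by [].
apply/andP; split.
- rewrite -ge0_integralZl// ?lee_fin ?subr_ge0//.
  apply: ge0_le_integral => //.
  + by move=> p _; rewrite mule_ge0// lee_fin subr_ge0.
  + exact: measurable_funeM.
  + by move=> p _; have /andP[] := key p.
- rewrite -ge0_integralZl// ?lee_fin ?addr_ge0 ?(ltW eta0) ?(ltW kap_gt0)//.
  apply: ge0_le_integral => //.
  + by move=> p _; rewrite mule_ge0// lee_fin.
  + exact: measurable_funeM.
  + by move=> p _; have /andP[] := key p.
Unshelve. all: by end_near. Qed.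

End box_limit.

(** * The Beta integral and the limiting masses *)

Section beta_integral.
Context {R : realType}.
Local Notation mu := (@lebesgue_measure R).
Implicit Types (a p u v x : R).

(** Weighted arithmetic-geometric inequality for u and 1, from the tangent of ln at the weighted
    mean m. *)
Lemma powR_bernoulli a u : 0 < a < 1 -> 0 < u -> u `^ a <= a * u + (1 - a).
Proof.
move=> /andP[a0 a1] u0; set m := _ + _.
have m0 : 0 < m by rewrite /m addr_gt0 ?mulr_gt0// subr_gt0.
have hln y : 0 < y -> ln y - ln m <= y / m - 1.
  move=> y0; rewrite -ln_div ?posrE//.
  have := @le_ln1Dx _ (y / m - 1); have -> : 1 + (y / m - 1) = y / m by ring.
  apply; have : 0 < y / m by rewrite divr_gt0.
  by lra.
have h1 := hln _ u0; have h2 := hln _ ltr01; rewrite ln1 in h2.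
have hm : a * (u / m) + (1 - a) * (1 / m) = 1.
  by rewrite !mulrA -mulrDl mulr1 divff// gt_eqF.
rewrite /powR gt_eqF// -[leRHS](lnK m0) ler_expR.
have h3 : a * (ln u - ln m) <= a * (u / m - 1) by apply: ler_wpM2l; [exact: ltW|].
have h4 : (1 - a) * (0 - ln m) <= (1 - a) * (1 / m - 1) by apply: ler_wpM2l => //; lra.
clear -hm h3 h4; lra.
Qed.

Lemma powR_gt0D (u c e : R) : 0 < u -> u `^ (c + e) = u `^ c * u `^ e.
Proof. by move=> u0; rewrite powRD//; apply/implyP => _; rewrite gt_eqF. Qed.

Lemma is_derive_powR (c x : R) : 0 < x -> is_derive x (1 : R) (fun y => y `^ c) (c * x `^ (c - 1)).
Proof. by move=> x0; exact: is_derive1_powR. Qed.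

Lemma is_derive_powR_onem (c x : R) : x < 1 ->
  is_derive x (1 : R) (fun y => (1 - y) `^ c) (- (c * (1 - x) `^ (c - 1))).
Proof.
move=> x1; have h0 : 0 < 1 - x by rewrite subr_gt0.
have hd : is_derive x (1 : R) (fun y : R => 1 - y) (- 1).
  have := is_deriveB (is_derive_cst (1 : R) x (1 : R)) (is_derive_id x (1 : R)).
  by rewrite sub0r.
have := @is_derive1_comp _ (fun y => y `^ c) (fun y => 1 - y) x _ _ (is_derive_powR c h0) hd.
by rewrite mulrN1.
Qed.

Lemma continuous_powR (c x : R) : 0 < x -> {for x, continuous (fun y : R => y `^ c)}.
Proof.
by move=> /(is_derive_powR c)[d _]; exact/differentiable_continuous/derivable1_diffP.
Qed.

Lemma continuous_powR_onem (c x : R) : x < 1 -> {for x, continuous (fun y : R => (1 - y) `^ c)}.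
Proof.
by move=> /(is_derive_powR_onem c)[d _]; exact/differentiable_continuous/derivable1_diffP.
Qed.

Definition beta_half a : \bar R := (\int[mu]_(u in `]0%R, 1%R[) ((u * (1 - u)) `^ (- a))%:E)%E.

(* The primitive u^-a (1 - (1 - u)^(1 - a)) vanishes at 0 and is 1 at 1. *)
Lemma beta_by_parts a : 2^-1 < a < 1 ->
  (\int[mu]_(u in `]0%R, 1%R[) (a * u `^ (- 1 - a) * ((1 - u) `^ (- a) - 1))%:E =
   (2 * a - 1)%:E * beta_half a + 1)%E.
Proof.
move=> /andP[ha a1]; have a0 : 0 < a by lra.
pose H u := u `^ (- a) * (1 - (1 - u) `^ (1 - a)).
pose h u := a * u `^ (- 1 - a) * ((1 - u) `^ (- a) - 1) - (2 * a - 1) * (u * (1 - u)) `^ (- a).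
have powS u c : 0 < u -> u `^ (c + 1) = u `^ c * u.
  by move=> u0; rewrite powR_gt0D// powRr1// ltW.
have dH u : 0 < u < 1 -> is_derive u (1 : R) H (h u).
  move=> /andP[u0 u1]; have v0 : 0 < 1 - u by rewrite subr_gt0.
  have d1 := is_derive_powR (- a) u0.
  have d2 := is_deriveB (is_derive_cst (1 : R) u (1 : R)) (is_derive_powR_onem (1 - a) u1).
  have d := is_deriveM d1 d2.
  apply: (is_derive_eq d); rewrite /GRing.scale /= /h !fctE.
  have -> : 1 - a - 1 = - a by ring.
  have -> : - a - 1 = - 1 - a by ring.
  rewrite powRM ?(ltW u0) ?(ltW v0)//.
  have -> : (1 - u) `^ (1 - a) = (1 - u) `^ (- a) * (1 - u) by rewrite -powS//; congr (_ `^ _); ring.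
  have -> : u `^ (- a) = u `^ (- 1 - a) * u by rewrite -powS//; congr (_ `^ _); ring.
  by rewrite /cst; ring.
(* Needed to integrate the derivative of [H] as a nonnegative function. Factoring out u^(-1 - a) (1
   - u)^-a leaves a - a (1 - u)^a - (2 a - 1) u, which is at least (a - 1)^2 u by
   [powR_bernoulli]. *)
have h0 u : 0 < u < 1 -> 0 <= h u.
  move=> /andP[u0 u1]; have v0 : 0 < 1 - u by rewrite subr_gt0.
  rewrite /h powRM ?(ltW u0) ?(ltW v0)//.
  have -> : u `^ (- a) = u `^ (- 1 - a) * u by rewrite -powS//; congr (_ `^ _); ring.
  have hb := powR_bernoulli (a := a) (u := 1 - u).
  have {}hb : (1 - u) `^ a <= a * (1 - u) + (1 - a) by apply: hb => //; rewrite a0.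
  have e1 : (1 - u) `^ (- a) * (1 - u) `^ a = 1.
    by rewrite -powR_gt0D// addNr powRr0.
  set X := u `^ _; set Y := (1 - u) `^ (- a) in e1 *; set Z := (1 - u) `^ a in hb e1 *.
  have X0 : 0 <= X by exact: powR_ge0.
  have Y0 : 0 <= Y by exact: powR_ge0.
  have -> : a * X * (Y - 1) - (2 * a - 1) * (X * u * Y) =
    X * (Y * (a - a * Z - (2 * a - 1) * u)) + a * X * (Y * Z - 1) by ring.
  rewrite e1 subrr mulr0 addr0 mulr_ge0// mulr_ge0//.
  have : a * Z <= a * (a * (1 - u) + (1 - a)) by apply: ler_wpM2l => //; exact: ltW.
  have : 0 <= (a - 1) ^+ 2 * u by rewrite mulr_ge0 ?sqr_ge0// ltW.
  by clear; lra.
have ch u : 0 < u < 1 -> {for u, continuous h}.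
  move=> /andP[u0 u1]; have uv0 : 0 < u * (1 - u) by rewrite mulr_gt0// subr_gt0.
  apply: cvgB.
    apply: cvgM; first (apply: cvgM; [exact: cvg_cst|exact: continuous_powR]).
    by apply: cvgB; [exact: continuous_powR_onem|exact: cvg_cst].
  apply: cvgM; first exact: cvg_cst.
  apply: (@continuous_comp _ _ _ (fun y : R => y * (1 - y)) (fun y => y `^ (- a))).
    by apply: cvgM; [exact: cvg_id|apply: cvgB; [exact: cvg_cst|exact: cvg_id]].
  exact: continuous_powR.
have a1' : 0 < 1 - a by rewrite subr_gt0.
(* Since 1 - (1 - u)^(1 - a) <= u, the primitive is at most u^(1 - a). *)
have H0 : H u @[u --> 0^'+] --> (0 : R).
  apply: (@squeeze_cvgr _ _ _ _ (fun=> 0) (fun u => u `^ (1 - a))); last 2 first.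
  - exact: cvg_cst.
  - exact: powR_cvg0.
  near=> u.
  have u0 : 0 < u by near: u; exact: nbhs_right_gt.
  have u1 : u < 1 by near: u; exact: nbhs_right_lt.
  have v0 : 0 < 1 - u by rewrite subr_gt0.
  have hle (c : R) : 0 <= c -> (1 - u) `^ c <= 1.
    move=> c0; apply: (@le_trans _ _ (1 `^ c)); last by rewrite powR1.
    by apply: ge0_ler_powR; rewrite ?nnegrE// ?gerBl ltW.
  have h1 := hle _ (ltW a1').
  have h2 : 1 - u <= (1 - u) `^ (1 - a).
    have e : (1 - u) `^ (1 - a) * (1 - u) `^ a = 1 - u.
      by rewrite -powR_gt0D// subrK powRr1// ltW.
    by rewrite -{1}e; apply: ler_piMr; [exact: powR_ge0|apply: hle; exact: ltW].
  rewrite /H; apply/andP; split; first by rewrite mulr_ge0 ?powR_ge0// subr_ge0.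
  have -> : u `^ (1 - a) = u `^ (- a) * u by rewrite -powS//; congr (_ `^ _); ring.
  by apply: ler_wpM2l; [exact: powR_ge0|lra].
have H1 : H u @[u --> 1^'-] --> (1 : R).
  suff : H u @[u --> 1^'-] --> (1 : R) `^ (- a) * (1 - 0).
    by rewrite powR1 subr0 mulr1.
  apply: cvgM.
    by apply: cvg_at_left_filter; exact: continuous_powR.
  apply: cvgB; first exact: cvg_cst.
  apply/cvg_at_leftP => w [w1 wc].
  have /cvg_at_rightP := powR_cvg0 a1'; apply; split.
    by move=> n; rewrite subr_gt0.
  by rewrite -(subrr 1); apply: cvgB => //; exact: cvg_cst.
have hint : (\int[mu]_(u in `]0%R, 1%R[) (h u)%:E = 1)%E.
  rewrite (@ge0_FTC_oo _ h H 0 1 0 1) ?subr0//.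
have mh : measurable_fun (`]0%R, 1%R[%classic : set R) h.
  by apply: open_continuous_measurable_fun => // u /set_mem /=; rewrite in_itv/=; exact: ch.
have mb : measurable_fun (`]0%R, 1%R[%classic : set R) (fun u => (u * (1 - u)) `^ (- a)).
  apply: measurable_funTS; apply: (measurableT_comp (measurable_powR _)).
  by apply: measurable_funM => //; exact: measurable_funB.
rewrite /beta_half -hint -ge0_integralZl//; last 3 first.
- exact/measurable_EFinP.
- by move=> u _; rewrite lee_fin powR_ge0.
- by rewrite lee_fin; lra.
rewrite -ge0_integralD//; last 3 first.
- by move=> u _; rewrite mule_ge0// lee_fin ?powR_ge0//; lra.
- by apply: emeasurable_funM => //; exact/measurable_EFinP.
- exact/measurable_EFinP.
by apply: eq_integral => u _; rewrite -EFinM -EFinD; congr EFin; rewrite /h; ring.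
Unshelve. all: by end_near. Qed.

Definition gamma_integral (x : R) : \bar R :=
  (\int[mu]_(t in `]0%R, +oo[) (t `^ (x - 1) * expR (- t))%:E)%E.

Let gf (x t : R) : R := t `^ (x - 1) * expR (- t) * \1_`]0%R, +oo[ t.

Let mgf x : measurable_fun setT (gf x).
Proof.
apply: measurable_funM; last exact: measurable_indic.
apply: measurable_funM; first exact: measurable_powR.
by apply: measurableT_comp.
Qed.

Let gf_ge0 x t : 0 <= gf x t.
Proof. by rewrite mulr_ge0// mulr_ge0 ?powR_ge0// expR_ge0. Qed.

Let gamma_integralE x : gamma_integral x = (\int[mu]_t (gf x t)%:E)%E.
Proof.
rewrite /gamma_integral integral_mkcond; apply: eq_integral => t _.
rewrite patchE /gf indicE; case: ifPn => _; first by rewrite mulr1.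
by rewrite mulr0.
Qed.

Let bf a (u : R) : R := (u * (1 - u)) `^ (- a) * \1_`]0%R, 1%R[ u.

Let beta_halfE a : beta_half a = (\int[mu]_t (bf a t)%:E)%E.
Proof.
rewrite /beta_half integral_mkcond; apply: eq_integral => t _.
rewrite patchE /bf indicE; case: ifPn => _; first by rewrite mulr1.
by rewrite mulr0.
Qed.

Let mbf a : measurable_fun setT (bf a).
Proof.
apply: measurable_funM; last exact: measurable_indic.
apply: (measurableT_comp (measurable_powR _)).
by apply: measurable_funM => //; exact: measurable_funB.
Qed.

Lemma measurable_section2 {S : realType}
    (h : measurableTypeR S * measurableTypeR S -> \bar S) (z : S) :
  measurable_fun setT h ->
  measurable_fun setT (fun x : measurableTypeR S => h (x, z)).
Proof.
move=> mh; apply: (measurableT_comp mh).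
by apply: measurable_fun_pair; [exact: measurable_id|exact: measurable_cst].
Qed.

Let mgfE x : measurable_fun setT (fun u : measurableTypeR R => (gf x u)%:E).
Proof. by apply/measurable_EFinP; exact: mgf. Qed.

Let mbfE a : measurable_fun setT (fun u : measurableTypeR R => (bf a u)%:E).
Proof. by apply/measurable_EFinP; exact: mbf. Qed.

(* Both sides are the integral of (s (u - s))^-a e^-u over 0 < s < u. *)
Lemma beta_gamma a : (gamma_integral (1 - a) * gamma_integral (1 - a) =
  gamma_integral (2 - 2 * a) * beta_half a)%E.
Proof.
pose p := 1 - a.
pose K (us : measurableTypeR R * measurableTypeR R) : \bar R :=
  (us.2 `^ (p - 1) * (us.1 - us.2) `^ (p - 1) * expR (- us.1) *
   (\1_`]0%R, +oo[ us.2 * \1_`]0%R, +oo[ (us.1 - us.2)))%:E.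
have mK : measurable_fun setT K.
  apply/measurable_EFinP; apply: measurable_funM.
    apply: measurable_funM; last first.
      by apply: measurableT_comp => //; exact: measurableT_comp.
    apply: measurable_funM; apply: (measurableT_comp (measurable_powR _)) => //.
    exact: measurable_funB.
  apply: measurable_funM; first exact: (measurableT_comp (measurable_indic _)).
  by apply: (measurableT_comp (measurable_indic _)) => //; exact: measurable_funB.
have K0 us : (0 <= K us)%E.
  by rewrite lee_fin !mulr_ge0 ?powR_ge0 ?expR_ge0.
have ind0 (x : R) : \1_(`]0%R, +oo[%classic : set R) x = (0 < x)%R%:R :> R.
  by rewrite indicE; congr (nat_of_bool _)%:R; apply/idP/idP => [/set_mem|h]; rewrite ?inE/= in_itv/= andbT.
have ind1 (x : R) : \1_(`]0%R, 1%R[%classic : set R) x = (0 < x < 1)%R%:R :> R.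
  by rewrite indicE; congr (nat_of_bool _)%:R; apply/idP/idP => [/set_mem|h]; rewrite ?inE/= in_itv/=.
transitivity (\int[mu]_u \int[mu]_s K (u, s))%E; last first.
  rewrite gamma_integralE beta_halfE.
  have B0 : (0 <= \int[mu]_v (bf a v)%:E)%E by apply: integral_ge0 => v _; rewrite lee_fin mulr_ge0 ?powR_ge0.
  rewrite -ge0_integralZr//; last by move=> u _; rewrite lee_fin.
  apply: eq_integral => u _.
  have [u0|u0] := leP u 0.
    rewrite /gf ind0 ltNge u0 mulr0 mul0e; apply: integral0_eq => s _.
    rewrite /K /= !ind0 subr_gt0; case: ltP => [s0|]; last by rewrite mul0r mulr0.
    by rewrite (ltNge s) (ltW (le_lt_trans u0 s0)) !mulr0.
  have mKu : measurable_fun setT (fun s : R => K (u, s)) by exact: (measurable_section1 u mK).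
  apply: (etrans (ge0_integral_affine 0 u0 mKu (fun s => K0 (u, s)))).
  rewrite -!ge0_integralZl//; last 4 first.
  - by move=> v _; rewrite lee_fin mulr_ge0 ?powR_ge0.
  - by rewrite lee_fin.
  - apply: (measurableT_comp mKu).
    by apply: measurable_funD => //; apply: measurable_funM.
  - by rewrite lee_fin ltW.
  apply: eq_integral => v _; rewrite addr0 /K /= -!EFinM; congr EFin.
  have -> : u - u * v = u * (1 - v) by ring.
  rewrite /gf /bf !ind0 ind1 u0 !pmulr_rgt0// subr_gt0 mulr1.
  case: (ltP 0 v) => [v0|]; last by rewrite !(mul0r, mulr0).
  case: (ltP v 1) => [v1|]; last by rewrite !(mul0r, mulr0).
  rewrite /= !mulr1.
  have v1' : 0 <= 1 - v by rewrite subr_ge0 ltW.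
  rewrite !powRM ?(ltW u0) ?(ltW v0)//.
  have -> : p - 1 = - a by rewrite /p; ring.
  have -> : 2 - 2 * a - 1 = - a + (- a) + 1 by ring.
  rewrite (powR_gt0D (- a - a))// (powR_gt0D (- a))// powRr1 ?(ltW u0)//.
  by ring.
rewrite (fubini_tonelli (m1 := mu) (m2 := mu) _ mK K0).
rewrite !gamma_integralE.
have G0 : (0 <= \int[mu]_t (gf (1 - a) t)%:E)%E by apply: integral_ge0 => v _; rewrite lee_fin.
rewrite -ge0_integralZr//; last by move=> u _; rewrite lee_fin.
apply: eq_integral => s _.
have mKs : measurable_fun setT (fun u : R => K (u, s)) by exact: (measurable_section2 s mK).
apply/esym; apply: (etrans (ge0_integral_affine s ltr01 mKs (fun u => K0 (u, s)))).
rewrite mul1e -ge0_integralZl//; last 2 first.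
- by move=> v _; rewrite lee_fin.
- by rewrite lee_fin.
apply: eq_integral => t _; rewrite mul1r /K /= addrK -EFinM; congr EFin.
rewrite /gf opprD expRD /p; ring.
Qed.

(** Split at 1: the integrand is below t^(x - 1), of integral 1 / x, on ]0, 1[, and below exp(- t)
    beyond, as x <= 1. *)
Lemma gamma_integral_fin x : 0 < x <= 1 -> (gamma_integral x < +oo)%E.
Proof.
move=> /andP[x0 x1].
pose h1 (t : R) := (t `^ (x - 1) * \1_`]0%R, 1%R[ t)%:E.
pose h2 (t : R) := (expR (- t) * \1_`[1%R, +oo[ t)%:E.
have mh1 : measurable_fun setT h1.
  by apply/measurable_EFinP; apply: measurable_funM; [exact: measurable_powR|exact: measurable_indic].
have mh2 : measurable_fun setT h2.
  by apply/measurable_EFinP; apply: measurable_funM; [exact: measurableT_comp|exact: measurable_indic].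
have h10 t : (0 <= h1 t)%E by rewrite lee_fin mulr_ge0 ?powR_ge0.
have h20 t : (0 <= h2 t)%E by rewrite lee_fin mulr_ge0 ?expR_ge0.
have I1 : (\int[mu]_t h1 t = (x^-1)%:E)%E.
  transitivity (\int[mu]_(t in `]0%R, 1%R[) (t `^ (x - 1))%:E)%E.
    rewrite [RHS]integral_mkcond; apply: eq_integral => t _.
    rewrite patchE /h1 indicE; case: ifPn => _; first by rewrite mulr1.
    by rewrite mulr0.
  have := @ge0_FTC_oo R (fun t : R => t `^ (x - 1)) (fun t : R => x^-1 * t `^ x) 0 1 0 x^-1 ltr01; rewrite subr0; apply.
  - by move=> t; rewrite in_itv/= => /andP[t0 _]; exact: continuous_powR.
  - by move=> t _; exact: powR_ge0.
  - move=> t; rewrite in_itv/= => /andP[t0 _].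
    have := is_deriveZ x^-1 (is_derive_powR x t0).
    move=> hd; apply: (is_derive_eq hd).
    by rewrite /GRing.scale /= mulKf// gt_eqF.
  - by rewrite -[X in _ --> X](mulr0 x^-1); apply: cvgM; [exact: cvg_cst|exact: powR_cvg0].
  - rewrite -[X in _ --> X]mulr1; apply: cvgM; first exact: cvg_cst.
    suff : t `^ x @[t --> 1^'-] --> (1 : R) `^ x by rewrite powR1.
    by apply: cvg_at_left_filter; exact: continuous_powR.
have I2 : (\int[mu]_t h2 t <= 1)%E.
  have <- : (\int[mu]_t (exponential_pdf (1 : R) t)%:E = 1)%E by exact: integral_exponential_pdf.
  apply: ge0_le_integral => //.
  - by apply/measurable_EFinP; exact: measurable_exponential_pdf.
  - move=> t _; rewrite lee_fin indicE; have [t1|t1] := boolP (t \in _); last first.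
      by rewrite mulr0 exponential_pdf_ge0.
    rewrite mulr1 exponential_pdfE ?mul1r ?mulN1r//.
    by move: t1; rewrite inE/= in_itv/= andbT; exact: le_trans.
apply: (@le_lt_trans _ _ ((x^-1)%:E + 1)%E); last by rewrite -EFinD ltry.
rewrite gamma_integralE -I1; apply: (@le_trans _ _ (\int[mu]_t h1 t + \int[mu]_t h2 t)%E); last exact: leeD.
rewrite -ge0_integralD//; apply: ge0_le_integral => //.
- by move=> t _; rewrite lee_fin.
- exact: emeasurable_funD.
- move=> t _; rewrite /h1 /h2 -EFinD lee_fin /gf !indicE.
  have [t0|t0] := leP t 0.
    rewrite (memNset (A := `]0%R, +oo[%classic)) ?mulr0 ?addr_ge0 ?mulr_ge0 ?powR_ge0 ?expR_ge0//=.
    by rewrite in_itv/= andbT ltNge t0.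
  rewrite (mem_set (A := `]0%R, +oo[%classic)) ?mulr1; last by rewrite /= in_itv/= t0.
  have [t1|t1] := ltP t 1.
    rewrite (mem_set (A := `]0%R, 1%R[%classic)) ?mulr1; last by rewrite /= in_itv/= t0.
    rewrite -[leLHS]addr0 lerD ?mulr_ge0 ?expR_ge0//.
    by apply: ler_piMr; [exact: powR_ge0|rewrite -expR0 ler_expR oppr_le0 ltW].
  rewrite (mem_set (A := `[1%R, +oo[%classic)) ?mulr1; last by rewrite /= in_itv/= t1.
  rewrite -[leLHS]add0r lerD ?mulr_ge0 ?powR_ge0//.
  apply: ler_piMl; first exact: expR_ge0.
  rewrite -[leRHS](powRr0 t); apply: ler_powR => //.
  by rewrite subr_le0.
Qed.

Lemma gamma_integral_gt0 x : 0 < x <= 1 -> (0 < gamma_integral x)%E.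
Proof.
move=> /andP[x0 x1].
apply: (@lt_le_trans _ _ (expR (- 1))%:E); first by rewrite lte_fin expR_gt0.
have <- : (\int[mu]_(t in `]0%R, 1%R[) (expR (- 1))%:E = (expR (- 1))%:E)%E.
  have := @integral_cst _ _ _ mu `]0%R, 1%R[%classic (measurable_itv _) (expR (- 1))%:E.
  rewrite /cst.
  have hm : mu `]0%R, 1%R[%classic = 1%E.
    by rewrite lebesgue_measure_itv/= lte_fin ltr01 oppr0 adde0.
  by move=> e; rewrite -[RHS]mule1 -hm; exact: e.
rewrite gamma_integralE integral_mkcond.
apply: ge0_le_integral => //.
- by move=> t _; rewrite patchE; case: ifPn => // _; rewrite lee_fin expR_ge0.
- by apply/(measurable_restrictT _ _).1 => //; exact: measurable_cst.
- move=> t _; rewrite patchE; case: ifPn => [|_]; last by rewrite lee_fin.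
  rewrite inE/= in_itv/= => /andP[t0 t1].
  rewrite /gf indicE mem_set/=; last by rewrite in_itv/= t0.
  rewrite mulr1 lee_fin -[leLHS]mul1r; apply: ler_pM => //; rewrite ?expR_ge0//; last first.
    by rewrite ler_expR lerN2 ltW.
  rewrite /powR gt_eqF// -[leLHS]expR0 ler_expR mulr_le0// ?subr_le0//.
  by rewrite -[leRHS]ln1 ler_ln ?posrE// ltW.
Qed.

(** Here 1 - 2 a lies in ]-1, 0[, so Gamma(1 - 2 a) = Gamma(2 - 2 a) / (1 - 2 a), and [beta_gamma]
    turns C(a) into (2 a - 1) B(1 - a, 1 - a). The Beta integral is finite because its product with
    a positive number is finite. *)
Lemma beta_half_C a : 2^-1 < a < 1 ->
  beta_half a \is a fin_num /\ C_ a = (2 * a - 1) * fine (beta_half a).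
Proof.
move=> /andP[ha a1].
have h1 : 0 < 1 - a <= 1 by lra.
have h2 : 0 < 2 - 2 * a <= 1 by lra.
have G1 := gamma_integral_fin h1; have G1p := gamma_integral_gt0 h1.
have G2 := gamma_integral_fin h2; have G2p := gamma_integral_gt0 h2.
have := beta_gamma a.
have g1 : gamma_integral (1 - a) \is a fin_num by rewrite (ge0_fin_numE (ltW _)).
have g2 : gamma_integral (2 - 2 * a) \is a fin_num by rewrite (ge0_fin_numE (ltW _)).
have E1 : Gamma (1 - a) = fine (gamma_integral (1 - a)) by rewrite /Gamma; have /andP[-> _] := h1.
have E2 : Gamma (1 - 2 * a) = fine (gamma_integral (2 - 2 * a)) / (1 - 2 * a).
  have n0 : (0 < 1 - 2 * a) = false by apply/negbTE; rewrite -leNgt; lra.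
  (* 0 < 2 a - 1 < 1, so a single translate makes the argument of [Gamma] positive. *)
  have tr : Num.truncn (- (1 - 2 * a)) = 0%N.
    by apply/eqP; rewrite -leqn0 -ltnS truncn_lt_nat; lra.
  rewrite /Gamma n0 tr big_ord1 addr0.
  have -> : 1 - 2 * a + 1%:R = 2 - 2 * a by ring.
  by [].
have B0 : (0 <= beta_half a)%E by apply: integral_ge0 => u _; rewrite lee_fin powR_ge0.
rewrite /C_ E1 E2 -(fineK g1) -(fineK g2).
have : fine (gamma_integral (2 - 2 * a)) != 0.
  by rewrite gt_eqF// fine_gt0// G2p.
have : 0 < fine (gamma_integral (2 - 2 * a)) by rewrite fine_gt0// G2p.
move: (fine (gamma_integral _)) (fine (gamma_integral _)) => X Y Y0 Yn.
case: (beta_half a) B0 => [B|//|//] B0; last first.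
  by rewrite -EFinM mulry gtr0_sg// mul1e.
rewrite -!EFinM => -[] /= XY; split => //.
rewrite expr2 XY; field; rewrite Yn/= andbT; lra.
Qed.

End beta_integral.

(** * Masses of the two parts of the pair increment over the whole quadrant *)

Section pair_masses.
Context {R : realType}.
Local Notation mu := (@lebesgue_measure R).
Local Notation RR := (measurableTypeR R * measurableTypeR R)%type.
Implicit Types (a b u v : R) (g : R * R -> R).

Lemma cvg_ge0_integral_increasing d (T : measurableType d) (nu : {measure set T -> \bar R})
    (f : (T -> \bar R)^nat) (h : T -> \bar R) :
  (forall n, measurable_fun setT (f n)) -> (forall n x, 0 <= f n x)%E ->
  (forall x, nondecreasing_seq (f^~ x)) -> (forall x, f^~ x @ \oo --> h x) ->
  (\int[nu]_x f n x @[n --> \oo] --> \int[nu]_x h x)%E.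
Proof.
move=> mf f0 ndf fh.
have -> : (\int[nu]_x h x = \int[nu]_x (fun x => limn (f^~ x)) x)%E.
  by apply: eq_integral => x _; apply/esym/cvg_lim => //; exact: fh.
by apply: cvg_monotone_convergence.
Qed.

Definition full_mass b g : \bar R :=
  (\int[mu]_u \int[mu]_v
     (g (u, v) * ((0 < u)%R && (0 < v)%R)%:R * (u * v) `^ (b - 2))%:E)%E.

Let measurable_pos : measurable_fun setT (fun p : RR => ((0 < p.1)%R && (0 < p.2)%R)%:R : R).
Proof.
have -> : (fun p : RR => ((0 < p.1)%R && (0 < p.2)%R)%:R : R) =
    \1_(`]0%R, +oo[ `*` `]0%R, +oo[) :> (RR -> R).
  apply/funext => p; rewrite indicE; congr (nat_of_bool _)%:R.
  apply/idP/idP => [/andP[h1 h2]|/set_mem [/=]].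
    by apply/mem_set; split; rewrite /= in_itv/= andbT.
  by rewrite !in_itv/= !andbT => -> ->.
by apply: measurable_indic; exact: measurableX.
Qed.

Let measurable_mass (c : RR -> R) b g : measurable_fun setT (g : RR -> R) ->
  measurable_fun setT c ->
  measurable_fun setT (fun p : RR => (g p * c p * (p.1 * p.2) `^ (b - 2))%:E).
Proof.
move=> mg mc; apply/measurable_EFinP; apply: measurable_funM; first exact: measurable_funM.
by apply: (measurableT_comp (measurable_powR _)); exact: measurable_funM.
Qed.

Lemma box_mass_cvg b g : measurable_fun setT (g : RR -> R) -> (forall p, 0 <= g p) ->
  box_mass b g n.+1%:R^-1 n.+1%:R @[n --> \oo] --> full_mass b g.
Proof.
move=> mg g0.
pose f n (p : RR) := (g p * (in_box n.+1%:R^-1 n.+1%:R p)%:R * (p.1 * p.2) `^ (b - 2))%:E.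
pose h (p : RR) := (g p * ((0 < p.1)%R && (0 < p.2)%R)%:R * (p.1 * p.2) `^ (b - 2))%:E.
have mf n : measurable_fun setT (f n) by apply: measurable_mass => //; exact: measurable_in_box.
have f0 n p : (0 <= f n p)%E by rewrite lee_fin mulr_ge0 ?powR_ge0// mulr_ge0.
have ndbox (m n : nat) (p : R * R) : (m <= n)%N -> in_box m.+1%:R^-1 m.+1%:R p -> in_box n.+1%:R^-1 n.+1%:R p.
  move=> mn; have h1 : (n.+1%:R : R)^-1 <= m.+1%:R^-1 by rewrite lef_pV2 ?posrE// ler_nat.
  have h2 : (m.+1%:R : R) <= n.+1%:R by rewrite ler_nat.
  rewrite /in_box !in_itv/= => /andP[/andP[b1 b2] /andP[b3 b4]].
  by rewrite !(le_trans h1)//= !(le_trans _ h2).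
have ndf p : nondecreasing_seq (f^~ p).
  move=> m n mn; rewrite lee_fin ler_wpM2r ?powR_ge0// ler_wpM2l// ler_nat.
  by case: (boolP (in_box m.+1%:R^-1 _ _)) => // /(ndbox _ _ _ mn) ->.
have fh p : f^~ p @ \oo --> h p.
  have [/andP[p1 p2]|pn] := boolP ((0 < p.1)%R && (0 < p.2)%R); last first.
    rewrite (_ : f^~ p = fun=> h p); first exact: cvg_cst.
    apply/funext => n; rewrite /f /h (negbTE pn).
    suff -> : in_box n.+1%:R^-1 n.+1%:R p = false by [].
    apply: contraNF pn; rewrite /in_box !in_itv/= => /andP[/andP[b1 _] /andP[b3 _]].
    have i0 : 0 < (n.+1%:R : R)^-1 by rewrite invr_gt0.
    by rewrite !(lt_le_trans i0).
  have hN (x : R) : \forall n \near \oo, x <= n.+1%:R.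
    by near=> n; apply: (@le_trans _ _ n%:R); [near: n; exact: nbhs_infty_ger|rewrite ler_nat].
  apply: cvg_near_cst; near=> n.
  rewrite /f /h p1 p2; suff -> : in_box n.+1%:R^-1 n.+1%:R p by [].
  rewrite /in_box !in_itv/=; apply/andP; split; apply/andP; split.
  - by rewrite invf_ple ?posrE//; near: n; exact: hN.
  - by near: n; exact: hN.
  - by rewrite invf_ple ?posrE//; near: n; exact: hN.
  - by near: n; exact: hN.
apply: (@cvg_ge0_integral_increasing _ _ mu (fun n u => \int[mu]_v f n (u, v))%E
  (fun u => \int[mu]_v h (u, v))%E).
- move=> n; exact: (measurable_fun_fubini_tonelli_F (m2 := mu) _ (mf n) (f0 n)).
- by move=> n u; apply: integral_ge0 => v _; exact: f0.
- move=> u m n mn; apply: ge0_le_integral => //.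
  + exact: measurable_section1.
  + exact: measurable_section1.
  + by move=> v _; exact: ndf.
- move=> u; apply: (@cvg_ge0_integral_increasing _ _ mu (fun n v => f n (u, v)) (fun v => h (u, v))) => //.
  + by move=> n; exact: measurable_section1.
Unshelve. all: by end_near. Qed.

Lemma ge0_integralZl_real (c : R) (f : R -> \bar R) : 0 <= c ->
  measurable_fun setT f -> (forall x, 0 <= f x)%E ->
  (c%:E * \int[mu]_x f x = \int[mu]_x (c%:E * f x))%E.
Proof. by move=> c0 mf f0; rewrite ge0_integralZl. Qed.

(** Substituting u -> w1 u and v -> w2 v produces w1 w2 from the measure and (w1 w2)^(b - 2) from
    the power. This reduces every pair to unit weights and is the origin of (w_i w_j)^a. *)
Lemma full_mass_scale b g (w1 w2 : R) : measurable_fun setT (g : RR -> R) ->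
  (forall p, 0 <= g p) -> 0 < w1 -> 0 < w2 ->
  full_mass b (fun p => g (w1 * p.1, w2 * p.2)) = (((w1 * w2) `^ (1 - b))%:E * full_mass b g)%E.
Proof.
move=> mg g0 w10 w20.
pose h (p : RR) := (g p * ((0 < p.1)%R && (0 < p.2)%R)%:R * (p.1 * p.2) `^ (b - 2))%:E.
have mh : measurable_fun setT h by exact: measurable_mass.
have h0 p : (0 <= h p)%E by rewrite lee_fin mulr_ge0 ?powR_ge0// mulr_ge0.
pose F (u : R) : \bar R := (\int[mu]_v h (u, v))%E.
have mF : measurable_fun setT F.
  exact: (measurable_fun_fubini_tonelli_F (m2 := mu) _ mh h0).
have F0 u : (0 <= F u)%E by apply: integral_ge0 => v _; exact: h0.
have mhs u : measurable_fun setT (fun v : R => h (u, v)) by exact: (measurable_section1 u mh).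
have mlin (w : R) (f : R -> \bar R) : measurable_fun setT f -> measurable_fun setT (fun v => f (w * v + 0)).
  by move=> mf; apply: (measurableT_comp mf); apply: measurable_funD => //; exact: measurable_funM.
pose F1 (u : R) : \bar R := (w1%:E * F (w1 * u + 0)%R)%E.
have mF1 : measurable_fun setT F1 by exact (measurable_funeM _ (mlin w1 F mF)).
have F10 u : (0 <= F1 u)%E by rewrite mule_ge0// lee_fin ltW.
have -> : full_mass b g = (\int[mu]_u F1 u)%E.
  apply: (etrans (ge0_integral_affine 0 w10 mF F0)).
  exact (ge0_integralZl_real (ltW w10) (mlin w1 F mF) (fun u => F0 (w1 * u + 0))).
apply: (etrans _ (esym (ge0_integralZl_real (powR_ge0 _ _) mF1 F10))); rewrite /F1.
apply: eq_integral => u _; rewrite addr0.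
have -> : F (w1 * u) = (\int[mu]_v (w2%:E * h ((w1 * u)%R, (w2 * v + 0)%R)))%E.
  apply: (etrans (ge0_integral_affine 0 w20 (mhs _) (fun v => h0 (w1 * u, v)))).
  by rewrite -ge0_integralZl//; [exact: (mlin _ _ (mhs _))|rewrite lee_fin ltW].
rewrite muleA -ge0_integralZl//; last 3 first.
- by apply: emeasurable_funM => //; exact: (mlin _ _ (mhs _)).
- by move=> v _; rewrite mule_ge0// lee_fin ltW.
- by rewrite lee_fin mulr_ge0 ?powR_ge0// ltW.
apply: eq_integral => v _; rewrite /h /= addr0 -!EFinM !pmulr_rgt0//; congr EFin.
have [/andP[u0 v0]|_] := boolP (_ && _); last by rewrite !(mulr0, mul0r).
rewrite !mulr1.
have -> : w1 * u * (w2 * v) = (w1 * w2) * (u * v) by ring.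
rewrite (powRM _ (x := w1 * w2)) ?mulr_ge0// ?ltW//.
have w0 : 0 < w1 * w2 by rewrite mulr_gt0.
have e : (w1 * w2) `^ (1 - b) * (w1 * w2) * (w1 * w2) `^ (b - 2) = 1.
  rewrite -{2}[w1 * w2]powRr1 ?(ltW w0)// -!powR_gt0D//.
  by rewrite (_ : 1 - b + 1 + (b - 2) = 0) ?powRr0//; ring.
transitivity ((w1 * w2) `^ (1 - b) * (w1 * w2) * (w1 * w2) `^ (b - 2) * (g (w1 * u, w2 * v) * (u * v) `^ (b - 2))); last by ring.
by rewrite e mul1r.
Qed.


Lemma integral_powR_ray a c : 0 < a -> 0 < c ->
  (\int[mu]_(v in `]c, +oo[) (v `^ (- 1 - a))%:E = (a^-1 * c `^ (- a))%:E)%E.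
Proof.
move=> a0 c0; rewrite integral_itv_obnd_cbnd; last first.
  by apply: measurable_funTS; apply/measurable_EFinP; exact: measurable_powR.
rewrite (@ge0_continuous_FTC2y _ (fun v => v `^ (- 1 - a)) (fun v => - (a^-1 * v `^ (- a))) c 0).
- by rewrite -EFinB sub0r opprK.
- by move=> u _; exact: powR_ge0.
- apply: continuous_in_subspaceT => u /set_mem /=; rewrite in_itv/= andbT => cu.
  by apply: continuous_powR; exact: lt_le_trans cu.
- rewrite -[X in _ --> X]oppr0; apply: cvgN; rewrite -[X in _ --> X](mulr0 a^-1).
  apply: cvgM; first exact: cvg_cst.
  apply/cvgrPdist_lt => e e0; near=> x.
  have x0 : 0 < x by near: x; exact: nbhs_pinfty_gt.
  rewrite sub0r normrN ger0_norm ?powR_ge0// powRN -(invrK e) ltf_pV2 ?posrE ?powR_gt0 ?invr_gt0//.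
  have ei : 0 < e^-1 by rewrite invr_gt0.
  have -> : e^-1 = ((e^-1) `^ a^-1) `^ a by rewrite -powRrM mulVf ?gt_eqF// powRr1// ltW.
  apply: gt0_ltr_powR; rewrite ?nnegrE ?powR_ge0 ?(ltW x0)//.
- move=> u cu; have u0 : 0 < u by exact: lt_trans cu.
  by have [] := is_deriveN (is_deriveZ a^-1 (is_derive_powR (- a) u0)).
- apply: cvg_at_right_filter; apply: cvgN; apply: cvgM; first exact: cvg_cst.
  exact: continuous_powR.
- move=> u; rewrite in_itv/= andbT => cu; have u0 : 0 < u by exact: lt_trans cu.
  rewrite derive1E; have [_ ->] := is_deriveN (is_deriveZ a^-1 (is_derive_powR (- a) u0)).
  have -> : - a - 1 = - 1 - a by ring.
  by rewrite /GRing.scale /= mulNr mulrN opprK mulKf// gt_eqF.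
Unshelve. all: by end_near. Qed.

Lemma integral_powR_itv a c : 0 < a -> 0 < c < 1 ->
  (\int[mu]_(v in `]c, 1%R]) (v `^ (- 1 - a))%:E = (a^-1 * (c `^ (- a) - 1))%:E)%E.
Proof.
move=> a0 /andP[c0 c1].
rewrite -integral_itv_bndo_bndc; last first.
  by apply: measurable_funTS; apply/measurable_EFinP; exact: measurable_powR.
have -> : a^-1 * (c `^ (- a) - 1) = - (a^-1 * 1 `^ (- a)) - - (a^-1 * c `^ (- a)).
  by rewrite powR1; ring.
apply: (@ge0_FTC_oo R (fun v : R => v `^ (- 1 - a)) (fun v : R => - (a^-1 * v `^ (- a)))) => //.
- by move=> u; rewrite in_itv/= => /andP[cu _]; apply: continuous_powR; exact: lt_trans cu.
- by move=> u _; exact: powR_ge0.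
- move=> u; rewrite in_itv/= => /andP[cu _]; have u0 : 0 < u by exact: lt_trans cu.
  apply: (is_derive_eq (is_deriveN (is_deriveZ a^-1 (is_derive_powR (- a) u0)))).
  have -> : - a - 1 = - 1 - a by ring.
  by rewrite /GRing.scale /= mulNr mulrN opprK mulKf// gt_eqF.
- apply: cvg_at_right_filter; apply: cvgN; apply: cvgM; first exact: cvg_cst.
  exact: continuous_powR.
- apply: cvg_at_left_filter; apply: cvgN; apply: cvgM; first exact: cvg_cst.
  exact: continuous_powR.
Qed.

(** On a region described by its sections over u, the power of u v factors and the inner integral
    involves v only. *)
Lemma full_mass_slices b g (A : set R) (B : R -> set R) :
  measurable (A : set (measurableTypeR R)) ->
  (forall u, A u -> measurable (B u : set (measurableTypeR R))) ->
  (forall u v, A u -> B u v -> 0 < u /\ 0 < v) ->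
  (forall u v, 0 < u -> 0 < v -> g (u, v) = ((u \in A) && (v \in B u))%:R) ->
  full_mass b g =
    (\int[mu]_(u in A) ((u `^ (b - 2))%:E * \int[mu]_(v in B u) (v `^ (b - 2))%:E))%E.
Proof.
move=> mA mB AB gE; rewrite /full_mass [RHS]integral_mkcond.
apply: eq_integral => u _; rewrite patchE; case: ifPn => [uA|uA]; last first.
  apply: integral0_eq => v _; case: (boolP (_ && _)) => [/andP[u0 v0]|_]; last by rewrite mulr0 mul0r.
  by rewrite gE// (negbTE uA) !mul0r.
have Au := set_mem uA; have mBu := mB _ Au.
pose h : R -> \bar R := (fun v => (v `^ (b - 2))%:E) \_ (B u).
have mh : measurable_fun setT h.
  apply: ((measurable_restrictT _ mBu).1 _); apply: measurable_funTS.
  by apply/measurable_EFinP; exact: measurable_powR.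
have h0 v : (0 <= h v)%E by rewrite /h patchE; case: ifPn => // _; rewrite lee_fin powR_ge0.
rewrite [in RHS]integral_mkcond.
apply: (etrans _ (esym (ge0_integralZl_real (powR_ge0 _ _) mh h0))).
apply: eq_integral => v _; rewrite /h patchE; case: ifPn => [vB|vB].
  have [u0 v0] := AB _ _ Au (set_mem vB).
  by rewrite gE// uA vB u0 v0 /= mulr1 mul1r powRM ?ltW// EFinM.
case: (boolP (_ && _)) => [/andP[u0 v0]|_]; last by rewrite mulr0 mul0r mule0.
by rewrite gE// (negbTE vB) andbF !mul0r mule0.
Qed.

(* The pair increment with unit weights is excess_pos - excess_neg on positive
   arguments: it is 0 when exactly one argument exceeds 1 and -1 when both do. *)
Definition excess_pos (p : R * R) : R := [&& 1 < p.1 + p.2, p.1 <= 1 & p.2 <= 1]%R%:R.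
Definition excess_neg (p : R * R) : R := ((1 < p.1)%R && (1 < p.2)%R)%:R.

Let in_ray (c u : R) : (u \in `]c, +oo[%classic) = (c < u).
Proof. by apply/idP/idP => [/set_mem|h]; rewrite ?inE/= in_itv/= andbT. Qed.

Let in_oc (c d u : R) : (u \in `]c, d]%classic) = (c < u <= d).
Proof. by apply/idP/idP => [/set_mem|h]; rewrite ?inE/= in_itv/=. Qed.

Lemma full_mass_neg b : 0 < b < 1 -> full_mass b excess_neg = ((1 - b) ^- 2)%:E.
Proof.
move=> /andP[b0 b1]; have a0 : 0 < 1 - b by rewrite subr_gt0.
have b2 : b - 2 = - 1 - (1 - b) by ring.
have I1 := integral_powR_ray a0 ltr01; rewrite powR1 mulr1 -b2 in I1.
rewrite (@full_mass_slices b _ `]1, +oo[%classic (fun=> `]1, +oo[%classic)); last 4 first.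
- exact: measurable_itv.
- by move=> u _; exact: measurable_itv.
- move=> u v /=; rewrite !in_itv/= !andbT => u1 v1.
  by split; apply: lt_trans ltr01 _.
- by move=> u v _ _; rewrite !in_ray.
rewrite I1 ge0_integralZr//; last 3 first.
- by apply: measurable_funTS; apply/measurable_EFinP; exact: measurable_powR.
- by move=> u _; rewrite lee_fin powR_ge0.
- by rewrite lee_fin invr_ge0 ltW.
by rewrite I1 -EFinM expr2 invfM.
Qed.

(** The section over u is ]1 - u, 1], of mass ((1 - u)^-a - 1) / a; integrating it against u^(-1 -
    a) is, up to a^-2, the left-hand side of [beta_by_parts]. *)
Lemma full_mass_pos b : 0 < b < 2^-1 ->
  full_mass b excess_pos = ((C_ (1 - b) + 1) / (1 - b) ^+ 2)%:E.
Proof.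
move=> /andP[b0 b1]; have a0 : 0 < 1 - b by lra.
have b2 : b - 2 = - 1 - (1 - b) by ring.
have ha : 2^-1 < 1 - b < 1 by lra.
have [Bfin ->] := beta_half_C ha; have := beta_by_parts ha.
set a := 1 - b in a0 b2 ha Bfin * => Ha.
rewrite (@full_mass_slices b _ `]0, 1]%classic (fun u => `]1 - u, 1]%classic)); last 4 first.
- exact: measurable_itv.
- by move=> u _; exact: measurable_itv.
- move=> u v /=; rewrite !in_itv/= => /andP[u0 u1] /andP[v0 _].
  by split => //; apply: le_lt_trans v0; rewrite subr_ge0.
- move=> u v u0 v0; rewrite !in_oc u0 /= ltrBlDl; congr (_%:R).
  by rewrite andbCA andbC -andbA andbC.
pose f (u : R) : R := u `^ (- 1 - a) * (a^-1 * ((1 - u) `^ (- a) - 1)).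
have mf : measurable_fun setT f.
  apply: measurable_funM; first exact: measurable_powR.
  apply: measurable_funM => //; apply: measurable_funB => //.
  by apply: (measurableT_comp (measurable_powR _)); exact: measurable_funB.
have inn : {in (`]0%R, 1%R[%classic : set (measurableTypeR R)), (fun u => (f u)%:E) =1
   (fun u : R => (u `^ (b - 2))%:E * \int[mu]_(v in `](1 - u)%R, 1%R]) (v `^ (b - 2))%:E)%E}.
  move=> u /set_mem /=; rewrite in_itv/= => /andP[u0 u1].
  have h : 0 < 1 - u < 1 by clear -u0 u1; lra.
  by rewrite b2 (integral_powR_itv a0 h) -EFinM.
(* The point u = 1 is discarded: its section ]0, 1] is outside the range of [integral_powR_itv]. *)
rewrite -integral_itv_bndo_bndc; last first.
  apply: eq_measurable_fun inn _; apply: measurable_funTS.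
  by apply/measurable_EFinP; exact: mf.
transitivity (\int[mu]_(u in `]0%R, 1%R[) ((a ^- 2)%:E * (a * u `^ (- 1 - a) * ((1 - u) `^ (- a) - 1))%:E))%E.
  apply: eq_integral => u u01; rewrite -inn// -EFinM; congr EFin.
  by rewrite /f; field; rewrite gt_eqF.
rewrite ge0_integralZl//; last 3 first.
- apply: measurable_funTS; apply/measurable_EFinP; apply: measurable_funM.
    by apply: measurable_funM => //; exact: measurable_powR.
  by apply: measurable_funB => //; apply: (measurableT_comp (measurable_powR _)); exact: measurable_funB.
- move=> u /=; rewrite in_itv/= => /andP[u0 u1].
  rewrite lee_fin !mulr_ge0 ?powR_ge0 ?(ltW a0)// subr_ge0 powRN invf_ge1 ?powR_gt0 ?subr_gt0//.
  rewrite -[leRHS](congr1 (fun f => f a) (@powR1 R)).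
  by apply: ge0_ler_powR; rewrite ?nnegrE ?(ltW a0)// ?subr_ge0 ?gerBl ltW.
- by rewrite lee_fin invr_ge0 exprn_ge0// ltW.
rewrite Ha; case: (beta_half a) Bfin => // B _ /=.
by rewrite -[LHS]/((a ^- 2 * ((2 * a - 1) * B + 1))%:E) mulrC.
Qed.

End pair_masses.

(** * The pair limit *)

Lemma dist_halves (R : realFieldType) (e q x y z : R) : x - z <= q -> q <= x + z ->
  `|y - x| < e / 2 -> z < e / 2 -> `|q - y| < e.
Proof.
rewrite !ltr_norml => h1 h2 /andP[h3 h4] h5.
by apply/andP; split; lra.
Qed.

Lemma dist_thirds (R : realFieldType) (e x1 x2 x3 x4 x5 : R) : `|x1 - x4| < e / 3 ->
  `|x2 - x5| < e / 3 -> `|x3| < e / 3 -> `|x4 - x5 - (x1 - x2 + x3)| < e.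
Proof.
rewrite !ltr_norml => /andP[h1 h2] /andP[h3 h4] /andP[h5 h6].
by apply/andP; split; lra.
Qed.

Lemma bounded_integrable d (T : measurableType d) (R : realType) (P : probability T R)
    (f : T -> R) (M : R) : measurable_fun setT f -> (forall x, `|f x| <= M) ->
  P.-integrable setT (EFin \o f).
Proof.
move=> mf fM; apply: measurable_bounded_integrable => //.
  exact: (le_lt_trans (probability_le1 P measurableT) (ltry 1)).
by exists M; split; [exact: num_real|move=> N MN x _; exact: le_trans (fM x) (ltW MN)].
Qed.

Lemma limf_esup_lt (T : choiceType) (X : filteredType T) (R : realType)
    (f : X -> \bar R) (F : set (set X)) (c : \bar R) : Filter F ->
  (limf_esup f F < c)%E -> F [set x | (f x < c)%E].
Proof.
move=> FF /ereal_inf_lt[_ [V FV <-] hc]; apply: (filterS _ FV) => x Vx.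
by rewrite /=; apply: le_lt_trans hc; apply: ereal_sup_ubound; exists x.
Qed.

Section pair_limit.
Context d (T : measurableType d) (R : realType) (P : probability T R).
Local Notation mu := (@lebesgue_measure R).
Local Notation N01 := (@normal_prob R 0 1).
Local Notation RR := (measurableTypeR R * measurableTypeR R)%type.
Variables (s : R -> R) (k : R -> R -> R) (b kap : R) (X1 X2 : T -> R).
Hypothesis hs : is_score s.
Hypothesis s_gt0 : forall x, 0 < s x.
Hypothesis k_ge0 : forall x z, 0 <= k x z.
Hypothesis mk : measurable_fun setT (fun p : RR => k p.1 p.2).
Hypothesis hk : kernel_asymp s k b kap.
Hypothesis hP : forall h : RR -> \bar R, measurable_fun setT h ->
  (forall p, 0 <= h p)%E ->
  (\int[P]_x h (s (X1 x), s (X2 x)) =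
   \int[(N01 \x N01)%E]_p (h (s p.1, s p.2) * (k p.1 p.2)%:E))%E.
Hypothesis kap_gt0 : 0 < kap.
Hypotheses (mX1 : measurable_fun setT X1) (mX2 : measurable_fun setT X2).

Let S t x : R * R := (s (X1 x) / t, s (X2 x) / t).

Let mS (t : R) : measurable_fun setT (S t : T -> RR).
Proof.
have [ms _] := hs.
by apply: measurable_fun_pair; apply: measurable_funM => //; exact: measurableT_comp.
Qed.

Lemma power_rate_gt0 t : 1 < t -> 0 < power_rate b t.
Proof. by move=> t1; rewrite mulr_gt0// powR_gt0 ?ln_gt0// (lt_trans ltr01). Qed.

(** The box is chosen first so that its mass is near F, then eta in terms of that mass, and only
    then t: the threshold of [box_limit] depends on the box. *)
Lemma box_mean_near (g : R * R -> R) F e : measurable_fun setT (g : RR -> R) ->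
  (forall p, 0 <= g p) -> full_mass b g = F%:E -> 0 < e ->
  \forall n \near \oo, \forall t \near +oo,
  `|(\int[P]_x (g (S t x) * (in_box n.+1%:R^-1 n.+1%:R (S t x))%:R)) / power_rate b t
     - kap * F| < e.
Proof.
move=> mg g0 gF e0; have := @box_mass_cvg R b g mg g0; rewrite gF => /fine_cvgP[fin cv].
have /cvgrPdist_lt /(_ (e / 2 / kap)) : (fine \o (fun n => box_mass b g n.+1%:R^-1 n.+1%:R)) n @[n --> \oo] --> F by exact: cv.
have e2 : 0 < e / 2 by rewrite divr_gt0.
rewrite divr_gt0// => /(_ isT) cv2; near=> n.
have /fineK Em : box_mass b g n.+1%:R^-1 n.+1%:R \is a fin_num by near: n; exact: fin.
have : `|F - fine (box_mass b g n.+1%:R^-1 n.+1%:R)| < e / 2 / kap by near: n; exact: cv2.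
rewrite -Em /= ; set m := fine _ in Em * => hm.
have m0 : 0 <= m.
  apply: fine_ge0; apply: integral_ge0 => u _; apply: integral_ge0 => v _.
  by rewrite lee_fin mulr_ge0 ?powR_ge0// mulr_ge0.
(* At most [kap], as [box_limit] asks, and small enough that eta m < e / 2; m + 1 guards against m =
   0. *)
pose eta := Num.min kap (e / 2 / (m + 1)).
have m1 : 0 < m + 1 by rewrite ltr_wpDl.
have eta0 : 0 < eta by rewrite lt_min kap_gt0 divr_gt0.
have etam : eta * m < e / 2.
  have : eta * (m + 1) <= e / 2 by rewrite -ler_pdivlMr// ge_min lexx orbT.
  by lra.
have etak : 0 < eta <= kap by rewrite eta0 ge_min lexx.
have n0 : 0 < n.+1%:R^-1 :> R by rewrite invr_gt0.
have hB := box_limit hs k_ge0 mk hk hP kap_gt0 n.+1%:R mg g0 n0 etak.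
near=> t.
have t1 : 1 < t by near: t; exact: nbhs_pinfty_gt.
have r0 := power_rate_gt0 t1.
have : ((kap - eta)%:E * ((power_rate b t)%:E * box_mass b g n.+1%:R^-1 n.+1%:R) <=
  \int[P]_x (g (S t x) * (in_box n.+1%:R^-1 n.+1%:R (S t x))%:R)%:E <=
  (kap + eta)%:E * ((power_rate b t)%:E * box_mass b g n.+1%:R^-1 n.+1%:R))%E.
  by near: t; exact: hB.
rewrite -Em -!EFinM /Rintegral.
case: (\int[P]_x _)%E => [I||]; rewrite ?lee_fin ?leye_eq ?leeNy_eq ?andbF//=.
move=> /andP[h1 h2].
have {}h1 : (kap - eta) * m <= I / power_rate b t by rewrite ler_pdivlMr// -mulrA (mulrC m).
have {}h2 : I / power_rate b t <= (kap + eta) * m by rewrite ler_pdivrMr// -mulrA (mulrC m).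
have : kap * `|F - m| < e / 2 by rewrite -ltr_pdivlMl// mulrC.
rewrite -{1}(gtr0_norm kap_gt0) -normrM => h3.
move: h1 h2 h3 etam; rewrite mulrBl mulrDl mulrBr.
exact: dist_halves.
Unshelve. all: by end_near. Qed.

Definition pair_excess (w1 w2 : R) (p : R * R) : R :=
  (1 < w1 * p.1 + w2 * p.2)%R%:R - (1 < w1 * p.1)%R%:R - (1 < w2 * p.2)%R%:R.

Lemma pair_excessE (w1 w2 : R) p : 0 <= w1 * p.1 -> 0 <= w2 * p.2 ->
  pair_excess w1 w2 p = excess_pos (w1 * p.1, w2 * p.2) - excess_neg (w1 * p.1, w2 * p.2).
Proof.
rewrite /pair_excess /excess_pos /excess_neg /=; move: (w1 * _) (w2 * _) => u v u0 v0.
case: (ltP 1 u) => u1; case: (ltP 1 v) => v1; rewrite ?andbF ?andbT /=.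
- by rewrite (lt_le_trans u1) ?lerDl// subrr sub0r.
- by rewrite (lt_le_trans u1) ?lerDl// subrr !subr0.
- by rewrite (lt_le_trans v1) ?lerDr// !subr0 subrr.
- by rewrite !subr0.
Qed.

Lemma measurable_excess_pos : measurable_fun setT (excess_pos : RR -> R).
Proof.
rewrite (_ : excess_pos = \1_[set p : RR | [&& 1 < p.1 + p.2, p.1 <= 1 & p.2 <= 1]]); last first.
  apply/funext => p; rewrite indicE; congr (nat_of_bool _)%:R.
  by apply/idP/idP => [h|/set_mem]; [apply/mem_set|].
apply: measurable_indic.
have m1 : measurable_fun setT (fun p : RR => p.1) by exact: measurable_fst.
have m2 : measurable_fun setT (fun p : RR => p.2) by exact: measurable_snd.
have m12 : measurable_fun setT (fun p : RR => p.1 + p.2 : measurableTypeR R) by exact: measurable_funD.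
have h0 := m12 measurableT `]1, +oo[%classic (measurable_itv _).
have h1 := m1 measurableT `]-oo, 1]%classic (measurable_itv _).
have h2 := m2 measurableT `]-oo, 1]%classic (measurable_itv _).
have := measurableI _ _ h0 (measurableI _ _ h1 h2); congr measurable.
apply/seteqP; split => p /=; rewrite !in_itv/= andbT.
  by move=> [[_ ->] [[_ ->] [_ ->]]].
by move=> /and3P[-> -> ->].
Qed.

Lemma measurable_excess_neg : measurable_fun setT (excess_neg : RR -> R).
Proof.
rewrite (_ : excess_neg = \1_(`]1, +oo[ `*` `]1, +oo[) :> (RR -> R)); last first.
  apply/funext => p; rewrite indicE; congr (nat_of_bool _)%:R.
  apply/idP/idP => [/andP[h1 h2]|/set_mem [/=]].
    by apply/mem_set; split; rewrite /= in_itv/= andbT.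
  by rewrite !in_itv/= !andbT => -> ->.
by apply: measurable_indic; exact: measurableX.
Qed.

(** The increment is cut into its positive part in a box, its negative part in the box, and the rest
    outside, each controlled up to e / 3. The limit is the difference of the masses: (C + 1) / a^2 -
    1 / a^2 = C / a^2. *)
Lemma pair_mean_limit (w1 w2 : R) : 0 < w1 -> 0 < w2 -> 0 < b < 2^-1 ->
  (fun p : R * R => limf_esup (fun t : R => ((power_rate b t)^-1%:E *
     \int[P]_x (`|pair_excess w1 w2 (S t x)| * (~~ in_box p.1 p.2 (S t x))%:R)%:E)%E)
     (pinfty_nbhs R)) @ filter_prod 0^'+ (pinfty_nbhs R) --> 0%E ->
  (\int[P]_x pair_excess w1 w2 (S t x)) / power_rate b t @[t --> +oo] -->
  kap * ((w1 * w2) `^ (1 - b) * (C_ (1 - b) / (1 - b) ^+ 2)).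
Proof.
move=> w10 w20 b02 hN; have b01 : 0 < b < 1 by lra.
pose gp (p : R * R) := excess_pos (w1 * p.1, w2 * p.2).
pose gm (p : R * R) := excess_neg (w1 * p.1, w2 * p.2).
have mw : measurable_fun setT (fun p : RR => (w1 * p.1, w2 * p.2) : RR).
  by apply: measurable_fun_pair; exact: measurable_funM.
have mgp : measurable_fun setT (gp : RR -> R) by exact: (measurableT_comp measurable_excess_pos mw).
have mgm : measurable_fun setT (gm : RR -> R) by exact: (measurableT_comp measurable_excess_neg mw).
have gp0 p : 0 <= gp p by rewrite ler0n.
have gm0 p : 0 <= gm p by rewrite ler0n.
set W := (w1 * w2) `^ (1 - b).
have Fp : full_mass b gp = (W * ((C_ (1 - b) + 1) / (1 - b) ^+ 2))%:E.
  by rewrite (full_mass_scale b measurable_excess_pos)// full_mass_pos// EFinM.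
have Fm : full_mass b gm = (W * (1 - b) ^- 2)%:E.
  by rewrite (full_mass_scale b measurable_excess_neg)// full_mass_neg// EFinM.
apply/cvgrPdist_lt => e e0; have e3 : 0 < e / 3 by rewrite divr_gt0.
have Bp := box_mean_near mgp gp0 Fp e3.
have Bm := box_mean_near mgm gm0 Fm e3.
(* The boundary hypothesis is used along eps = 1 / (n + 1), M = n + 1, the boxes of
   [box_mass_cvg]. *)
have cn : (n.+1%:R^-1 : R, n.+1%:R : R) @[n --> \oo] --> filter_prod 0^'+ (pinfty_nbhs R).
  move=> A [[A1 A2] /= [h1 h2] sA].
  have c1 : \forall n \near \oo, A1 (n.+1%:R^-1).
    have := @cvg_harmonic R _ h1.
    by rewrite /nbhs /=; apply: filterS => n; apply; rewrite /= invr_gt0.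
  have /(_ _ h2) c2 : (n.+1%:R : R) @[n --> \oo] --> +oo.
    apply/cvgryPge => y; near=> n; apply: (@le_trans _ _ n%:R); last by rewrite ler_nat.
    by near: n; exact: nbhs_infty_ger.
  by near=> n; apply: sA; split => /=; near: n.
have Bn : \forall n \near \oo, (limf_esup (fun t : R => ((power_rate b t)^-1%:E *
     \int[P]_x (`|pair_excess w1 w2 (S t x)| * (~~ in_box n.+1%:R^-1 n.+1%:R (S t x))%:R)%:E)%E)
     (pinfty_nbhs R) < (e / 3)%:E)%E.
  have hU : nbhs (0%E : \bar R) [set y | (y < (e / 3)%:E)%E].
    by apply: open_nbhs_nbhs; split; [exact: open_ereal_lt_ereal|rewrite /= lte_fin].
  exact: (cvg_comp _ _ cn hN _ hU).
near \oo => n.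
have Bpt : \forall t \near +oo,
  `|(\int[P]_x (gp (S t x) * (in_box n.+1%:R^-1 n.+1%:R (S t x))%:R)) / power_rate b t
     - kap * (W * ((C_ (1 - b) + 1) / (1 - b) ^+ 2))| < e / 3 by near: n.
have Bmt : \forall t \near +oo,
  `|(\int[P]_x (gm (S t x) * (in_box n.+1%:R^-1 n.+1%:R (S t x))%:R)) / power_rate b t
     - kap * (W * (1 - b) ^- 2)| < e / 3 by near: n.
have Bnt : \forall t \near +oo, ((power_rate b t)^-1%:E *
     \int[P]_x (`|pair_excess w1 w2 (S t x)| * (~~ in_box n.+1%:R^-1 n.+1%:R (S t x))%:R)%:E < (e / 3)%:E)%E.
  by apply: limf_esup_lt; near: n.
near=> t.
have t1 : 1 < t by near: t; exact: nbhs_pinfty_gt.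
have r0 := power_rate_gt0 t1.
have hp : `|(\int[P]_x (gp (S t x) * (in_box n.+1%:R^-1 n.+1%:R (S t x))%:R)) / power_rate b t
     - kap * (W * ((C_ (1 - b) + 1) / (1 - b) ^+ 2))| < e / 3 by near: t.
have hm : `|(\int[P]_x (gm (S t x) * (in_box n.+1%:R^-1 n.+1%:R (S t x))%:R)) / power_rate b t
     - kap * (W * (1 - b) ^- 2)| < e / 3 by near: t.
have hn : ((power_rate b t)^-1%:E *
     \int[P]_x (`|pair_excess w1 w2 (S t x)| * (~~ in_box n.+1%:R^-1 n.+1%:R (S t x))%:R)%:E < (e / 3)%:E)%E by near: t.
pose B x : R := (in_box n.+1%:R^-1 n.+1%:R (S t x))%:R.
pose B' x : R := (~~ in_box n.+1%:R^-1 n.+1%:R (S t x))%:R.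
have BB' x : B x + B' x = 1 by rewrite /B /B'; case: in_box; rewrite ?addr0 ?add0r.
have mB : measurable_fun setT B by exact: (measurableT_comp (measurable_in_box _ _) (mS t)).
have mB' : measurable_fun setT B'.
  rewrite (_ : B' = fun x => 1 - B x); first exact: measurable_funB.
  by apply/funext => x; rewrite -(BB' x) addrAC subrr add0r.
have mGp : measurable_fun setT (fun x => gp (S t x)) by exact: (measurableT_comp mgp (mS t)).
have mGm : measurable_fun setT (fun x => gm (S t x)) by exact: (measurableT_comp mgm (mS t)).
have B1 x : `|B x| <= 1 by rewrite /B; case: in_box; rewrite ?normr1 ?normr0.
have B'1 x : `|B' x| <= 1 by rewrite /B'; case: in_box; rewrite ?normr1 ?normr0.
have gp1 p : `|gp p| <= 1 by rewrite /gp /excess_pos; case: (_ && _); rewrite ?normr1 ?normr0.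
have gm1 p : `|gm p| <= 1 by rewrite /gm /excess_neg; case: (_ && _); rewrite ?normr1 ?normr0.
have bnd (f h : T -> R) (M : R) : 0 <= M -> measurable_fun setT f -> measurable_fun setT h ->
    (forall x, `|f x| <= M) -> (forall x, `|h x| <= 1) ->
    P.-integrable setT (EFin \o (fun x => f x * h x)).
  move=> M0 mf mh fM h1; apply: (@bounded_integrable _ _ _ _ _ M); first exact: measurable_funM.
  by move=> x; rewrite normrM -[leRHS]mulr1 ler_pM.
have ip : P.-integrable setT (EFin \o (fun x => gp (S t x) * B x)) by exact: (bnd _ _ 1).
have im : P.-integrable setT (EFin \o (fun x => gm (S t x) * B x)) by exact: (bnd _ _ 1).
pose G x := pair_excess w1 w2 (S t x).
have GE x : G x = gp (S t x) - gm (S t x).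
  have t0 : 0 < t by exact: lt_trans t1.
  by apply: pair_excessE; rewrite mulr_ge0 ?divr_ge0 ?ltW.
have mG : measurable_fun setT G.
  by rewrite (funext GE); exact: measurable_funB.
have G2 x : `|G x| <= 2.
  rewrite GE.
  have -> : 2 = 1 + 1 :> R by [].
  exact: le_trans (ler_normB _ _) (lerD (gp1 _) (gm1 _)).
have iG : P.-integrable setT (EFin \o (fun x => G x * B' x)) by exact: (bnd _ _ 2).
have E : \int[P]_x G x = \int[P]_x (gp (S t x) * B x) - \int[P]_x (gm (S t x) * B x) + \int[P]_x (G x * B' x).
  have iD : P.-integrable setT (EFin \o (fun x => gp (S t x) * B x - gm (S t x) * B x)).
    by have := integrableB measurableT ip im.
  rewrite -(RintegralB measurableT ip im) -(RintegralD measurableT iD iG).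
  apply: eq_Rintegral => x _; rewrite -[LHS]mulr1 -(BB' x) mulrDr; congr (_ + _).
  by rewrite GE mulrBl.
have iaG : P.-integrable setT (EFin \o (fun x => `|G x| * B' x)).
  by apply: (bnd _ _ 2) => //; [exact: measurableT_comp|move=> x; rewrite normr_id].
have D : `|\int[P]_x (G x * B' x) / power_rate b t| < e / 3.
  rewrite normrM (ger0_norm (x := _^-1)) ?invr_ge0 ?(ltW r0)//.
  apply: (@le_lt_trans _ _ (\int[P]_x (`|G x| * B' x) / power_rate b t)).
    rewrite ler_wpM2r ?invr_ge0 ?(ltW r0)//.
    apply: (le_trans (le_normr_Rintegral measurableT iG)).
    rewrite le_eqVlt; apply/orP; left; apply/eqP; apply: eq_Rintegral => x _.
    by rewrite normrM (ger0_norm (x := B' x)).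
  have := integrable_fin_num measurableT iaG; move: hn.
  rewrite /Rintegral /G /B'.
  case: (\int[P]_x _)%E => // q.
  by rewrite -EFinM lte_fin /= mulrC.
rewrite E.
set Ip := \int[P]_x (gp _ * _) in hp *; set Im := \int[P]_x (gm _ * _) in hm *.
set In := \int[P]_x (G _ * _) in D *.
have -> : kap * (W * (C_ (1 - b) / (1 - b) ^+ 2)) =
   kap * (W * ((C_ (1 - b) + 1) / (1 - b) ^+ 2)) - kap * (W * (1 - b) ^- 2).
  by rewrite mulrDl mul1r; ring.
have -> : (Ip - Im + In) / power_rate b t =
    Ip / power_rate b t - Im / power_rate b t + In / power_rate b t.
  by rewrite !mulrDl mulNr.
exact: dist_thirds hp hm D.
Unshelve. all: by end_near. Qed.

End pair_limit.

(** * Inclusion-exclusion *)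

Section inclusion_exclusion.
Context {R : realType} {m : nat}.
Implicit Types (A I J : {set 'I_m}) (q : {set 'I_m} -> R).

(** Expand the product over i of [F i + G i]: the factor is 1 on J and off A, and -1 + 1 = 0 on the
    rest of A. A choice I of the terms F survives only when J is contained in I and I in A. *)
Lemma sum_signed_interval A J : J \subset A ->
  \sum_(I : {set 'I_m} | (J \subset I) && (I \subset A)) (-1) ^+ (#|I| - #|J|) =
  (J == A)%:R :> R.
Proof.
move=> JA.
pose F (i : 'I_m) : R := if i \in J then 1 else if i \in A then -1 else 0.
pose G (i : 'I_m) : R := if i \in J then 0 else 1.
have := bigA_distr _ _ F G : \prod_i (F i + G i) = _.
have -> : \prod_i (F i + G i) = (J == A)%:R.
  have [JE|JnA] := eqVneq J A.
    by apply: big1 => i _; rewrite /F /G JE; case: (i \in A); rewrite ?addr0 ?add0r.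
  have /fintype.subsetPn[i iA iJ] : ~~ (A \subset J) by apply: contra_neqN JnA => AJ; apply/eqP; rewrite finset.eqEsubset JA.
  by rewrite (bigD1 i)//= {1}/F {1}/G (negbTE iJ) iA addNr mul0r.
move=> ->; rewrite big_mkcond; apply: eq_bigr => I _.
case: ifPn => [/andP[JI IA]|].
  rewrite (bigID (fun i => i \in I :\: J))/= [X in _ * X]big1 ?mulr1; last first.
    move=> i; rewrite inE negb_and negbK /F /G.
    case: ifPn => iI /=; rewrite ?orbF ?orbT => h; first by rewrite h.
    by case: ifPn => // iJ; rewrite (fintype.subsetP JI) in iI.
  rewrite -(cardsDS JI) -prodr_const; apply: eq_bigr => i; rewrite inE => /andP[iJ iI].
  by rewrite iI /F (negbTE iJ) (fintype.subsetP IA).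
rewrite negb_and => /orP[/fintype.subsetPn[i iJ iI]|/fintype.subsetPn[i iI iA]].
  by rewrite (bigD1 i)//= (negbTE iI) /G iJ mul0r.
rewrite (bigD1 i)//= iI /F (negbTE iA) ifN ?mul0r//.
by apply: contra iA; exact: (fintype.subsetP JA).
Qed.

(** Moebius inversion on the lattice of subsets: after exchanging the sums, the coefficient of [q J]
    is the signed count of the interval from J to A. *)
Lemma inclusion_exclusion q A : q finset.set0 = 0 ->
  q A = \sum_(I : {set 'I_m} | (I != finset.set0) && (I \subset A))
    \sum_(J : {set 'I_m} | (J != finset.set0) && (J \subset I)) (-1) ^+ (#|I| - #|J|) * q J.
Proof.
move=> q0.
transitivity (\sum_(J : {set 'I_m} | (J != finset.set0) && (J \subset A)) q J * (J == A)%:R).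
  have [->|An] := eqVneq A finset.set0.
    by rewrite q0 big1// => J /andP[J0]; rewrite finset.subset0 => /eqP J0'; rewrite J0' eqxx in J0.
  rewrite (bigD1 A)/= ?An ?subxx// eqxx mulr1 big1 ?addr0// => J /andP[_ /negbTE ->].
  by rewrite mulr0.
transitivity (\sum_(J : {set 'I_m} | (J != finset.set0) && (J \subset A))
   \sum_(I : {set 'I_m} | (J \subset I) && (I \subset A)) (-1) ^+ (#|I| - #|J|) * q J).
  by apply: eq_bigr => J /andP[_ JA]; rewrite -sum_signed_interval// mulrC mulr_suml.
rewrite (exchange_big_dep (fun I => (I != finset.set0) && (I \subset A)))/=.
  apply: eq_bigr => I /andP[I0 IA]; apply: eq_bigl => J.
  case: (boolP (J == finset.set0)) => //= J0.
  by rewrite IA andbT; case: (boolP (J \subset I)) => JI; rewrite ?andbF ?andbT// (fintype.subset_trans JI).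
move=> J I /andP[J0 JA] /andP[JI ->]; rewrite andbT.
by apply: contraNneq J0 => I0; rewrite -finset.subset0 -I0.
Qed.

(** The condition i < j picks one ordered pair for each two-element set, which makes p -> {p.1, p.2}
    injective. *)
Lemma sum_pairs (w : 'I_m -> R) (F : {set 'I_m} -> R) :
  \sum_(I : {set 'I_m} | (I \subset active w) && (#|I| == 2)) F I =
  \sum_(p in active_pairs w) F [set p.1; p.2]%SET.
Proof.
pose f (p : 'I_m * 'I_m) := [set p.1; p.2]%SET.
rewrite -[RHS](@big_imset _ _ _ _ _ f (active_pairs w) F); last first.
  move=> [i j] [i' j'] /=; rewrite !inE /= /f /= => /and3P[ij _ _] /and3P[ij' _ _] E.
  have /orP h2 : (i == i') || (i == j') by move: (in_set2 i i' j'); rewrite -E in_set2 eqxx => <-.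
  have /orP h1 : (j == i') || (j == j') by move: (in_set2 j i' j'); rewrite -E in_set2 eqxx orbT => <-.
  case: h1 => /eqP h1; case: h2 => /eqP h2; move: ij ij'; rewrite h1 h2 ?ltnn// => ij ij'.
  by have := ltn_trans ij ij'; rewrite ltnn.
apply: eq_bigl => I; apply/andP/imsetP => [[IA /cards2P[i [j [ij IE]]]]|[[i j]]].
  have iA : i \in active w by apply: (fintype.subsetP IA); rewrite IE !inE eqxx.
  have jA : j \in active w by apply: (fintype.subsetP IA); rewrite IE !inE eqxx orbT.
  have [lt|lt|/val_inj e] := ltngtP i j.
  - by exists (i, j) => //; rewrite !inE /= lt; move: iA jA; rewrite !inE => -> ->.
  - exists (j, i) => //; last by rewrite IE /f /= finset.setUC.
    by rewrite !inE /= lt; move: iA jA; rewrite !inE => -> ->.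
  - by rewrite e eqxx in ij.
rewrite !inE /= => /and3P[ij iA jA] ->; split; last first.
  by rewrite cards2 (_ : i != j)//; apply: contraTneq ij => ->; rewrite ltnn.
by apply/fintype.subsetP => l; rewrite !inE => /orP[] /eqP ->.
Qed.

End inclusion_exclusion.

(** * The tail probability as a sum of mean increments *)

Section tail_expansion.
Context d (T : measurableType d) (R : realType) (P : probability T R) (m : nat).
Variables (w : 'I_m -> R) (Y : 'I_m -> T -> R).
Hypothesis simplex_w : simplex_weights w.
Hypothesis mY : forall i, measurable_fun setT (Y i).
Implicit Types (I J : {set 'I_m}) (t : R).

Lemma Rintegral_indicator (A : T -> bool) : measurable [set x | A x] ->
  \int[P]_x (A x)%:R = fine (P [set x | A x]).
Proof.
move=> mA; rewrite /Rintegral -[in RHS](setIT [set x | A x]) -integral_indic//.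
congr fine; apply: eq_integral => x _; rewrite indicE; congr (nat_of_bool _)%:R%:E.
by apply/idP/idP => [h|/set_mem]; [apply/mem_set|].
Qed.

Lemma Rintegral_sum (I : eqType) (r : seq I) (Q : pred I) (f : I -> T -> R) :
  (forall i, Q i -> P.-integrable setT (EFin \o f i)) ->
  \int[P]_x (\sum_(i <- r | Q i) f i x) = \sum_(i <- r | Q i) \int[P]_x f i x.
Proof.
(* Integrability of the partial sums is carried through the induction because additivity of the
   integral requires it. *)
move=> hf; suff [] : P.-integrable setT (EFin \o (fun x => \sum_(i <- r | Q i) f i x)) /\
  \int[P]_x (\sum_(i <- r | Q i) f i x) = \sum_(i <- r | Q i) \int[P]_x f i x by [].
elim: r => [|i r [ih1 ih2]].
  split; last by under eq_Rintegral do rewrite big_nil; rewrite big_nil Rintegral_cst// mul0r.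
  have -> : (fun x => \sum_(i <- [::] | Q i) f i x) = fun=> 0 by apply/funext => x; rewrite big_nil.
  exact: integrable0.
rewrite big_cons; case: ifPn => Qi.
  have -> : (fun x => \sum_(j <- i :: r | Q j) f j x) = (fun x => f i x + \sum_(j <- r | Q j) f j x).
    by apply/funext => x; rewrite big_cons Qi.
  rewrite -ih2 -RintegralD//; last exact: hf.
  split; last by apply: eq_Rintegral => x _.
  have := integrableD measurableT (hf _ Qi) ih1; apply: eq_integrable => // x _.
have -> : (fun x => \sum_(j <- i :: r | Q j) f j x) = (fun x => \sum_(j <- r | Q j) f j x).
  by apply/funext => x; rewrite big_cons (negbTE Qi).
by [].
Qed.

Let exceed t J x : bool := 1 < \sum_(j in J) w j * (Y j x / t).

Let q t J : R := fine (P [set x | exceed t J x]).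

Let m_exceed t J : measurable [set x | exceed t J x].
Proof.
have mS : measurable_fun setT (fun x => \sum_(j <- enum J) w j * (Y j x / t)).
  apply: (@measurable_sum _ _ _ _ _ (enum J) (fun j x => w j * (Y j x / t))) => j.
  by apply: measurable_funM => //; exact: measurable_funM.
have := mS measurableT `]1, +oo[%classic (measurable_itv _).
by rewrite setTI; congr measurable; apply/seteqP; split => x /=; rewrite in_itv/= andbT big_enum.
Qed.

Lemma mean_incrementE I t : mean_increment P Y w I t =
  \sum_(J : {set 'I_m} | (J != finset.set0) && (J \subset I)) (-1) ^+ (#|I| - #|J|) * q t J.
Proof.
rewrite /mean_increment unlock.
rewrite -[LHS]/(\int[P]_x (\sum_(J : {set 'I_m} | (J != finset.set0) && (J \subset I))
  (-1) ^+ (#|I| - #|J|) * (exceed t J x)%:R)).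
have ib J : P.-integrable setT (EFin \o (fun x => (exceed t J x)%:R : R)).
  apply: (@bounded_integrable _ _ _ _ _ 1).
    rewrite (_ : (fun x => _) = \1_[set x | exceed t J x]); first exact: measurable_indic.
    apply/funext => x; rewrite indicE; congr (nat_of_bool _)%:R.
    by apply/idP/idP => [h|/set_mem]; [apply/mem_set|].
  by move=> x; case: exceed; rewrite ?normr1 ?normr0.
rewrite Rintegral_sum.
  by apply: eq_bigr => J _; rewrite RintegralZl// Rintegral_indicator.
move=> J _; have := integrableZl measurableT ((-1) ^+ (#|I| - #|J|)) (ib J).
by apply: eq_integrable.
Qed.

Lemma tail_probE t : 0 < t -> tail_prob P Y w t = q t (active w).
Proof.
move=> t0; rewrite /tail_prob /q; congr (fine (P _)); apply/funext => x /=; apply/propext.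
rewrite /exceed -(ltr_pM2l t0) mulr1 mulr_sumr.
suff -> : \sum_(i < m) w i * Y i x = \sum_(i in active w) t * (w i * (Y i x / t)) by [].
rewrite [RHS]big_mkcond; apply: eq_bigr => i _; rewrite inE.
case: ltP => wi; first by field; rewrite gt_eqF.
have [w0 _] := simplex_w; suff -> : w i = 0 by rewrite mul0r.
by apply/le_anti; rewrite wi w0.
Qed.

Hypothesis marginal : forall i y, i \in active w -> 1 <= y ->
  P [set x | y < Y i x] = (y^-1)%:E.

Lemma weight_le1 i : w i <= 1.
Proof.
have [w0 <-] := simplex_w; rewrite (bigD1 i)//= lerDl.
by apply: sumr_ge0 => j _; exact: w0.
Qed.

(** As w_i <= 1, the level t / w_i is at least 1, where the Pareto tail is exact; so singletons
    leave no error term. *)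
Lemma mean_increment1 i t : i \in active w -> 1 <= t ->
  mean_increment P Y w [set i]%SET t = w i / t.
Proof.
move=> iA t1; have wi : 0 < w i by rewrite inE in iA.
have t0 : 0 < t by exact: lt_le_trans t1.
rewrite mean_incrementE (big_pred1 [set i]%SET); last first.
  move=> J; rewrite finset.subset1 /=.
  have [->|J0] := eqVneq J finset.set0; last by rewrite orbF.
  by rewrite eq_sym -finset.cards_eq0 cards1.
rewrite subnn expr0 mul1r /q /exceed.
have y1 : 1 <= t / w i by rewrite ler_pdivlMr// mul1r (le_trans (weight_le1 i)).
have /(congr1 fine) /= := marginal iA y1; rewrite invf_div => <-; congr (fine (P _)).
apply/funext => x /=; apply/propext; rewrite big_set1 ltr_pdivrMr// mulrA ltr_pdivlMr// mul1r.
by rewrite (mulrC (w i)).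
Qed.

Lemma tail_split t : 1 <= t -> tail_prob P Y w t = t^-1
  + \sum_(p in active_pairs w) mean_increment P Y w [set p.1; p.2]%SET t
  + \sum_(I : {set 'I_m} | (I \subset active w) && (3 <= #|I|)%N) mean_increment P Y w I t.
Proof.
move=> t1; have t0 : 0 < t by exact: lt_le_trans t1.
have q0 : q t finset.set0 = 0.
  rewrite /q (_ : [set x | _] = set0) ?measure0//.
  by apply/seteqP; split => x //=; rewrite /exceed big_set0 ltNge ler01.
rewrite tail_probE// (inclusion_exclusion _ q0).
under eq_bigr do rewrite -mean_incrementE.
rewrite (bigID (fun I : {set 'I_m} => #|I| == 1%N))/= -addrA; congr (_ + _).
  rewrite (eq_bigl (fun I : {set 'I_m} => I \in [set [set i]%SET | i in active w]%SET)); last first.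
    move=> I; apply/idP/imsetP => [/andP[/andP[_ IA] /cards1P[i IE]]|[i iA ->]].
      by exists i => //; apply: (fintype.subsetP IA); rewrite IE inE.
    by rewrite cards1 eqxx andbT finset.sub1set iA andbT -finset.card_gt0 cards1.
  rewrite big_imset/=; last by move=> i j _ _ /finset.set1_inj.
  under eq_bigr => i iA do rewrite mean_increment1//.
  rewrite -mulr_suml; have [w0 w1] := simplex_w.
  rewrite -[RHS]mul1r -w1; congr (_ / _); rewrite big_mkcond; apply: eq_bigr => i _.
  by rewrite inE; case: ltP => // wi; apply/le_anti; rewrite wi w0.
rewrite (bigID (fun I : {set 'I_m} => #|I| == 2%N)) /= -(sum_pairs w (fun I => mean_increment P Y w I t)); congr (_ + _); apply: eq_bigl => I.
  by rewrite -finset.cards_eq0; case: (I \subset _); rewrite ?andbF//=; case: #|I| => [|[|[|]]].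
by rewrite -finset.cards_eq0; case: (I \subset _); rewrite ?andbF//=; case: #|I| => [|[|[|]]].
Qed.

Lemma tail_expansion (E : {set 'I_m * 'I_m}) (r : R -> R) (L : 'I_m * 'I_m -> R) e :
  E \subset active_pairs w -> (\forall t \near +oo, 0 < r t) ->
  (forall p, p \in E ->
     mean_increment P Y w [set p.1; p.2]%SET t / r t @[t --> +oo] --> L p) ->
  remaining_faces_negligible P Y w E r -> 0 < e ->
  \forall t \near +oo, `|tail_prob P Y w t - (t^-1 + (\sum_(p in E) L p) * r t)| <= e * r t.
Proof.
move=> EA r0 hE hrem e0; have e2 : 0 < e / 2 by rewrite divr_gt0.
have cE : (\sum_(p in E) mean_increment P Y w [set p.1; p.2]%SET t / r t) @[t --> +oo] --> \sum_(p in E) L p.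
  by apply: (cvg_big add_continuous) => p pE; exact: hE.
move/cvgrPdist_lt : cE => /(_ _ e2) cE.
move/eqoP : hrem => /(_ _ e2) hrem.
near=> t.
have t1 : 1 <= t by near: t; apply: nbhs_pinfty_ge; rewrite num_real.
have rt : 0 < r t by near: t.
have h1 : `|\sum_(p in E) L p - \sum_(p in E) mean_increment P Y w [set p.1; p.2]%SET t / r t| < e / 2.
  by near: t.
have h2 : `|\sum_(p : 'I_m * 'I_m | (p.1 < p.2)%N && (p \notin E))
        `|mean_increment P Y w [set p.1; p.2]%SET t|
     + \sum_(I : {set 'I_m} | (I \subset active w) && (3 <= #|I|)%N)
        `|mean_increment P Y w I t| | <= e / 2 * `|r t| by near: t.
rewrite (gtr0_norm rt) in h2.
rewrite tail_split// (bigID (fun p => p \in E))/=.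
rewrite (eq_bigl (fun p => p \in E)); last first.
  by move=> p; rewrite andb_idl// => /(fintype.subsetP EA).
set S1 := \sum_(p in E) _ in h1 *; set S1' := \sum_(p in E) _ in h1.
have -> : \sum_(p in E) mean_increment P Y w [set p.1; p.2]%SET t = S1' * r t.
  by rewrite mulr_suml; apply: eq_bigr => p _; rewrite divfK// gt_eqF.
set S2 := \sum_(p in active_pairs w | _) _; set S3 := \sum_(I | _) mean_increment _ _ _ _ _.
(* The pair sum in [h2] ranges over all indices, active or not; being made of absolute values, it
   dominates the sum over active pairs. *)
have h3 : `|S2| + `|S3| <= e / 2 * r t.
  apply: le_trans h2; apply: (le_trans _ (ler_norm _)).
  apply: lerD; last exact: ler_norm_sum.
  apply: (le_trans (ler_norm_sum _ _ _)).
  rewrite [leLHS]big_mkcond [leRHS]big_mkcond; apply: ler_sum => p _.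
  case: ifPn => [/andP[pA pE]|_]; last by case: ifP.
  by rewrite pE andbT; move: pA; rewrite inE => /and3P[-> _ _].
have -> : t^-1 + (S1' * r t + S2) + S3 - (t^-1 + S1 * r t) = (S1' - S1) * r t + S2 + S3 by ring.
have h4 : `|(S1' - S1) * r t| <= e / 2 * r t.
  by rewrite normrM (gtr0_norm rt) ler_wpM2r ?(ltW rt)// distrC ltW.
rewrite (le_trans (ler_normD _ _))// (le_trans (lerD (ler_normD _ _) (lexx _)))//.
by rewrite -addrA (le_trans (lerD h4 h3))// -mulrDl -splitr.
Unshelve. all: by end_near. Qed.

End tail_expansion.

(** * Half-Cauchy scores and rescaling *)

Section rescaling.
Context {R : realType}.
Implicit Types (b c D t x : R) (f g r : R -> R).

Lemma expansionP f g r D : (\forall t \near +oo, 0 < r t) ->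
  (forall e, 0 < e -> \forall t \near +oo, `|f t - (g t + D * r t)| <= e * r t) <->
  ((f t - g t) / r t @[t --> +oo] --> D).
Proof.
move=> r0; have E t : 0 < r t -> f t - (g t + D * r t) = ((f t - g t) / r t - D) * r t.
  by move=> rt; rewrite mulrBl divfK ?gt_eqF// opprD addrA.
split=> [h|/cvgrPdist_le h e e0].
  apply/cvgrPdist_le => e e0; near=> t; have rt : 0 < r t by near: t.
  have : `|f t - (g t + D * r t)| <= e * r t by near: t; exact: h.
  by rewrite E// normrM (gtr0_norm rt) ler_pM2r// distrC.
near=> t; have rt : 0 < r t by near: t.
rewrite E// normrM (gtr0_norm rt) ler_pM2r// distrC.
by near: t; exact: h.
Unshelve. all: by end_near. Qed.

Lemma eq_cvg_pinfty f g D : (\forall t \near +oo, f t = g t) ->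
  g t @[t --> +oo] --> D -> f t @[t --> +oo] --> D.
Proof.
move=> h; apply: cvg_trans; apply: near_eq_cvg; near=> t; apply/esym; near: t; exact: h.
Unshelve. all: by end_near. Qed.

Lemma cvg_ln_pinfty : ln (t : R) @[t --> +oo] --> +oo.
Proof.
apply/cvgryPge => A; near=> t; have : expR A <= t by near: t; apply: nbhs_pinfty_ge; rewrite num_real.
by move=> h; rewrite -ler_expR lnK// posrE (lt_le_trans _ h)// expR_gt0.
Unshelve. all: by end_near. Qed.

Lemma cvg_shift_scale c x : 0 < c -> ((t : R) + x) / c @[t --> +oo] --> +oo.
Proof.
move=> c0; apply/cvgryPge => A; near=> t.
rewrite ler_pdivlMr// -lerBlDr; near: t; apply: nbhs_pinfty_ge; rewrite num_real//.
Unshelve. all: by end_near. Qed.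

Lemma cvg_inv_pinfty f : f t @[t --> +oo] --> +oo -> (f t)^-1 @[t --> +oo] --> (0 : R).
Proof.
move=> /cvgryPgt h; apply/cvgrPdist_lt => e e0; near=> t.
have : Num.max 0 e^-1 < f t by near: t; exact: h.
rewrite gt_max => /andP[f0 fe].
by rewrite sub0r normrN ger0_norm ?invr_ge0 ?ltW// invf_plt ?posrE.
Unshelve. all: by end_near. Qed.

(** Regular variation: (t + x) / c = t y with y tending to 1 / c, and ln(t y) = ln t (1 + ln y / ln
    t), so neither the shift nor the logarithm contributes to the limit. *)
Lemma power_rate_shift_scale b c x : 0 < b -> 0 < c ->
  power_rate b ((t + x) / c) / power_rate b t @[t --> +oo] --> c `^ (2 * (1 - b)).
Proof.
move=> b0 c0.
have i0 : (t : R)^-1 @[t --> +oo] --> (0 : R) by apply: cvg_inv_pinfty; exact: cvg_id.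
have l0 : (ln (t : R))^-1 @[t --> +oo] --> (0 : R) by apply: cvg_inv_pinfty; exact: cvg_ln_pinfty.
have h1 : (1 + x * t^-1) / c @[t --> +oo] --> c^-1.
  suff : (1 + x * t^-1) / c @[t --> +oo] --> (1 + x * 0) / c by rewrite mulr0 addr0 mul1r.
  by apply: cvgM; [apply: cvgD; [exact: cvg_cst|apply: cvgM => //; exact: cvg_cst]|exact: cvg_cst].
have ci0 : 0 < c^-1 by rewrite invr_gt0.
have h2 : ((1 + x * t^-1) / c) `^ (- (2 * (1 - b))) @[t --> +oo] --> c `^ (2 * (1 - b)).
  have -> : c `^ (2 * (1 - b)) = c^-1 `^ (- (2 * (1 - b))).
    by rewrite -powR_inv1 ?ltW// -powRrM mulN1r opprK.
  exact: (cvg_comp _ _ h1 (continuous_powR (c := - (2 * (1 - b))) ci0)).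
have h4 : 1 + ln ((1 + x * t^-1) / c) * (ln t)^-1 @[t --> +oo] --> (1 : R).
  suff : 1 + ln ((1 + x * t^-1) / c) * (ln t)^-1 @[t --> +oo] --> 1 + ln c^-1 * 0 by rewrite mulr0 addr0.
  apply: cvgD; first exact: cvg_cst.
  by apply: cvgM => //; exact: (cvg_comp _ _ h1 (continuous_ln ci0)).
have h3 : (1 + ln ((1 + x * t^-1) / c) * (ln t)^-1) `^ (- b) @[t --> +oo] --> (1 : R).
  suff : (1 + ln ((1 + x * t^-1) / c) * (ln t)^-1) `^ (- b) @[t --> +oo] --> (1 : R) `^ (- b) by rewrite powR1.
  exact: (cvg_comp _ _ h4 (continuous_powR (c := - b) ltr01)).
rewrite -[X in _ --> X]mulr1.
apply: eq_cvg_pinfty (cvgM h2 h3); near=> t.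
have t1 : 1 < t by near: t; exact: nbhs_pinfty_gt.
have t0 : 0 < t by exact: lt_trans t1.
have L0 : 0 < ln t by rewrite ln_gt0.
have s0 : 0 < (1 + x * t^-1) / c.
  by near: t; exact: (cvgr_gt _ h1).
have L1 : 0 < 1 + ln ((1 + x * t^-1) / c) * (ln t)^-1.
  by near: t; exact: (cvgr_gt _ h4).
have -> : (t + x) / c = t * ((1 + x * t^-1) / c) by field; rewrite !gt_eqF.
rewrite /power_rate /=; set y := (1 + _) / c in s0 L1 *.
have -> : ln (t * y) = ln t * (1 + ln y * (ln t)^-1).
  by rewrite (lnM (x := t)) ?posrE//; field; rewrite gt_eqF.
rewrite (powRM _ (x := t)) ?ltW// (powRM _ (x := ln t)) ?ltW//.
have p1 : 0 < t `^ (- (2 * (1 - b))) by rewrite powR_gt0.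
have p2 : 0 < ln t `^ (- b) by rewrite powR_gt0.
by field; rewrite !gt_eqF.
Unshelve. all: by end_near. Qed.

(** The quotient is t^(- 2 b) (ln t)^b. Once ln t >= 1, (ln t)^b <= ln t <= t^b / b, which leaves a
    multiple of t^-b. *)
Lemma inv_sqr_power_rate b : 0 < b < 1 -> (t : R) ^- 2 / power_rate b t @[t --> +oo] --> (0 : R).
Proof.
move=> /andP[b0 b1].
have h : b^-1 * t `^ (- b) @[t --> +oo] --> (0 : R).
  rewrite -(mulr0 b^-1); apply: cvgM; first exact: cvg_cst.
  under eq_fun do rewrite powRN.
  apply: cvg_inv_pinfty; apply/cvgryPge => A; near=> t.
  have hM : (Num.max 1 A) `^ b^-1 <= t by near: t; apply: nbhs_pinfty_ge; rewrite num_real.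
  have M0 : 0 <= Num.max 1 A by rewrite le_max ler01.
  apply: (@le_trans _ _ (Num.max 1 A)); first by rewrite le_max lexx orbT.
  have -> : Num.max 1 A = ((Num.max 1 A) `^ b^-1) `^ b by rewrite -powRrM mulVf ?gt_eqF// powRr1.
  by apply: ge0_ler_powR; rewrite ?nnegrE ?powR_ge0 ?(ltW b0)// (le_trans _ hM) ?powR_ge0.
apply: (@squeeze_cvgr _ _ _ _ (fun=> 0) (fun t => b^-1 * t `^ (- b))) => //; last exact: cvg_cst.
near=> t.
have t1 : 1 < t by near: t; exact: nbhs_pinfty_gt.
have t0 : 0 < t by exact: lt_trans t1.
have L1 : 1 <= ln t.
  have te : expR 1 <= t by near: t; apply: nbhs_pinfty_ge; rewrite num_real.
  by rewrite -ler_expR lnK ?posrE.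
have L0 : 0 < ln t by exact: lt_le_trans L1.
rewrite divr_ge0 ?invr_ge0 ?exprn_ge0 ?(ltW t0)//= ?mulr_ge0 ?powR_ge0//.
rewrite ler_pdivrMr ?mulr_gt0 ?powR_gt0//.
have -> : t ^- 2 = t `^ (- b) * t `^ (- (2 * (1 - b))) * t `^ (- b).
  rewrite -!powR_gt0D// -powR_mulrn ?(ltW t0)// -powRN; congr (_ `^ _); ring.
have hb : ln t `^ b <= b^-1 * t `^ b.
  apply: (@le_trans _ _ (ln t)).
    by rewrite -[leRHS]powRr1 ?(ltW L0)//; apply: ler_powR => //; exact: ltW.
  rewrite ler_pdivlMl// -ln_powR.
  have tb : 0 < t `^ b by rewrite powR_gt0.
  have := @le_ln1Dx _ (t `^ b - 1); rewrite [1 + _]addrC subrK => hl.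
  have {}hl : ln (t `^ b) <= t `^ b - 1 by apply: hl; rewrite ltrBrDr addNr.
  by rewrite (le_trans hl)// gerBl.
have hb' : t `^ (- b) <= b^-1 * ln t `^ (- b).
  rewrite !powRN ler_pdivlMr ?powR_gt0// ler_pdivrMl ?powR_gt0//.
  by rewrite mulrC.
have X0 : 0 <= t `^ (- b) * t `^ (- (2 * (1 - b))) by rewrite mulr_ge0 ?powR_ge0.
rewrite (le_trans (ler_wpM2l X0 hb'))// le_eqVlt; apply/orP; left; apply/eqP.
by rewrite /power_rate; ring.
Unshelve. all: by end_near. Qed.

(** Both bounds on h follow the expansion of f at (t + x) / c, for x = 1 and x = 0. Their leading
    terms c / (t + 1) and c / t differ by at most c t^-2, negligible by [inv_sqr_power_rate]. *)
Lemma expansion_rescale (f h : R -> R) b c D : 0 < b < 1 -> 0 < c ->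
  (f t - t^-1) / power_rate b t @[t --> +oo] --> D ->
  (\forall t \near +oo, f ((t + 1) / c) <= h t <= f (t / c)) ->
  (h t - c / t) / power_rate b t @[t --> +oo] --> c `^ (2 * (1 - b)) * D.
Proof.
move=> b01 c0 hf fh; have /andP[b0 _] := b01.
have r0 : \forall t \near +oo, 0 < power_rate b t.
  by near=> t; apply: power_rate_gt0; near: t; exact: nbhs_pinfty_gt.
have key x : (f ((t + x) / c) - ((t + x) / c)^-1) / power_rate b t @[t --> +oo] --> c `^ (2 * (1 - b)) * D.
  have hx := cvg_shift_scale x c0.
  have h1 : (f ((t + x) / c) - ((t + x) / c)^-1) / power_rate b ((t + x) / c) @[t --> +oo] --> D.
    exact: (cvg_comp _ _ hx hf).
  apply: eq_cvg_pinfty (cvgM (power_rate_shift_scale x b0 c0) h1).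
  have rx : \forall t \near +oo, 0 < power_rate b ((t + x) / c) by exact: hx _ r0.
  near=> t; have h3 : 0 < power_rate b t by near: t.
  have h4 : 0 < power_rate b ((t + x) / c) by near: t.
  move: (f _ - _) (power_rate b ((t + x) / c)) (power_rate b t) h3 h4 => y u v v0 u0.
  by field; rewrite !gt_eqF.
have low : (f ((t + 1) / c) - c / t) / power_rate b t @[t --> +oo] --> c `^ (2 * (1 - b)) * D.
  have hd : (((t + 1) / c)^-1 - c / t) / power_rate b t @[t --> +oo] --> (0 : R).
    have hz : - (c * (t ^- 2 / power_rate b t)) @[t --> +oo] --> (0 : R).
      suff : - (c * (t ^- 2 / power_rate b t)) @[t --> +oo] --> - (c * 0) by rewrite mulr0 oppr0.
      apply: cvgN.
      by apply: cvgM; [exact: cvg_cst|exact: inv_sqr_power_rate].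
    apply: squeeze_cvgr hz (cvg_cst (0 : R)); near=> t.
    have t0 : 0 < t by near: t; exact: nbhs_pinfty_gt.
    have t10 : 0 < t + 1 by rewrite addr_gt0.
    have rt : 0 < power_rate b t by near: t.
    have E : ((t + 1) / c)^-1 - c / t = - (c / (t * (t + 1))) by field; rewrite !gt_eqF.
    have q0 : 0 <= c / (t * (t + 1)) by rewrite divr_ge0 ?mulr_ge0 ?ltW.
    rewrite E mulNr lerN2; apply/andP; split; last by rewrite oppr_le0 divr_ge0// ltW.
    rewrite mulrA ler_pM2r ?invr_gt0// ler_pM2l// lef_pV2 ?posrE ?exprn_gt0 ?mulr_gt0//.
    by rewrite expr2 ler_pM2l// lerDl.
  rewrite -[X in _ --> X]addr0; apply: eq_cvg_pinfty (cvgD (key 1) hd).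
  by near=> t; rewrite -mulrDl addrA subrK.
have upp : (f (t / c) - c / t) / power_rate b t @[t --> +oo] --> c `^ (2 * (1 - b)) * D.
  by apply: eq_cvg_pinfty (key 0); near=> t; rewrite addr0 invf_div.
apply: squeeze_cvgr low upp; near=> t.
have rt : 0 < power_rate b t by near: t.
have /andP[h1 h2] : f ((t + 1) / c) <= h t <= f (t / c) by near: t.
by rewrite !ler_pM2r ?invr_gt0// !lerD2r h1 h2.
Unshelve. all: by end_near. Qed.

End rescaling.

(** * Coordinates of a normal vector *)

Section normal_vector.
Context d (T : measurableType d) (R : realType) (P : probability T R) (m : nat).
Local Notation N01 := (@normal_prob R 0 1).
Local Notation RR := (measurableTypeR R * measurableTypeR R)%type.
Variables (Rho : 'M[R]_m) (Z : 'I_m -> {RV P >-> R}).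
Hypothesis posdef_Rho : posdef_correlation Rho.
Hypothesis normal_Z : multivariate_normal Z Rho.

Let pairv i j (a b : R) : 'rV[R]_m := a *: delta_mx 0 i + b *: delta_mx 0 j.

Let pairvE i j a b k : pairv i j a b 0 k = a * (k == i)%:R + b * (k == j)%:R.
Proof. by rewrite !mxE eqxx. Qed.

Let sum_delta (f : 'I_m -> R) i : \sum_k (k == i)%:R * f k = f i.
Proof.
rewrite (bigD1 i)//= eqxx mul1r big1 ?addr0// => k /negbTE ->.
by rewrite mul0r.
Qed.

Lemma sum_pairv (f : 'I_m -> R) i j a b :
  \sum_k pairv i j a b 0 k * f k = a * f i + b * f j.
Proof.
under eq_bigr do rewrite pairvE mulrDl -!mulrA.
by rewrite big_split/= -!mulr_sumr !sum_delta.
Qed.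

Lemma quad_pairv i j a b : (pairv i j a b *m Rho *m (pairv i j a b)^T) 0 0 =
  a ^+ 2 + 2 * a * b * Rho i j + b ^+ 2.
Proof.
have [RT R1 _] := posdef_Rho.
have Rji : Rho j i = Rho i j by rewrite -[in LHS]RT mxE.
rewrite mxE; under eq_bigr do rewrite mxE mulrC [X in X * _]mxE.
rewrite !sum_pairv !R1 Rji.
by ring.
Qed.

Lemma pairv_neq0 i j a b : i != j -> (a != 0) || (b != 0) -> pairv i j a b != 0.
Proof.
move=> ij; apply: contraTneq => v0.
have := pairvE i j a b i; have := pairvE i j a b j; rewrite v0 !mxE !eqxx eq_sym (negbTE ij).
by rewrite !mulr0 !mulr1 add0r addr0 => <- <-; rewrite eqxx.
Qed.

(** Positive definiteness on the vectors e_i + e_j and e_i - e_j gives 2 + 2 rho > 0 and 2 - 2 rho >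
    0. *)
Lemma correlation_lt1 i j : i != j -> `|Rho i j| < 1.
Proof.
move=> ij; have [_ _ pd] := posdef_Rho.
have h1 := pd _ (pairv_neq0 (a := 1) (b := 1) ij _); have h2 := pd _ (pairv_neq0 (a := 1) (b := -1) ij _).
rewrite !quad_pairv oner_eq0 in h1 h2.
have {}h1 := h1 isT; have {}h2 := h2 isT.
by rewrite ltr_norml; apply/andP; split; lra.
Qed.

Lemma bivariate_normal_coordinates i j : i != j -> bivariate_normal (Z i) (Z j) (Rho i j).
Proof.
move=> ij a b ab B mB; rewrite -quad_pairv -(normal_Z (pairv_neq0 ij ab) mB).
by congr (P _); apply/funext => x /=; rewrite sum_pairv.
Qed.

Lemma normal_coordinate i B : measurable B -> P [set x | B (Z i x)] = N01 B.
Proof.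
move=> mB; have [_ R1 _] := posdef_Rho.
(* A single coordinate is the degenerate pair (i, i) with coefficients 1 and 0. *)
have v0 : pairv i i 1 0 != 0.
  apply/eqP => /rowP /(_ i); rewrite pairvE mxE eqxx mul0r addr0 mulr1 => /eqP.
  by rewrite oner_eq0.
have := normal_Z v0 mB; rewrite quad_pairv mulr0 mul0r addr0 expr0n addr0 expr1n sqrtr1 => <-.
by congr (P _); apply/funext => x /=; rewrite sum_pairv mul1r mul0r addr0.
Qed.

Lemma score_coordinate s i y : is_score s -> 1 <= y ->
  P [set x | y < s (Z i x)] = (y^-1)%:E.
Proof.
move=> hs y1; have [_ <-//] := hs.
exact: (@normal_coordinate i [set x | y < s x] (is_score_measurable y hs)).
Qed.

Lemma copula_coordinates i j (h : RR -> \bar R) : i != j -> measurable_fun setT h ->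
  (forall p, 0 <= h p)%E ->
  (\int[P]_x h (Z i x, Z j x) =
   \int[(N01 \x N01)%E]_p (h p * (gauss_copula (Rho i j) p.1 p.2)%:E))%E.
Proof.
move=> ij mh h0.
rewrite (bivariate_normal_copula (correlation_lt1 ij) (bivariate_normal_coordinates ij) mh h0).
apply/esym; apply: (etrans (fubini_tonelli1 _ _ _)).
- apply: emeasurable_funM => //; apply/measurable_EFinP; exact: measurable_gauss_copula.
- by move=> p; rewrite mule_ge0// lee_fin gauss_copula_ge0.
by [].
Qed.

End normal_vector.

Lemma rho_star_lt1 (R : realType) m (S : 'M[R]_m) w :
  (forall i j, i != j -> S i j < 1) -> rho_star S w < 1.
Proof.
move=> S1; apply: bigmax_lt; first by rewrite (lt_trans _ ltr01)// ltrN10.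
move=> [i j]; rewrite inE /= => /and3P[ij _ _]; apply: S1.
by apply: contraTneq ij => ->; rewrite ltnn.
Qed.

(** * Signs, evenness and the two-sided density *)

Lemma gauss_copulaN (R : realType) (r x z : R) : gauss_copula r (- x) z = gauss_copula (- r) x z.
Proof.
have e : 2 * r * - x * z = 2 * - r * x * z by ring.
by rewrite /gauss_copula !sqrrN e.
Qed.

(** The density depends only on the squares and on the product r x z, so a change of sign of x or z
    can be moved to r; the average is symmetric in r and - r. *)
Lemma abs_copulaE (R : realType) (r x z : R) :
  abs_copula `|r| x z = (gauss_copula r x z + gauss_copula (- r) x z) / 2.
Proof.
have evN (q u v : R) : gauss_copula q u v = gauss_copula (- q) (- u) v.
  by rewrite gauss_copulaN opprK.
have evN2 (q u v : R) : gauss_copula q u v = gauss_copula (- q) u (- v).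
  have e : 2 * - q * u * - v = 2 * q * u * v by ring.
  by rewrite /gauss_copula !sqrrN e.
rewrite /abs_copula; congr (_ / 2).
have [r0|r0] := leP 0 r; have [x0|x0] := leP 0 x; have [z0|z0] := leP 0 z;
  rewrite ?(ger0_norm r0) ?(ltr0_norm r0) ?(ger0_norm x0) ?(ltr0_norm x0)
    ?(ger0_norm z0) ?(ltr0_norm z0) ?opprK.
- by [].
- by rewrite addrC [in LHS]evN2 [X in _ + X]evN2 !opprK.
- by rewrite addrC [in LHS]evN [X in _ + X]evN !opprK.
- by rewrite ![gauss_copula _ (- x) _]evN ![gauss_copula _ _ (- z)]evN2 !opprK.
- by rewrite addrC.
- by rewrite ![gauss_copula _ _ (- z)]evN2 !opprK.
- by rewrite ![gauss_copula _ (- x) _]evN !opprK.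
- by rewrite addrC ![gauss_copula _ (- x) _]evN ![gauss_copula _ _ (- z)]evN2 !opprK.
Qed.

Lemma integral_normal01_opp (R : realType) (f : R -> \bar R) : measurable_fun setT f ->
  (forall x, 0 <= f x)%E ->
  (\int[@normal_prob R 0 1]_x f (- x)%R = \int[@normal_prob R 0 1]_x f x)%E.
Proof.
move=> mf f0.
have mfN : measurable_fun setT (fun x : R => f (- x)).
  by apply: (measurableT_comp mf); exact: measurable_funN.
rewrite !ge0_integral_normal01//.
have mp : measurable_fun setT (fun x : R => f x * (stdpdf x)%:E)%E.
  by apply: emeasurable_funM => //; exact: measurable_EFin_stdpdf.
rewrite [RHS](ge0_integral_oppr mp); last by move=> x; rewrite mule_ge0// lee_fin ltW// stdpdf_gt0.
by apply: eq_integral => x _; rewrite stdpdfN.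
Qed.

Lemma adde_half (R : realType) (x : \bar R) : (2^-1%:E * x + 2^-1%:E * x = x)%E.
Proof.
rewrite -ge0_muleDl ?lee_fin ?invr_ge0// -EFinD (_ : 2^-1 + 2^-1 = 1) ?mul1e//.
by field.
Qed.

Lemma mule_average (R : realType) (x : \bar R) (u v : R) : 0 <= u -> 0 <= v ->
  (x * ((u + v) / 2)%:E = 2^-1%:E * (x * u%:E) + 2^-1%:E * (x * v%:E))%E.
Proof.
move=> u0 v0; have i0 : 0 <= 2^-1 :> R by rewrite invr_ge0.
rewrite !(muleCA (2^-1%:E)) -!EFinM -ge0_muleDr ?lee_fin ?mulr_ge0//.
by rewrite -EFinD mulrC mulrDr.
Qed.

Section absolute_scores.
Context d (T : measurableType d) (R : realType) (P : probability T R) (m : nat).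
Local Notation N01 := (@normal_prob R 0 1).
Local Notation RR := (measurableTypeR R * measurableTypeR R)%type.
Variables (Rho : 'M[R]_m) (Z : 'I_m -> {RV P >-> R}).
Hypothesis posdef_Rho : posdef_correlation Rho.
Hypothesis normal_Z : multivariate_normal Z Rho.

(* Reflecting the first coordinate exchanges the copula densities of [r] and
   [- r], so an even function sees only their average. *)
Lemma abs_copula_coordinates i j (h : RR -> \bar R) : i != j -> measurable_fun setT h ->
  (forall p, 0 <= h p)%E -> (forall x z, h (- x, z) = h (x, z)) ->
  (\int[P]_x h (Z i x, Z j x) =
   \int[(N01 \x N01)%E]_p (h p * (abs_copula `|Rho i j| p.1 p.2)%:E))%E.
Proof.
move=> ij mh h0 hN; set r := Rho i j.
rewrite (copula_coordinates posdef_Rho normal_Z ij mh h0) -/r.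
pose f q (p : RR) := (h p * (gauss_copula q p.1 p.2)%:E)%E.
have mf q : measurable_fun setT (f q).
  by apply: emeasurable_funM => //; apply/measurable_EFinP; exact: measurable_gauss_copula.
have f0 q p : (0 <= f q p)%E by rewrite mule_ge0// lee_fin gauss_copula_ge0.
have fub q : (\int[(N01 \x N01)%E]_p f q p = \int[N01]_x \int[N01]_z f q (x, z))%E.
  by apply: (etrans (fubini_tonelli1 _ (mf q) (f0 q))).
have E : (\int[(N01 \x N01)%E]_p f r p = \int[(N01 \x N01)%E]_p f (- r)%R p)%E.
  rewrite (fub r) (fub (- r)).
  pose F (x : R) : \bar R := (\int[N01]_z f r (x, z))%E.
  have mF : measurable_fun setT F by exact: (measurable_fun_fubini_tonelli_F (m2 := N01) _ (mf r) (f0 r)).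
  have F0 x : (0 <= F x)%E by apply: integral_ge0 => z _; exact: f0.
  apply: (etrans (esym (integral_normal01_opp mF F0))).
  by apply: eq_integral => x _; apply: eq_integral => z _; rewrite /f /= hN gauss_copulaN.
have hf p : (h p * (abs_copula `|r| p.1 p.2)%:E = 2^-1%:E * f r p + 2^-1%:E * f (- r)%R p)%E.
  rewrite abs_copulaE /f.
  by apply: mule_average; exact: gauss_copula_ge0.
apply/esym; transitivity (\int[(N01 \x N01)%E]_p (2^-1%:E * f r p + 2^-1%:E * f (- r)%R p))%E.
  by apply: eq_integral => p _; exact: hf.
have i0 : (0 <= 2^-1%:E :> \bar R)%E by rewrite lee_fin invr_ge0.
have mi q : measurable_fun setT (fun p => 2^-1%:E * f q p)%E by exact (measurable_funeM _ (mf q)).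
have i0f q p : (0 <= 2^-1%:E * f q p)%E by exact: mule_ge0.
apply: (etrans (ge0_integralD _ measurableT (fun p _ => i0f r p) (mi r) (fun p _ => i0f _ p) (mi _))).
have hZ q := ge0_integralZl (N01 \x N01)%E measurableT (mf q) (fun p _ => f0 q p) i0.
apply: (etrans (congr2 adde (hZ r) (hZ (- r)))).
by rewrite -E; exact: adde_half.
Qed.

End absolute_scores.

(** * Expansion for a sum of scores *)

Lemma is_derive_ge0_le (R : realType) (f df : R -> R) (x : R) : 0 <= x ->
  (forall y, is_derive y (1 : R) f (df y)) -> (forall y, 0 < y < x -> 0 <= df y) -> f 0 <= f x.
Proof.
move=> x0 hd df0.
have cf y : {for y, continuous f} by have [d _] := hd y; exact/differentiable_continuous/derivable1_diffP.
apply: (@ger0_derive1_ndecr R f 0 x) => //; last exact: continuous_subspaceT.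
by move=> y; rewrite in_itv/= derive1E => y01; have [_ ->] := hd y; exact: df0.
Qed.

Lemma mul_cos_le_sin (R : realType) (x : R) : 0 <= x <= pi -> x * cos x <= sin x.
Proof.
move=> /andP[x0 x1].
have hd y : is_derive y (1 : R) (fun y : R => sin y - y * cos y) (y * sin y).
  have h := is_deriveB (is_derive_sin y) (is_deriveM (is_derive_id y (1 : R)) (is_derive_cos y)).
  by apply: (is_derive_eq h); rewrite /GRing.scale /=; ring.
have := is_derive_ge0_le x0 hd; rewrite sin0 mul0r subr0 subr_ge0; apply => y /andP[y0 yx].
by rewrite mulr_ge0 ?sin_ge0_pi// ltW//= (le_trans (ltW yx)).
Qed.

Lemma sin_le_id (R : realType) (x : R) : 0 <= x -> sin x <= x.
Proof.
move=> x0; have hd y : is_derive y (1 : R) (fun y : R => y - sin y) (1 - cos y).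
  exact: is_deriveB (is_derive_id y (1 : R)) (is_derive_sin y).
have := is_derive_ge0_le x0 hd; rewrite sin0 subr0 subr_ge0; apply => y _.
by rewrite subr_ge0 cos_le1.
Qed.

Lemma onem_le_cos (R : realType) (x : R) : 0 <= x -> 1 - x <= cos x.
Proof.
move=> x0; have hd y : is_derive y (1 : R) (fun y : R => cos y + y) (- sin y + 1).
  exact: is_deriveD (is_derive_cos y) (is_derive_id y (1 : R)).
have := is_derive_ge0_le x0 hd; rewrite cos0 addr0 lerBlDr; apply => y _.
by rewrite addrC subr_ge0 sin_le1.
Qed.

(** The upper bound is x cos x <= sin x. For the lower one, if x >= 1 the left side is at most 0 and
    cot x is nonnegative; if x < 1, (1 / x - 1) sin x <= 1 - x <= cos x. At x = pi U / 2 this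
    compares the half-Cauchy and Pareto scores. *)
Lemma cot_bounds (R : realType) (x : R) : 0 < x <= pi / 2 -> x^-1 - 1 <= cot x <= x^-1.
Proof.
move=> /andP[x0 x1]; have p0 := pi_gt0 R.
have xpi : x < pi by rewrite (le_lt_trans x1)// gtr_pMr// invf_lt1// ltr1n.
have s0 : 0 < sin x by rewrite sin_gt0_pi// x0.
have h1 : x * cos x <= sin x by apply: mul_cos_le_sin; rewrite !ltW.
apply/andP; split; last by rewrite /cot ler_pdivrMr// mulrC ler_pdivlMr// mulrC.
rewrite /cot ler_pdivlMr//; have [x1'|x1'] := leP 1 x.
  apply: (@le_trans _ _ 0).
    by rewrite mulr_le0_ge0 ?(ltW s0)// subr_le0 invf_le1.
  apply: cos_ge0_pihalf; rewrite x1 andbT (le_trans _ (ltW x0))// oppr_le0 divr_ge0 ?pi_ge0//.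
apply: le_trans (onem_le_cos (ltW x0)).
have -> : 1 - x = (x^-1 - 1) * x by field; rewrite gt_eqF.
by apply: ler_wpM2l; [rewrite subr_ge0 invf_ge1 ?ltW|exact: sin_le_id (ltW x0)].
Qed.

Lemma face_increment_pair (R : realType) m (w : 'I_m -> R) (i j : 'I_m) (x : 'I_m -> R) :
  i != j -> face_increment w [set i; j]%SET x = pair_excess (w i) (w j) (x i, x j).
Proof.
move=> ij; have c2 : #|[set i; j]%SET| = 2%N by rewrite cards2 ij.
have nij : [set i]%SET != [set i; j]%SET by apply/eqP => /(congr1 (fun A : {set 'I_m} => #|A|)); rewrite c2 cards1.
have nji : [set j]%SET != [set i; j]%SET by apply/eqP => /(congr1 (fun A : {set 'I_m} => #|A|)); rewrite c2 cards1.
have nij' : [set j]%SET != [set i]%SET by apply/eqP => /finset.set1_inj /eqP; rewrite eq_sym (negbTE ij).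
rewrite /face_increment (bigD1 [set i; j]%SET)/=; last by rewrite fintype.subxx andbT -finset.card_gt0 c2.
rewrite (bigD1 [set i]%SET)/=; last by rewrite nij andbT finset.sub1set !inE eqxx andbT -finset.card_gt0 cards1.
rewrite (bigD1 [set j]%SET)/=; last first.
  by rewrite nji nij' !andbT finset.sub1set !inE eqxx orbT andbT -finset.card_gt0 cards1.
rewrite [X in _ + (_ + (_ + X))]big1 ?addr0; last first.
  move=> J /andP[/andP[/andP[/andP[J0 JS] JA] JB] JC]; exfalso.
  (* A subset of {i, j} is determined by the membership of i and of j; each of the four
     possibilities has been removed from the sum. *)
  have JE (b1 b2 : bool) : (i \in J) = b1 -> (j \in J) = b2 ->
      J = [set l in [set i; j]%SET | if l == i then b1 else b2]%SET.
    move=> h1 h2; apply/finset.setP => l; rewrite !inE.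
    have [lJ|lJ] := boolP (l \in J).
      have := fintype.subsetP JS _ lJ; rewrite !inE => /orP[] /eqP le; rewrite le.
        by rewrite eqxx /= -h1 -le lJ.
      by rewrite eqxx orbT /= eq_sym (negbTE ij) -h2 -le lJ.
    apply/esym/negbTE; apply: contra lJ => /andP[/orP[] /eqP ->]; first by rewrite eqxx h1.
    by rewrite eq_sym (negbTE ij) h2.
  case h1 : (i \in J); case h2 : (j \in J); have E := JE _ _ h1 h2.
  - move/eqP: JA; apply; apply/finset.setP => l; rewrite E !inE; case: (l == i) => //=.
    by rewrite andbT.
  - move/eqP: JB; apply; apply/finset.setP => l; rewrite E !inE; case: (l == i) => //=.
    by rewrite andbF.
  - move/eqP: JC; apply; apply/finset.setP => l; rewrite E !inE.
    by have [->|_] := eqVneq l i; rewrite ?(negbTE ij)//= andbT.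
  - move/eqP: J0; apply; apply/finset.setP => l; rewrite E !inE.
    by case: (l == i); rewrite andbF.
rewrite !cards1 c2 subnn expr0 mul1r subn1 /= expr1 !mulN1r.
by rewrite !big_set1 big_setU1 ?inE//= big_set1 /pair_excess /= addrA.
Qed.

Lemma rateE (R : realType) (rho : R) : rate rho = power_rate (beta_ rho).
Proof.
apply/funext => t; rewrite /rate /power_rate /beta_ /q_.
by congr (_ `^ (- _) * _); rewrite opprB addrCA subrr addr0.
Qed.

(** * Expansions for scores 1 / u, with u a p-value function and k a copula density *)

Section score_sum.
Context d (T : measurableType d) (R : realType) (P : probability T R) (m : nat).
Local Notation N01 := (@normal_prob R 0 1).
Local Notation RR := (measurableTypeR R * measurableTypeR R)%type.
Variables (w : 'I_m -> R) (S : 'M[R]_m) (X : 'I_m -> {RV P >-> R}).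
Variables (u : R -> R) (k : R -> R -> R) (kap : R).
Let s z := (u z)^-1.
Let rho := rho_star S w.
Let E := E_star S w.
Let Y i x := s (X i x).
Let H i x := cot (pi * u (X i x) / 2).
Hypothesis simplex_w : simplex_weights w.
Hypothesis measurable_u : measurable_fun setT u.
Hypothesis u01 : forall z, 0 < u z <= 1.
Hypothesis hs : is_score s.
Hypothesis rho01 : 0 < rho < 1.
Hypothesis k_ge0 : forall x z, 0 <= k x z.
Hypothesis mk : measurable_fun setT (fun p : RR => k p.1 p.2).
Hypothesis hk : kernel_asymp s k (beta_ rho) kap.
Hypothesis kap_gt0 : 0 < kap.
Hypothesis hP : forall i j, (i, j) \in E -> forall h : RR -> \bar R, measurable_fun setT h ->
  (forall p, 0 <= h p)%E ->
  (\int[P]_x h (s (X i x), s (X j x)) =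
   \int[(N01 \x N01)%E]_p (h (s p.1, s p.2) * (k p.1 p.2)%:E))%E.
Hypothesis marginal : forall i y, 1 <= y -> P [set x | y < Y i x] = (y^-1)%:E.
Hypothesis boundary : forall i j, (i, j) \in E -> boundary_negligible P Y w (rate rho) i j.
Hypothesis remaining : remaining_faces_negligible P Y w E (rate rho).

Let s_gt0 z : 0 < s z.
Proof. by rewrite invr_gt0; have /andP[] := u01 z. Qed.

Let mX i : measurable_fun setT (X i).
Proof. exact: measurable_funP. Qed.

Let mY i : measurable_fun setT (Y i).
Proof. by have [ms _] := hs; exact: measurableT_comp. Qed.

(** Equivalently 1/2 < [a_ rho] < 1, the range where [C_] is evaluated. *)
Let beta01 : 0 < beta_ rho < 2^-1.
Proof.
have /andP[r0 r1] := rho01; rewrite /beta_ /a_; apply/andP; split.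
  by rewrite subr_gt0 invf_lt1 ?ltrDl// addr_gt0.
have : 2^-1 < (1 + rho)^-1 by rewrite ltf_pV2 ?posrE ?addr_gt0//; lra.
by lra.
Qed.

(** Each extremal pair contributes kap (w_i w_j)^a C(a) / a^2 by [pair_mean_limit], and a^-2 = (1 +
    rho)^2; all other faces of size at least two are absorbed by condition (b). *)
Lemma score_sum_expansion : (tail_prob P Y w t - t^-1) / rate rho t @[t --> +oo] -->
  D_ (kap * (1 + rho) ^+ 2) rho E w.
Proof.
have /andP[r0 r1] := rho01.
have rate_gt0 : \forall t \near +oo, 0 < rate rho t.
  by near=> t; rewrite rateE; apply: power_rate_gt0; near: t; exact: nbhs_pinfty_gt.
pose L (p : 'I_m * 'I_m) := kap * ((w p.1 * w p.2) `^ (a_ rho) * (C_ (a_ rho) / a_ rho ^+ 2)).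
have -> : D_ (kap * (1 + rho) ^+ 2) rho E w = \sum_(p in E) L p.
  rewrite /D_ mulr_sumr; apply: eq_bigr => p _; rewrite /L {5}/a_ exprVn invrK.
  by ring.
have EA : E \subset active_pairs w by apply/fintype.subsetP => p; rewrite inE => /andP[].
apply/(expansionP _ _ _ rate_gt0) => e e0.
apply: (tail_expansion simplex_w mY _ EA rate_gt0 _ remaining e0).
  by move=> i y _; exact: marginal.
move=> [i j] ijE; have := fintype.subsetP EA _ ijE.
rewrite inE /= => /and3P[ij]; rewrite !inE => wi wj.
have nij : i != j by apply: contraTneq ij => ->; rewrite ltnn.
have := @pair_mean_limit _ _ _ P s k (beta_ rho) kap (X i) (X j) hs s_gt0 k_ge0 mk hk
  (hP ijE) kap_gt0 (mX i) (mX j) (w i) (w j) wi wj beta01.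
rewrite -rateE.
have -> : 1 - beta_ rho = a_ rho by rewrite /beta_ opprB addrCA subrr addr0.
have fE t x : face_increment w [set i; j]%SET (fun l => Y l x / t) =
    pair_excess (w i) (w j) (s (X i x) / t, s (X j x) / t) by exact: face_increment_pair.
have Eb (p : R * R) : limf_esup (fun t : R => ((rate rho t)^-1%:E *
      'E_P[boundary_increment Y w i j p.1 p.2 t])%E) (pinfty_nbhs R) =
    limf_esup (fun t : R => ((rate rho t)^-1%:E *
      \int[P]_x (`|pair_excess (w i) (w j) (s (X i x) / t, s (X j x) / t)| *
        (~~ in_box p.1 p.2 (s (X i x) / t, s (X j x) / t))%:R)%:E)%E) (pinfty_nbhs R).
  congr (limf_esup _ _); apply/funext => t; rewrite unlock; congr (_ * _)%E.
  by apply: eq_integral => x _; rewrite /boundary_increment fE.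
have Em t : mean_increment P Y w [set i; j]%SET t =
    \int[P]_x pair_excess (w i) (w j) (s (X i x) / t, s (X j x) / t).
  by rewrite /mean_increment unlock; apply: eq_Rintegral => x _; exact: fE.
under [X in _ -> X @ _ --> _]eq_fun do rewrite Em.
apply; have := boundary ijE; rewrite /boundary_negligible.
by rewrite (funext Eb).
Unshelve. all: by end_near. Qed.

Let measurable_tail_set (f : 'I_m -> T -> R) t : (forall i, measurable_fun setT (f i)) ->
  measurable [set x | t < \sum_(i < m) w i * f i x].
Proof.
move=> mf.
have mS : measurable_fun setT (fun x => \sum_(i < m) w i * f i x).
  by apply: (@measurable_sum _ _ _ _ _ _ (fun i x => w i * f i x)) => i; exact: measurable_funM.
have := mS measurableT `]t, +oo[%classic (measurable_itv _).
by rewrite setTI; congr measurable; apply/seteqP; split => x /=; rewrite in_itv/= andbT.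
Qed.

Let tail_set_le (f g : 'I_m -> T -> R) t t' : (forall i, measurable_fun setT (f i)) ->
  (forall i, measurable_fun setT (g i)) ->
  (forall x, t < \sum_(i < m) w i * f i x -> t' < \sum_(i < m) w i * g i x) ->
  tail_prob P f w t <= tail_prob P g w t'.
Proof.
move=> mf mg fg; rewrite /tail_prob; apply: fine_le; [exact: fin_num_measure (measurable_tail_set _ mf)|
  exact: fin_num_measure (measurable_tail_set _ mg)|].
by apply: le_measure; rewrite ?inE//; [exact: measurable_tail_set|exact: measurable_tail_set].
Qed.

Let angle z := pi * u z / 2.

Let angle_itv z : 0 < angle z <= pi / 2.
Proof.
have /andP[u0 u1] := u01 z; have p0 := pi_gt0 R; rewrite /angle.
by rewrite divr_gt0 ?mulr_gt0//= ler_pM2r// ger_pMr.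
Qed.

Let mH i : measurable_fun setT (H i).
Proof.
have mang : measurable_fun setT angle.
  by apply: measurable_funM => //; exact: measurable_funM.
(* The angle lies in ]0, pi / 2], where sin is nonnegative, so the inverse is a power with exponent
   -1 and measurability follows from that of powers. *)
have -> : H i = (fun z => cos (angle z) * (sin (angle z)) `^ (-1)) \o X i.
  apply/funext => x; rewrite /H /cot /= -/(angle _) powR_inv1//.
  have /andP[a0 a1] := angle_itv (X i x).
  apply: sin_ge0_pi; rewrite (ltW a0) (le_trans a1)//.
  by rewrite ler_piMr ?pi_ge0// invf_le1// ler1n.
have mc : measurable_fun setT (@cos R) by exact: continuous_measurable_fun (@continuous_cos R).
have ms : measurable_fun setT (@sin R) by exact: continuous_measurable_fun (@continuous_sin R).
apply: measurableT_comp => //; apply: measurable_funM; first exact: (measurableT_comp mc mang).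
exact: (measurableT_comp (measurable_powR _) (measurableT_comp ms mang)).
Qed.

Lemma half_cauchy_sum_expansion :
  (tail_prob P H w t - (2 / pi) / t) / rate rho t @[t --> +oo] -->
  (2 / pi) `^ q_ rho * D_ (kap * (1 + rho) ^+ 2) rho E w.
Proof.
set c := 2 / pi; have c0 : 0 < c by rewrite divr_gt0// pi_gt0.
have b01 : 0 < beta_ rho < 1 by have /andP[-> h] := beta01; lra.
have := score_sum_expansion; rewrite rateE => hY.
have -> : q_ rho = 2 * (1 - beta_ rho) by rewrite /q_ /beta_ opprB addrCA subrr addr0.
apply: (expansion_rescale b01 c0 hY); near=> t.
have cY i x : (angle (X i x))^-1 = c * Y i x.
  by rewrite /Y /s /angle /c !invfM invrK; ring.
have [w0 w1] := simplex_w.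
have HE i x : c * Y i x - 1 <= H i x <= c * Y i x.
  by rewrite -cY; exact: cot_bounds.
apply/andP; split; apply: tail_set_le => // x.
  rewrite ltr_pdivrMr// => h; apply: (@lt_le_trans _ _ (\sum_(i < m) w i * (c * Y i x - 1))).
    under eq_bigr do rewrite mulrBr mulr1.
    (* The weights sum to 1, so lowering every score by 1 lowers the weighted sum by exactly 1. *)
    rewrite sumrB w1 ltrBrDr (lt_le_trans h)// mulr_suml le_eqVlt.
    by apply/orP; left; apply/eqP; apply: eq_bigr => i _; rewrite -mulrA [c * _]mulrC.
  by apply: ler_sum => i _; apply: ler_wpM2l => //; have /andP[] := HE i x.
rewrite ltr_pdivrMr// => h; apply: (lt_le_trans h).
rewrite mulr_suml; apply: ler_sum => i _; rewrite -mulrA; apply: ler_wpM2l => //.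
by rewrite mulrC; have /andP[] := HE i x.
Unshelve. all: by end_near. Qed.

End score_sum.

(** * Little-o form, and the one-sided and two-sided instances *)

Lemma expansion_littleo (R : realType) (f g r : R -> R) (D : R) :
  (\forall t \near +oo, 0 < r t) -> (f t - g t) / r t @[t --> +oo] --> D ->
  f = (fun t => g t + D * r t) +o_ +oo r.
Proof.
move=> r0 /(expansionP _ _ _ r0) h; apply/eqaddoP => e e0; near=> t.
have rt : 0 < r t by near: t.
rewrite (gtr0_norm rt); near: t; exact: h.
Unshelve. all: by end_near. Qed.

Lemma rate_gt0_near (R : realType) (rho : R) : \forall t \near +oo, 0 < rate rho t.
Proof.
by near=> t; rewrite rateE; apply: power_rate_gt0; near: t; exact: nbhs_pinfty_gt.
Unshelve. all: by end_near. Qed.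

Lemma K_E (R : realType) (rho : R) : copula_cst rho * (1 + rho) ^+ 2 = K_ rho.
Proof. by rewrite /copula_cst /K_ /beta_ opprB mulrC mulrA. Qed.

Lemma onem_Phi_itv (R : realType) (z : R) : 0 < 1 - Phi z <= 1.
Proof. by rewrite onem_Phi_gt0 gerBl ltW// Phi_gt0. Qed.

Lemma onem_Phi_norm_itv (R : realType) (z : R) : 0 < 2 * (1 - Phi `|z|) <= 1.
Proof.
rewrite mulr_gt0 ?onem_Phi_gt0//=.
have : Phi (0 : R) <= Phi `|z| by rewrite Phi_le.
by rewrite Phi0; lra.
Qed.

Lemma measurable_score_pair (R : realType) (s : R -> R)
    (h : measurableTypeR R * measurableTypeR R -> \bar R) : is_score s ->
  measurable_fun setT h ->
  measurable_fun setT (fun p : measurableTypeR R * measurableTypeR R => h (s p.1, s p.2)).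
Proof.
move=> [ms _] mh; apply: (measurableT_comp mh).
by apply: measurable_fun_pair; exact: measurableT_comp.
Qed.

Theorem mainTheorem10 (R : realType) (d : measure_display)
    (T : measurableType d) (P : probability T R) (m : nat)
    (Rho : 'M[R]_m) (w : 'I_m -> R) (Z : 'I_m -> {RV P >-> R})
    (posdef_Rho : posdef_correlation Rho)
    (simplex_w : simplex_weights w)
    (two_active : (2 <= #|active w|)%N)
    (normal_Z : multivariate_normal Z Rho) :
  (let rho := rho_star Rho w in
   let E := E_star Rho w in
   let r := rate rho in
   let U := fun (i : 'I_m) (x : T) => 1 - Phi (Z i x) in
   let Y := fun (i : 'I_m) (x : T) => (U i x)^-1 in
   let H := fun (i : 'I_m) (x : T) => cot (pi * U i x / 2) in
   let c := 2 / pi in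
   let D := D_ (K_ rho) rho E w in
   0 < rho ->
   (forall i j, (i, j) \in E -> boundary_negligible P Y w r i j) ->
   remaining_faces_negligible P Y w E r ->
   (tail_prob P Y w =
      (fun t => t^-1 + D * r t) +o_ +oo r) /\
   (tail_prob P H w =
      (fun t => c / t + c `^ q_ rho * D * r t) +o_ +oo r))
  /\
  (let absRho := map_mx Num.norm Rho in
   let rho := rho_star absRho w in
   let E := E_star absRho w in
   let r := rate rho in
   let U := fun (i : 'I_m) (x : T) => 2 * (1 - Phi `|Z i x|) in
   let Y := fun (i : 'I_m) (x : T) => (U i x)^-1 in
   let H := fun (i : 'I_m) (x : T) => cot (pi * U i x / 2) in
   let c := 2 / pi in
   let D := D_ (2 `^ (1 - q_ rho) * K_ rho) rho E w in
   0 < rho ->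
   (forall i j, (i, j) \in E -> boundary_negligible P Y w r i j) ->
   remaining_faces_negligible P Y w E r ->
   (tail_prob P Y w =
      (fun t => t^-1 + D * r t) +o_ +oo r) /\
   (tail_prob P H w =
      (fun t => c / t + c `^ q_ rho * D * r t) +o_ +oo r)).
Proof.
have [_ R1 _] := posdef_Rho.
have rho_lt1 i j : i != j -> `|Rho i j| < 1 by exact: correlation_lt1.
split=> [rho E r U Y H c D rho0 boundary remaining|absRho rho E r U Y H c D rho0 boundary remaining].
- have rho1 : rho < 1.
    by apply: rho_star_lt1 => i j ij; apply: le_lt_trans (ler_norm _) (rho_lt1 _ _ ij).
  have rho01 : 0 < rho < 1 by rewrite rho0.
  have mu : measurable_fun setT (fun z : R => 1 - Phi z).
    by apply: measurable_funB => //; exact: continuous_measurable_fun (@continuous_Phi R).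
  have hP i j : (i, j) \in E -> forall h : measurableTypeR R * measurableTypeR R -> \bar R,
      measurable_fun setT h -> (forall p, 0 <= h p)%E ->
      (\int[P]_x h (score1 (Z i x), score1 (Z j x)) =
       \int[(@normal_prob R 0 1 \x @normal_prob R 0 1)%E]_p
         (h (score1 p.1, score1 p.2) * (gauss_copula rho p.1 p.2)%:E))%E.
    (* Membership in [E] makes the correlation of the pair equal to rho, so a single density serves
       all extremal pairs. *)
    rewrite inE => /andP[]; rewrite inE /= => /and3P[ij _ _] /eqP rE h mh h0; rewrite -[rho]rE.
    have nij : i != j by apply: contraTneq ij => ->; rewrite ltnn.
    exact: (copula_coordinates posdef_Rho normal_Z nij (measurable_score_pair is_score1 mh)).
  have marg i y : 1 <= y -> P [set x | y < score1 (Z i x)] = (y^-1)%:E.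
    by move=> y1; exact: (score_coordinate posdef_Rho normal_Z i is_score1 y1).
  have cst0 := copula_cst_gt0 rho01.
  have k1 := kernel_asymp1 rho01.
  have mk := measurable_gauss_copula rho.
  have r0 := rate_gt0_near rho.
  rewrite /D -K_E; split; apply: expansion_littleo => //; rewrite /r.
    exact: (score_sum_expansion simplex_w (@onem_Phi_itv R) (is_score1 (R := R)) rho01
      (@gauss_copula_ge0 R rho) mk k1 cst0 hP marg boundary remaining).
  exact: (half_cauchy_sum_expansion simplex_w mu (@onem_Phi_itv R) (is_score1 (R := R)) rho01
      (@gauss_copula_ge0 R rho) mk k1 cst0 hP marg boundary remaining).
- have rho1 : rho < 1 by apply: rho_star_lt1 => i j ij; rewrite mxE; exact: rho_lt1.
  have rho01 : 0 < rho < 1 by rewrite rho0.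
  have mu : measurable_fun setT (fun z : R => 2 * (1 - Phi `|z|)).
    apply: measurable_funM => //; apply: measurable_funB => //.
    have mPhi : measurable_fun setT (@Phi R) by exact: continuous_measurable_fun (@continuous_Phi R).
    by apply: (measurableT_comp mPhi).
  have hP i j : (i, j) \in E -> forall h : measurableTypeR R * measurableTypeR R -> \bar R,
      measurable_fun setT h -> (forall p, 0 <= h p)%E ->
      (\int[P]_x h (score2 (Z i x), score2 (Z j x)) =
       \int[(@normal_prob R 0 1 \x @normal_prob R 0 1)%E]_p
         (h (score2 p.1, score2 p.2) * (abs_copula rho p.1 p.2)%:E))%E.
    (* Only the absolute value of the correlation is known to be rho; evenness of [score2] allows
       the averaged density to be used for either sign. *)
    rewrite inE => /andP[]; rewrite inE /= => /and3P[ij _ _] /eqP rE h mh h0; rewrite -[rho]rE mxE.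
    have nij : i != j by apply: contraTneq ij => ->; rewrite ltnn.
    apply: (abs_copula_coordinates posdef_Rho normal_Z nij (measurable_score_pair is_score2 mh)) => //.
    by move=> x z /=; rewrite /score2 normrN.
  have marg i y : 1 <= y -> P [set x | y < score2 (Z i x)] = (y^-1)%:E.
    by move=> y1; exact: (score_coordinate posdef_Rho normal_Z i is_score2 y1).
  have cst0 : 0 < 2 `^ (1 - q_ rho) * copula_cst rho by rewrite mulr_gt0 ?powR_gt0// copula_cst_gt0.
  have k2 := kernel_asymp2 rho01.
  have mk : measurable_fun setT (fun p : measurableTypeR R * measurableTypeR R => abs_copula rho p.1 p.2).
    have mabs : measurable_fun setT (fun p : measurableTypeR R * measurableTypeR R =>
        (`|p.1|, `|p.2|) : measurableTypeR R * measurableTypeR R).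
      by apply: measurable_fun_pair; apply: measurableT_comp.
    apply: measurable_funM => //; apply: measurable_funD.
      exact: (measurableT_comp (measurable_gauss_copula rho) mabs).
    exact: (measurableT_comp (measurable_gauss_copula (- rho)) mabs).
  have k0 x z : 0 <= abs_copula rho x z by rewrite divr_ge0// addr_ge0// gauss_copula_ge0.
  have r0 := rate_gt0_near rho.
  (* The factor 2^(1 - q) belongs to the kernel constant, and (1 + rho)^2 is left for the masses. *)
  rewrite /D -K_E mulrA; split; apply: expansion_littleo => //; rewrite /r.
    exact: (score_sum_expansion simplex_w (@onem_Phi_norm_itv R) (is_score2 (R := R)) rho01
      k0 mk k2 cst0 hP marg boundary remaining).
  exact: (half_cauchy_sum_expansion simplex_w mu (@onem_Phi_norm_itv R) (is_score2 (R := R)) rho01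
      k0 mk k2 cst0 hP marg boundary remaining).
Qed.
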